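(* Assume the convergence condition for intertwining maps in $\mathcal{C}$, and let $W_1,W_2,W_3,W_4,M_1,M_2$ be objects of $\mathcal{C}$. (1) Let $\mathcal{Y}_1\in\mathcal{V}_{W_1M_1}^{W_4}$ and $\mathcal{Y}_2\in\mathcal{V}_{W_2W_3}^{M_1}$. For $w_{(1)}\in W_1$, $w_{(2)}\in W_2$, $w_{(3)}\in W_3$, $w'_{(4)}\in W_4'$ and $p,q\in\mathbb{Z}$, let $P_{p,q}(w_{(1)},w_{(2)};z_1,z_2)$ denote the sum of the absolutely convergent series $$\sum_{n\in\mathbb{R}}\Big(\langle w'_{(4)},\mathcal{Y}_1(w_{(1)},x_1)\pi_n(\mathcal{Y}_2(w_{(2)},x_2)w_{(3)})\rangle\Big|_{x_1^{m}=e^{ml_p(z_1)},\ \log x_1=l_p(z_1),\ x_2^{m}=e^{ml_q(z_2)},\ \log x_2=l_q(z_2)}\Big).$$ Then $P_{p,q}(w_{(1)},w_{(2)};z_1,z_2)$ is a single-valued analytic function on the region given by $|z_1|>|z_2|>0$ and $0<\arg z_1,\arg z_2<2\pi$, and for $k,l\in\mathbb{N}$, $$\frac{\partial^{k+l}}{\partial z_1^k\partial z_2^l}P_{p,q}(w_{(1)},w_{(2)};z_1,z_2)=P_{p,q}(L(-1)^kw_{(1)},L(-1)^lw_{(2)};z_1,z_2).$$ Moreover, the analytic functions $P_{p,q}(w_{(1)},w_{(2)};z_1,z_2)$ for different $p,q\in\mathbb{Z}$ are different branches of a multivalued analytic function defined on the region $|z_1|>|z_2|>0$ with the cut $\arg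 z_1=0$, $\arg z_2=0$; similarly, for each $k$ and $l$, for the analytic functions given by these derivatives. (2) Let $\mathcal{Y}^1\in\mathcal{V}_{M_2W_3}^{W_4}$ and $\mathcal{Y}^2\in\mathcal{V}_{W_1W_2}^{M_2}$. For $w_{(1)}\in W_1$, $w_{(2)}\in W_2$, $w_{(3)}\in W_3$, $w'_{(4)}\in W_4'$ and $p,q\in\mathbb{Z}$, let $Q_{p,q}(w_{(1)},w_{(2)};z_0,z_2)$ denote the sum of the absolutely convergent series $$\sum_{n\in\mathbb{R}}\Big(\langle w'_{(4)},\mathcal{Y}^1(\pi_n(\mathcal{Y}^2(w_{(1)},x_0)w_{(2)}),x_2)w_{(3)}\rangle\Big|_{x_0^{m}=e^{ml_p(z_0)},\ \log x_0=l_p(z_0),\ x_2^{m}=e^{ml_q(z_2)},\ \log x_2=l_q(z_2)}\Big).$$ Then $Q_{p,q}(w_{(1)},w_{(2)};z_0,z_2)$ is a single-valued analytic function on the region given by $|z_2|>|z_0|>0$ and $0<\arg z_0,\arg z_2<2\pi$, and for $k,l\in\mathbb{N}$, $$\frac{\partial^{k+l}}{\partial z_0^k\partial z_2^l}Q_{p,q}(w_{(1)},w_{(2)};z_0,z_2)=\sum_{j=0}^{l}\binom{l}{j}Q_{p,q}(L(-1)^{k+j}w_{(1)},L(-1)^{l-j}w_{(2)};z_0,z_2).$$ Moreover, the analytic functions $Q_{p,q}(w_{(1)},w_{(2)};z_0,z_2)$ for different $p,q\in\mathbb{Z}$ are different branches of a multivalued analytic function defined on the region $|z_2|>|z_0|>0$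 with the cut $\arg z_0=0$, $\arg z_2=0$; similarly, for each $k$ and $l$, for the analytic functions given by these derivatives.
   Context: All vector spaces are over $\mathbb{C}$; $\mathbb{N}=\{0,1,2,\dots\}$, $\mathbb{C}^{\times}=\mathbb{C}\setminus\{0\}$. Symbols $x,x_0,x_1,\dots$ are commuting formal variables; $\delta(x)=\sum_{n\in\mathbb{Z}}x^n$; powers of a binomial are expanded in nonnegative integral powers of its second term. Vertex algebras. A Möbius vertex algebra is a $\mathbb{Z}$-graded space $V=\coprod_{n}V_{(n)}$ with vertex operators $Y(v,x)=\sum_{n\in\mathbb{Z}}v_nx^{-n-1}$, $v_n\in\mathrm{End}\,V$, linear in $v$, a vacuum $\mathbf{1}\in V_{(0)}$, and operators $L(-1),L(0),L(1)$ on $V$ with $[L(m),L(n)]=(m-n)L(m+n)$, such that: $u_nv=0$ for $n$ large; $Y(\mathbf 1,x)=1$; $Y(v,x)\mathbf 1\in V[[x]]$ has constant term $v$; the Jacobi identity $x_0^{-1}\delta(\frac{x_1-x_2}{x_0})Y(u,x_1)Y(v,x_2)-x_0^{-1}\delta(\frac{x_2-x_1}{-x_0})Y(v,x_2)Y(u,x_1)=x_2^{-1}\delta(\frac{x_1-x_0}{x_2})Y(Y(u,x_0)v,x_2)$; $L(0)v=nv$ for $v\in V_{(n)}$; $\frac{d}{dx}Y(v,x)=Y(L(-1)v,x)$; and $[L(j),Y(v,x)]=\sum_{i=0}^{j+1}\binom{j+1}{i}x^iY(L(j-i)v,x)$ for $j=-1,0,1$. It is conformal if there is $\omega\in V_{(2)}$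 with $Y(\omega,x)=\sum_nL(n)x^{-n-2}$, the $L(n)$ satisfying the Virasoro relations and extending the given $L(0),L(\pm1)$. Standing assumption: $A\subset\tilde A$ are abelian groups, and $V$ is a strongly $A$-graded Möbius or conformal vertex algebra, i.e. $V=\coprod_{\alpha\in A}V^{(\alpha)}$ compatibly with the weight grading, $V^{(\alpha)}_{(n)}=V^{(\alpha)}\cap V_{(n)}$ is finite dimensional and is $0$ for $n$ sufficiently negative, $\mathbf 1\in V^{(0)}_{(0)}$, $v_lV^{(\beta)}\subset V^{(\alpha+\beta)}$ for $v\in V^{(\alpha)}$, $L(j)V^{(\alpha)}\subset V^{(\alpha)}$ for $j=0,\pm1$ (and $\omega\in V^{(0)}_{(2)}$ in the conformal case). Modules. A (strongly $\tilde A$-graded) generalized $V$-module is a space $W=\coprod_{n\in\mathbb{C}}W_{[n]}=\coprod_{\beta\in\tilde A}W^{(\beta)}$ (compatible gradings, $W^{(\beta)}_{[n]}=W^{(\beta)}\cap W_{[n]}$) with $Y_W(v,x)=\sum_nv_nx^{-n-1}$, $v_n\in\mathrm{End}\,W$, and operators $L(-1),L(0),L(1)$ on $W$ (the components of $Y_W(\omega,x)$ in the conformal case) satisfying the analogues on $W$ of truncation, vacuum, Jacobi, $\mathfrak{sl}(2)$, $L(-1)$-derivative and $L(j)$-bracket axioms, where $W_{[n]}$ is the generalized $L(0)$-eigenspace for $n$ (''generalized weight'' $n$), $v_lW^{(\beta)}\subset W^{(\alpha+\beta)}$ for $v\in V^{(\alpha)}$, $L(j)W^{(\beta)}\subset W^{(\beta)}$,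 $\dim W^{(\beta)}_{[n]}<\infty$, and $W^{(\beta)}_{[n+k]}=0$ for fixed $n,\beta$ and $k\in\mathbb{Z}$ sufficiently negative. It is a $V$-module (ordinary) if $L(0)$ acts semisimply. Morphisms preserve all structure including the $\tilde A$-grading. The contragredient is $W'=\coprod_{\beta,n}(W^{(\beta)}_{[n]})^*$, with $(W')^{(\beta)}=\coprod_n(W^{(-\beta)}_{[n]})^*$, $\langle Y'(v,x)w',w\rangle=\langle w',Y_W(e^{xL(1)}(-x^{-2})^{L(0)}v,x^{-1})w\rangle$ and $\langle L'(j)w',w\rangle=\langle w',L(-j)w\rangle$. The formal completion is $\overline W=\prod_{n\in\mathbb{C}}W_{[n]}$, with projections $\pi_n:\overline W\to W_{[n]}$ (also applied coefficientwise to formal series); it pairs with $W'$, the operators $v_n$, $L(j)$ extend to it, and $\overline{W^{(\beta)}}=\prod_nW^{(\beta)}_{[n]}$. Standing assumptions on $\mathcal{C}$: $\mathcal{C}$ is a full subcategory of $\mathcal{M}_{sg}$ (strongly $\tilde A$-graded $V$-modules) or of $\mathcal{GM}_{sg}$ (strongly $\tilde A$-graded generalized $V$-modules), closed under contragredients and finite direct sums; for each object of $\mathcal{C}$, all (generalized) weights are real and there is $K\in\mathbb{Z}_{+}$ with $(L(0)-L(0)_s)^K=0$ on it, where $L(0)_s$ acts on $W_{[n]}$ as $n$. $P(z)$-intertwining maps. Let $z\in\mathbb{C}^\times$ and let $W_1,W_2,W_3$ be generalized $V$-modules. $\mathcal{M}[P(z)]_{W_1W_2}^{W_3}$ is the space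 of $P(z)$-intertwining maps of type $\binom{W_3}{W_1W_2}$: linear maps $I:W_1\otimes W_2\to\overline{W_3}$ such that $I(W_1^{(\beta)}\otimes W_2^{(\gamma)})\subset\overline{W_3^{(\beta+\gamma)}}$; $\pi_{n-m}I(w_{(1)}\otimes w_{(2)})=0$ for $n\in\mathbb{C}$ and $m\in\mathbb{N}$ sufficiently large; $x_0^{-1}\delta(\frac{x_1-z}{x_0})Y_3(v,x_1)I(w_{(1)}\otimes w_{(2)})=z^{-1}\delta(\frac{x_1-x_0}{z})I(Y_1(v,x_0)w_{(1)}\otimes w_{(2)})+x_0^{-1}\delta(\frac{z-x_1}{-x_0})I(w_{(1)}\otimes Y_2(v,x_1)w_{(2)})$; and $L(j)I(w_{(1)}\otimes w_{(2)})=I(w_{(1)}\otimes L(j)w_{(2)})+\sum_{i=0}^{j+1}\binom{j+1}{i}z^iI(L(j-i)w_{(1)}\otimes w_{(2)})$ for $j=-1,0,1$. Convergence condition for intertwining maps in $\mathcal{C}$: for all objects $W_1,W_2,W_3,W_4,M_1$ of $\mathcal{C}$, all $|z_1|>|z_2|>0$, and all $I_1\in\mathcal{M}[P(z_1)]_{W_1M_1}^{W_4}$, $I_2\in\mathcal{M}[P(z_2)]_{W_2W_3}^{M_1}$, the series $\sum_{n\in\mathbb{C}}\langle w'_{(4)},I_1(w_{(1)}\otimes\pi_n(I_2(w_{(2)}\otimes w_{(3)})))\rangle$ converges absolutely for all $w_{(i)}\in W_i$, $w'_{(4)}\in W_4'$; equivalently, for all objects $W_1,W_2,W_3,W_4,M_2$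 of $\mathcal{C}$, all $|z_2|>|z_0|>0$, and all $I^1\in\mathcal{M}[P(z_2)]_{M_2W_3}^{W_4}$, $I^2\in\mathcal{M}[P(z_0)]_{W_1W_2}^{M_2}$, the series $\sum_{n\in\mathbb{C}}\langle w'_{(4)},I^1(\pi_n(I^2(w_{(1)}\otimes w_{(2)}))\otimes w_{(3)})\rangle$ always converges absolutely. Logarithmic intertwining operators. $\mathcal{V}_{W_1W_2}^{W_3}$ is the space of (grading-compatible) logarithmic intertwining operators of type $\binom{W_3}{W_1W_2}$: linear maps $\mathcal{Y}(\cdot,x)\cdot:W_1\otimes W_2\to W_3[\log x]\{x\}$, $\mathcal{Y}(w_{(1)},x)w_{(2)}=\sum_{n\in\mathbb{C}}\sum_{k\in\mathbb{N}}(w_{(1)})^{\mathcal{Y}}_{n;k}w_{(2)}\,x^{-n-1}(\log x)^k$ (finitely many $k$ for each $n$; $\log x$ a formal variable with $\frac{d}{dx}\log x=x^{-1}$), such that $(w_{(1)})^{\mathcal{Y}}_{n+m;k}w_{(2)}=0$ for $m\in\mathbb{N}$ large, independently of $k$; $x_0^{-1}\delta(\frac{x_1-x_2}{x_0})Y_3(v,x_1)\mathcal{Y}(w_{(1)},x_2)w_{(2)}-x_0^{-1}\delta(\frac{x_2-x_1}{-x_0})\mathcal{Y}(w_{(1)},x_2)Y_2(v,x_1)w_{(2)}=x_2^{-1}\delta(\frac{x_1-x_0}{x_2})\mathcal{Y}(Y_1(v,x_0)w_{(1)},x_2)w_{(2)}$; $\mathcal{Y}(L(-1)w_{(1)},x)=\frac{d}{dx}\mathcal{Y}(w_{(1)},x)$;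 $L(j)\mathcal{Y}(w_{(1)},x)w_{(2)}-\mathcal{Y}(w_{(1)},x)L(j)w_{(2)}=\sum_{i=0}^{j+1}\binom{j+1}{i}x^i\mathcal{Y}(L(j-i)w_{(1)},x)w_{(2)}$ for $j=0,\pm1$; and $(w_{(1)})^{\mathcal{Y}}_{n;k}w_{(2)}\in W_3^{(\beta+\gamma)}$ for $w_{(1)}\in W_1^{(\beta)}$, $w_{(2)}\in W_2^{(\gamma)}$. Branches. For $z\in\mathbb{C}^\times$, $\log z=\log|z|+i\arg z$ with $0\le\arg z<2\pi$, and $l_p(z)=\log z+2\pi ip$ for $p\in\mathbb{Z}$. In the series in the claim, each term (fixed $n$) is a finite sum of monomials in the formal variables and their logarithms, into which the indicated numbers are substituted ($m$ ranging over the exponents that occur). *)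

(* Defs.v *)
From HB Require Import structures.
From mathcomp Require Import all_boot all_order all_algebra.
From mathcomp Require Import complex.
From mathcomp Require Import all_classical all_reals all_analysis.

Set Implicit Arguments.
Unset Strict Implicit.
Unset Printing Implicit Defensive.

Import Order.TTheory GRing.Theory Num.Theory.
Import numFieldNormedType.Exports.

Local Open Scope classical_set_scope.
Local Open Scope ring_scope.
Local Open Scope complex_scope.

(* The complex numbers are R[i] for a realType R. *)

Definition abs_cvg {R : realType} {I : choiceType} (f : I -> R[i]) : Prop :=
  summable [set: I] (fun i => (complex.Re `|f i|)%:E).

Definition sumR {R : realType} {I : choiceType} (g : I -> R) : R :=
  fine (\esum_(i in [set: I]) (Num.max (g i) 0)%:E)
  - fine (\esum_(i in [set: I]) (Num.max (- g i) 0)%:E).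

(* The sum of the family f, meaningful when abs_cvg f. *)
Definition sumC {R : realType} {I : choiceType} (f : I -> R[i]) : R[i] :=
  sumR (fun i => complex.Re (f i)) +i* sumR (fun i => complex.Im (f i)).

Definition cexp {R : realType} (z : R[i]) : R[i] :=
  (expR (complex.Re z) * cos (complex.Im z))
    +i* (expR (complex.Re z) * sin (complex.Im z)).

(* For z != 0, the argument of z in [0, 2 pi[. *)
Definition carg {R : realType} (z : R[i]) : R :=
  let t := acos (complex.Re z / complex.Re `|z|) in
  if 0 <= complex.Im z then t else 2 * pi - t.

Definition clog {R : realType} (z : R[i]) : R[i] :=
  ln (complex.Re `|z|) +i* carg z.

Definition lbranch {R : realType} (p : int) (z : R[i]) : R[i] :=
  clog z + (2 * pi * p%:~R) *i.

Definition analytic2_at {R : realType} (f : R[i] -> R[i] -> R[i])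
    (a b : R[i]) : Prop :=
  exists (c : nat -> nat -> R[i]) (r : R), 0 < r /\
    forall h k : R[i], `|h| < r%:C -> `|k| < r%:C ->
      let t := fun ij : nat * nat => c ij.1 ij.2 * h ^+ ij.1 * k ^+ ij.2 in
      abs_cvg t /\ f (a + h) (b + k) = sumC t.

(* Meant for open D. *)
Definition analytic2_on {R : realType} (D : set (R[i] * R[i]))
    (f : R[i] -> R[i] -> R[i]) : Prop :=
  forall a b, D (a, b) -> analytic2_at f a b.

Definition pderiv1 {R : realType} (f : R[i] -> R[i] -> R[i]) (z1 z2 : R[i])
  : R[i] := 'D_1 (fun z : R[i]^o => f z z2 : R[i]^o) z1.

Definition pderiv2 {R : realType} (f : R[i] -> R[i] -> R[i]) (z1 z2 : R[i])
  : R[i] := 'D_1 (fun z : R[i]^o => f z1 z : R[i]^o) z2.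

Definition pderiv {R : realType} (k l : nat) (f : R[i] -> R[i] -> R[i])
  : R[i] -> R[i] -> R[i] := iter k pderiv1 (iter l pderiv2 f).

Definition region_fst_gt {R : realType} : set (R[i] * R[i]) :=
  [set z | `|z.1| > `|z.2| /\ `|z.2| > 0].

Definition region_snd_gt {R : realType} : set (R[i] * R[i]) :=
  [set z | `|z.2| > `|z.1| /\ `|z.1| > 0].

Definition cut_region {R : realType} (D : set (R[i] * R[i]))
  : set (R[i] * R[i]) :=
  D `&` [set z | 0 < carg z.1 < 2 * pi /\ 0 < carg z.2 < 2 * pi].

(* For D inside (C^x)^2, a multivalued analytic function on D is an analytic  *)
(* function F on its covering space {(s, t) | (e^s, e^t) in D}, which is      *)
(* convex, so the universal covering, when D is one of the two regions above. *)
(* Its branches on D cut along arg z_1 = 0, arg z_2 = 0 are its pullbacks by  *)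
(* the sections (l_p, l_q), so they are analytic continuations of each other. *)
Definition multivalued_branches {R : realType} (D : set (R[i] * R[i]))
    (f : int -> int -> R[i] -> R[i] -> R[i]) : Prop :=
  exists F : R[i] -> R[i] -> R[i],
    analytic2_on [set s | D (cexp s.1, cexp s.2)] F /\
    forall (p q : int) (z1 z2 : R[i]), cut_region D (z1, z2) ->
      f p q z1 z2 = F (lbranch p z1) (lbranch q z2).

(* A decomposition W = \coprod_(i in I) W_i, given by its projections. *)
Record grading {R : realType} (I : choiceType) (W : lmodType R[i]) := Grading {
  gproj :> I -> {linear W -> W} ;
  gproj_orth : forall i j w,
    gproj i (gproj j w) = if i == j then gproj j w else 0 ;
  gproj_finite : forall w, finite_set [set i | gproj i w != 0] ;
  gproj_sum : forall w, \sum_(i \in [set: I]) gproj i w = w }.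

Definition homog {R : realType} {I : choiceType} {W : lmodType R[i]}
  (g : grading I W) (i : I) : set W := [set w | g i w = w].

Definition compatible {R : realType} {I J : choiceType} {W : lmodType R[i]}
    (g : grading I W) (h : grading J W) : Prop :=
  forall i j w, g i (h j w) = h j (g i w).

Definition fin_dim {R : realType} {W : lmodType R[i]} (S : set W) : Prop :=
  exists s : seq W, forall w, S w ->
    exists c : nat -> R[i], w = \sum_(i < size s) c i *: s`_i.

Record sl2_ops {R : realType} (W : lmodType R[i]) := Sl2Ops {
  Lneg1 : {linear W -> W} ; Lzero : {linear W -> W} ; Lone : {linear W -> W} }.

(* L(j), only used for j = -1, 0, 1. *)
Definition Lop {R : realType} {W : lmodType R[i]} (L : sl2_ops W) (j : int)
    (w : W) : W :=
  if j == -1 then Lneg1 L w else if j == 0 then Lzero L w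
  else if j == 1 then Lone L w else 0.

Definition is_j (j : int) : Prop := [\/ j = -1, j = 0 | j = 1].

Definition sl2_relations {R : realType} {W : lmodType R[i]} (L : sl2_ops W)
  : Prop :=
  forall (m n : int) (w : W), is_j m -> is_j n ->
    Lop L m (Lop L n w) - Lop L n (Lop L m w) = (m - n)%:~R *: Lop L (m + n) w.

Definition binomz {R : realType} (n : int) (i : nat) : R[i] :=
  (\prod_(j < i) (n - j%:Z)%:~R) / (i`!)%:R.

(* The coefficient of x^(n - i) y^i in (x - y)^n. *)
Definition xmy {R : realType} (n : int) (i : nat) : R[i] :=
  (-1) ^+ i * binomz n i.

(* Below Y(v, x) = \sum_n (Y v n) x^(-n-1). In jacobi and Lbracket,           *)
(* op(w1, x) w2 = \sum_n (op w1 n w2) x^(-n-1), with n in int for a vertex    *)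
(* operator and n in C for (the coefficient of a power of log x in) an        *)
(* intertwining operator.                                                     *)

(* The coefficient of x0^(-l-1) x1^(-m-1) x2^(-n-1) in the Jacobi identity    *)
(*   x0^-1 delta((x1 - x2) / x0) Y3(v, x1) op(w1, x2) w2                      *)
(*   - x0^-1 delta((x2 - x1) / - x0) op(w1, x2) Y2(v, x1) w2                  *)
(*   = x2^-1 delta((x1 - x0) / x2) op(Y1(v, x0) w1, x2) w2;                   *)
(* the three sums have finite support when Y1, Y2 and op are truncated.       *)
Definition jacobi {R : realType} {K : pzRingType} {V W1 W2 W3 : lmodType R[i]}
    (Y1 : V -> int -> W1 -> W1) (Y2 : V -> int -> W2 -> W2)
    (Y3 : V -> int -> W3 -> W3) (op : W1 -> K -> W2 -> W3) : Prop :=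
  forall (v : V) (w1 : W1) (w2 : W2) (l m : int) (n : K),
    \sum_(i \in [set: nat])
       xmy l i *: Y3 v (m + l - i%:Z) (op w1 (n + i%:R) w2)
    - (-1) ^ l *: \sum_(i \in [set: nat])
       xmy l i *: op w1 (n + l%:~R - i%:R) (Y2 v (m + i%:Z) w2)
    = \sum_(i \in [set: nat])
       xmy (i%:Z - m - 1) i *:
         op (Y1 v (l + i%:Z) w1) (n + m%:~R - i%:R) w2.

Definition Lbracket {R : realType} {K : pzRingType} {W1 W2 W3 : lmodType R[i]}
    (L1 : sl2_ops W1) (L2 : sl2_ops W2) (L3 : sl2_ops W3)
    (op : W1 -> K -> W2 -> W3) : Prop :=
  forall (j : int) (w1 : W1) (w2 : W2) (n : K), is_j j ->
    Lop L3 j (op w1 n w2) - op w1 n (Lop L2 j w2)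
    = \sum_(i < (absz (j + 1)).+1)
        'C(absz (j + 1), i)%:R *: op (Lop L1 (j - i%:Z) w1) (n + i%:R) w2.

Record vertex_algebra (R : realType) (A : zmodType) := VertexAlgebra {
  va_sort :> lmodType R[i] ;
  va_wt : grading int va_sort ;
  va_ch : grading A va_sort ;
  va_Y : va_sort -> int -> {linear va_sort -> va_sort} ;
  va_vac : va_sort ;
  va_L : sl2_ops va_sort ;
  (* Some omega in the conformal case, None in the Moebius case *)
  va_omega : option va_sort ;

  va_Y_linear : forall n v, linear (fun u => va_Y u n v) ;
  va_sl2 : sl2_relations va_L ;
  va_trunc : forall u v, exists N : int, forall n, N <= n -> va_Y u n v = 0 ;
  va_vacuum : forall n v, va_Y va_vac n v = if n == -1 then v else 0 ;
  va_creation : forall v, va_Y v (-1) va_vac = v ;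
  va_creation0 : forall v n, 0 <= n -> va_Y v n va_vac = 0 ;
  va_jacobi : jacobi va_Y va_Y va_Y va_Y ;
  va_L0 : forall n v, homog va_wt n v -> Lop va_L 0 v = n%:~R *: v ;
  va_Lneg1 : forall v n u,
    va_Y (Lop va_L (-1) v) n u = - n%:~R *: va_Y v (n - 1) u ;
  va_Lbracket : Lbracket va_L va_L va_L va_Y ;

  va_compatible : compatible va_ch va_wt ;
  va_fin_dim : forall a n, fin_dim (homog va_ch a `&` homog va_wt n) ;
  va_bounded : forall a, exists N : int, forall n, n < N ->
    homog va_ch a `&` homog va_wt n `<=` [set 0] ;
  va_vac_comp : homog va_ch 0 va_vac /\ homog va_wt 0 va_vac ;
  va_Y_ch : forall a b u n v, homog va_ch a u -> homog va_ch b v ->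
    homog va_ch (a + b) (va_Y u n v) ;
  va_L_ch : forall a j v, is_j j -> homog va_ch a v ->
    homog va_ch a (Lop va_L j v) ;

  (* L(n) is the coefficient of x^(-n-2) in Y(omega, x) *)
  va_conformal : forall omega, va_omega = Some omega ->
    [/\ homog va_ch 0 omega,
        homog va_wt 2 omega,
        forall j v, is_j j -> Lop va_L j v = va_Y omega (j + 1) v
      & exists c : R[i], forall (m n : int) v,
          va_Y omega (m + 1) (va_Y omega (n + 1) v)
          - va_Y omega (n + 1) (va_Y omega (m + 1) v)
          = (m - n)%:~R *: va_Y omega (m + n + 1) v
            + (if m + n == 0 then (m ^+ 3 - m)%:~R / 12 * c else 0) *: v] }.

Section Modules.
(* A is a subgroup of At through the embedding iota. *)
Context {R : realType} {A At : zmodType} (iota : {additive A -> At}).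
Context (V : vertex_algebra R A).
Local Notation C := R[i].

Record gmodule := GModule {
  gm_sort :> lmodType C ;
  gm_wt : grading C gm_sort ;
  gm_ch : grading At gm_sort ;
  gm_Y : V -> int -> {linear gm_sort -> gm_sort} ;
  gm_L : sl2_ops gm_sort ;

  gm_Y_linear : forall n w, linear (fun v => gm_Y v n w) ;
  gm_sl2 : sl2_relations gm_L ;
  gm_trunc : forall v w, exists N : int, forall n, N <= n -> gm_Y v n w = 0 ;
  gm_vacuum : forall n w, gm_Y (va_vac V) n w = if n == -1 then w else 0 ;
  gm_jacobi : jacobi (@va_Y R A V) gm_Y gm_Y gm_Y ;
  gm_Lneg1 : forall v n w,
    gm_Y (Lop (va_L V) (-1) v) n w = - n%:~R *: gm_Y v (n - 1) w ;
  gm_Lbracket : Lbracket (va_L V) gm_L gm_L gm_Y ;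
  gm_conformal : forall omega, va_omega V = Some omega ->
    forall j w, is_j j -> Lop gm_L j w = gm_Y omega (j + 1) w ;

  gm_weight : forall n w, homog gm_wt n w <->
    exists k : nat, iter k (fun u => Lop gm_L 0 u - n *: u) w = 0 ;
  gm_compatible : compatible gm_ch gm_wt ;
  gm_Y_ch : forall a b v n w, homog (va_ch V) a v -> homog gm_ch b w ->
    homog gm_ch (iota a + b) (gm_Y v n w) ;
  gm_L_ch : forall b j w, is_j j -> homog gm_ch b w ->
    homog gm_ch b (Lop gm_L j w) ;
  gm_fin_dim : forall b n, fin_dim (homog gm_ch b `&` homog gm_wt n) ;
  gm_bounded : forall b n, exists N : int, forall k : int, k < N ->
    homog gm_ch b `&` homog gm_wt (n + k%:~R) `<=` [set 0] }.

(* Elements of the contragredient space \coprod_(b, n) (W^(b)_[n])^*, as      *)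
(* linear functionals on W.                                                   *)
Definition graded_dual (W : gmodule) (f : {scalar W}) : Prop :=
  finite_set [set bn : At * C | exists w, f (gm_ch W bn.1 (gm_wt W bn.2 w)) != 0].

Record gmodule_hom (W W' : gmodule) (f : {linear W -> W'}) : Prop := {
  hom_Y : forall v n w, f (gm_Y W v n w) = gm_Y W' v n (f w) ;
  hom_L : forall j w, is_j j -> f (Lop (gm_L W) j w) = Lop (gm_L W') j (f w) ;
  hom_wt : forall n w, homog (gm_wt W) n w -> homog (gm_wt W') n (f w) ;
  hom_ch : forall b w, homog (gm_ch W) b w -> homog (gm_ch W') b (f w) }.

(* W' is isomorphic, through ev, to the contragredient of W. In ctr_Y, the    *)
(* right-hand side is the coefficient of x^(-n-1) in                          *)
(* <w', Y_W(e^(x L(1)) (- x^-2)^L(0) v, x^-1) w>, for v of weight k.          *)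
Record is_contragredient (W W' : gmodule) (ev : W' -> {scalar W}) : Prop := {
  ctr_linear : forall w, scalar (fun w' => ev w' w) ;
  ctr_inj : forall w', (forall w, ev w' w = 0) -> w' = 0 ;
  ctr_dual : forall f : {scalar W},
    graded_dual f <-> exists w', forall w, ev w' w = f w ;
  ctr_wt : forall n w', homog (gm_wt W') n w' <->
    forall m w, homog (gm_wt W) m w -> m <> n -> ev w' w = 0 ;
  ctr_ch : forall b w', homog (gm_ch W') b w' <->
    forall c w, homog (gm_ch W) c w -> c <> - b -> ev w' w = 0 ;
  ctr_L : forall j w' w, is_j j ->
    ev (Lop (gm_L W') j w') w = ev w' (Lop (gm_L W) (- j) w) ;
  ctr_Y : forall k v, homog (va_wt V) k v -> forall n w' w,
    ev (gm_Y W' v n w') w =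
    (-1) ^ k * \sum_(i \in [set: nat]) (i`!)%:R^-1
      * ev w' (gm_Y W (iter i (Lop (va_L V) 1) v) (2 * k - i%:Z - n - 2) w) }.

Definition is_direct_sum (n : nat) (Ws : 'I_n -> gmodule) (W : gmodule) : Prop :=
  exists p : forall i, {linear W -> Ws i},
    (forall i, gmodule_hom (p i)) /\
    forall ws : forall i, Ws i, exists! w, forall i, p i w = ws i.

(* The standing assumptions on a full subcategory, given by its class of      *)
(* objects. The modules with L(0) semisimple being a full subcategory of the  *)
(* generalized modules, a full subcategory of either is one of the latter.    *)
Record standing (cat : gmodule -> Prop) : Prop := {
  st_contragredient : forall W, cat W ->
    exists W' ev, cat W' /\ @is_contragredient W W' ev ;
  st_direct_sum : forall n (Ws : 'I_n -> gmodule), (forall i, cat (Ws i)) ->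
    exists W, cat W /\ is_direct_sum Ws W ;
  st_real : forall W, cat W -> forall n w,
    homog (gm_wt W) n w -> w <> 0 -> n \is Num.real ;
  st_nilpotent : forall W, cat W -> exists K : nat, (0 < K)%N /\ forall w : W,
    iter K (fun u => Lop (gm_L W) 0 u
                     - \sum_(n \in [set: C]) n *: gm_wt W n u) w = 0 }.

(* An element of the completion \prod_n W_[n] is a family f : C -> W with     *)
(* f n in W_[n], so that pi_n f is f n.                                       *)
Definition in_completion (W : gmodule) (f : C -> W) : Prop :=
  forall n, homog (gm_wt W) n (f n).

(* The extension to the completion of an operator T = v_m or L(j); such a T   *)
(* changes weights by finitely many values, so the sum has finite support.    *)
Definition ext (W : gmodule) (T : W -> W) (f : C -> W) : C -> W :=
  fun n => \sum_(k \in [set: C]) gm_wt W n (T (f k)).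

Definition pairing (W : gmodule) (w' : {scalar W}) (f : C -> W) : C :=
  \sum_(n \in [set: C]) w' (f n).

(* P(z)-intertwining maps W1 (x) W2 -> \overline{W3}, as bilinear maps.       *)
(* pz_jacobi is the coefficient of x0^(-l-1) x1^(-m-1) in                     *)
(*   x0^-1 delta((x1 - z) / x0) Y3(v, x1) I(w1 (x) w2)                        *)
(*   = z^-1 delta((x1 - x0) / z) I(Y1(v, x0) w1 (x) w2)                       *)
(*   + x0^-1 delta((z - x1) / - x0) I(w1 (x) Y2(v, x1) w2),                   *)
(* projected to W3_[n].                                                       *)
Record intertwining_map (z : C) (W1 W2 W3 : gmodule) (I : W1 -> W2 -> C -> W3)
  : Prop := {
  pz_completion : forall w1 w2, in_completion (I w1 w2) ;
  pz_linear1 : forall w2 n, linear (fun w1 => I w1 w2 n) ;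
  pz_linear2 : forall w1 n, linear (fun w2 => I w1 w2 n) ;
  pz_ch : forall b c w1 w2 n, homog (gm_ch W1) b w1 -> homog (gm_ch W2) c w2 ->
    homog (gm_ch W3) (b + c) (I w1 w2 n) ;
  pz_trunc : forall w1 w2 n, exists N : nat, forall m : nat, (N <= m)%N ->
    I w1 w2 (n - m%:R) = 0 ;
  pz_jacobi : forall v w1 w2 (l m : int) (n : C),
    \sum_(i \in [set: nat])
       (xmy l i * z ^+ i) *: ext (gm_Y W3 v (m + l - i%:Z)) (I w1 w2) n
    = \sum_(i \in [set: nat])
       (xmy (i%:Z - m - 1) i * z ^ (m - i%:Z)) *:
         I (gm_Y W1 v (l + i%:Z) w1) w2 n
      + (-1) ^ l *: \sum_(i \in [set: nat])
       (xmy l i * z ^ (l - i%:Z)) *: I w1 (gm_Y W2 v (m + i%:Z) w2) n ;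
  pz_Lbracket : forall j w1 w2 n, is_j j ->
    ext (Lop (gm_L W3) j) (I w1 w2) n
    = I w1 (Lop (gm_L W2) j w2) n
      + \sum_(i < (absz (j + 1)).+1)
          ('C(absz (j + 1), i)%:R * z ^+ i) *:
            I (Lop (gm_L W1) (j - i%:Z) w1) w2 n }.

Definition convergence_condition (cat : gmodule -> Prop) : Prop :=
  forall W1 W2 W3 W4 M1 : gmodule,
    cat W1 -> cat W2 -> cat W3 -> cat W4 -> cat M1 ->
  forall z1 z2 : C, `|z1| > `|z2| -> `|z2| > 0 ->
  forall (I1 : W1 -> M1 -> C -> W4) (I2 : W2 -> W3 -> C -> M1),
    intertwining_map z1 I1 -> intertwining_map z2 I2 ->
  forall (w1 : W1) (w2 : W2) (w3 : W3) (w4' : {scalar W4}), graded_dual w4' ->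
    abs_cvg (fun n : C => pairing w4' (I1 w1 (I2 w2 w3 n))).

(* Y(w1, x) w2 = \sum_n \sum_k (Y w1 n k w2) x^(-n-1) (log x)^k               *)
Record log_intertwining (W1 W2 W3 : gmodule) (Y : W1 -> C -> nat -> W2 -> W3)
  : Prop := {
  li_linear1 : forall n k w2, linear (fun w1 => Y w1 n k w2) ;
  li_linear2 : forall w1 n k, linear (Y w1 n k) ;
  li_log : forall w1 w2 n, exists K : nat, forall k, (K <= k)%N ->
    Y w1 n k w2 = 0 ;
  li_trunc : forall w1 w2 n, exists N : nat, forall m : nat, (N <= m)%N ->
    forall k, Y w1 (n + m%:R) k w2 = 0 ;
  li_jacobi : forall k, jacobi (gm_Y W1) (gm_Y W2) (gm_Y W3)
    (fun w1 n w2 => Y w1 n k w2) ;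
  li_Lneg1 : forall w1 n k w2, Y (Lop (gm_L W1) (-1) w1) n k w2
    = - n *: Y w1 (n - 1) k w2 + k.+1%:R *: Y w1 (n - 1) k.+1 w2 ;
  li_Lbracket : forall k, Lbracket (gm_L W1) (gm_L W2) (gm_L W3)
    (fun w1 n w2 => Y w1 n k w2) ;
  li_ch : forall b c w1 w2 n k, homog (gm_ch W1) b w1 -> homog (gm_ch W2) c w2 ->
    homog (gm_ch W3) (b + c) (Y w1 n k w2) }.

(* The value of x^(-n-1) (log x)^k, where nk = (n, k), at log x = s. *)
Definition mono (nk : C * nat) (s : C) : C :=
  cexp ((- nk.1 - 1) * s) * s ^+ nk.2.

(* The n-th terms of the two series, at log x_i = s_i; for fixed n only       *)
(* finitely many pairs of monomials contribute.                               *)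
Definition product_term (W1 W2 W3 W4 M1 : gmodule)
    (Y1 : W1 -> C -> nat -> M1 -> W4) (Y2 : W2 -> C -> nat -> W3 -> M1)
    (w3 : W3) (w4' : {scalar W4}) (w1 : W1) (w2 : W2) (s1 s2 : C) (n : R) : C :=
  \sum_(t \in [set: (C * nat) * (C * nat)])
    w4' (Y1 w1 t.1.1 t.1.2 (gm_wt M1 n%:C (Y2 w2 t.2.1 t.2.2 w3)))
    * mono t.1 s1 * mono t.2 s2.

Definition iterate_term (W1 W2 W3 W4 M2 : gmodule)
    (Y1 : M2 -> C -> nat -> W3 -> W4) (Y2 : W1 -> C -> nat -> W2 -> M2)
    (w3 : W3) (w4' : {scalar W4}) (w1 : W1) (w2 : W2) (s0 s2 : C) (n : R) : C :=
  \sum_(t \in [set: (C * nat) * (C * nat)])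
    w4' (Y1 (gm_wt M2 n%:C (Y2 w1 t.1.1 t.1.2 w2)) t.2.1 t.2.2 w3)
    * mono t.1 s0 * mono t.2 s2.

Definition product_sum (W1 W2 W3 W4 M1 : gmodule)
    (Y1 : W1 -> C -> nat -> M1 -> W4) (Y2 : W2 -> C -> nat -> W3 -> M1)
    (w3 : W3) (w4' : {scalar W4}) (p q : int) (w1 : W1) (w2 : W2) (z1 z2 : C)
  : C := sumC (product_term Y1 Y2 w3 w4' w1 w2 (lbranch p z1) (lbranch q z2)).

Definition iterate_sum (W1 W2 W3 W4 M2 : gmodule)
    (Y1 : M2 -> C -> nat -> W3 -> W4) (Y2 : W1 -> C -> nat -> W2 -> M2)
    (w3 : W3) (w4' : {scalar W4}) (p q : int) (w1 : W1) (w2 : W2) (z0 z2 : C)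
  : C := sumC (iterate_term Y1 Y2 w3 w4' w1 w2 (lbranch p z0) (lbranch q z2)).

End Modules.

(* Main.v *)
(* Write s_i = log z_i. On homogeneous vectors the n-th term of the product is a
   polynomial in s_1 and s_2, of degree bounded independently of n because
   L(0) - L(0)_s is nilpotent, times a fixed exponential times e^(n (s_2 - s_1)).
   A logarithmic intertwining operator at log x = s is a P(e^s)-intertwining map,
   so the convergence condition applies at all s_1, s_2 with Re s_2 < Re s_1. As
   their imaginary parts are free, Vandermonde interpolation separates the powers
   of s_1 and s_2, and leaves absolutely convergent general Dirichlet series in
   s_2 - s_1, which are analytic and can be differentiated termwise. The sum is
   thus one analytic function on Re s_2 < Re s_1, the covering of
   |z_1| > |z_2| > 0, whose pullbacks by (l_p, l_q) are the branches, and the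
   L(-1)-derivative property gives their derivatives. Iterates reduce to products
   by the skew symmetry (w_2, w_1) |-> e^(-z L(-1)) I(w_1, w_2) of intertwining
   maps, where the convergence condition is only stated for products. *)

Require Import Defs.
From HB Require Import structures.
From mathcomp Require Import all_boot all_order all_algebra.
From mathcomp Require Import complex.
From mathcomp Require Import all_classical all_reals all_analysis.
From mathcomp Require Import ring lra zify.

Set Implicit Arguments.
Unset Strict Implicit.
Unset Printing Implicit Defensive.

Import Order.TTheory GRing.Theory Num.Theory.
Import numFieldNormedType.Exports.

Local Open Scope classical_set_scope.
Local Open Scope ring_scope.
Local Open Scope complex_scope.

(** * Sums of families *)

(** The convergence condition is pointwise and nothing uniform is assumed; moreover the weights that
    occur need not lie in finitely many classes modulo the integers, so the series has no natural
    order and is no power series in disguise. Sums are therefore unordered throughout, and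
    uniformity is produced by comparison: near t the terms of a general Dirichlet series are
    controlled by those at the two points t + |h| and t - |h|. Being analytic means having a local
    double power series expansion, so sums, products and compositions of analytic functions reduce
    to rearranging absolutely convergent families, with no contour integrals. The derivative with
    respect to z is e^(-s) times that with respect to s, and it is compared with the
    L(-1)-derivative property term by term. For iterates this comparison shifts the index: L(-1)
    raises the weight of the intermediate vector by one, so the z_2-derivative of the n-th term is
    made of (n + 1)-th terms of the two new series, which an unordered sum does not notice. *)

Definition nm {R : realType} (z : R[i]) : R := complex.Re `|z|.

Section Modulus.
Context {R : realType}.
Implicit Types x y z : R[i].

Lemma normE z : `|z| = (nm z)%:C. Proof. by rewrite /nm normc_def. Qed.

Lemma nm_ge0 z : 0 <= nm z. Proof. by rewrite -ler0c -normE. Qed.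

Lemma nm0 : nm (0 : R[i]) = 0. Proof. by rewrite /nm normr0. Qed.

Lemma nm1 : nm (1 : R[i]) = 1. Proof. by rewrite /nm normr1. Qed.

Lemma nmM x y : nm (x * y) = nm x * nm y.
Proof. by apply: complexI; rewrite rmorphM/= -!normE normrM. Qed.

Lemma nmX x n : nm (x ^+ n) = nm x ^+ n.
Proof. by elim: n => [|n IH]; rewrite ?expr0 ?nm1// !exprS nmM IH. Qed.

Lemma nmN x : nm (- x) = nm x. Proof. by rewrite /nm normrN. Qed.

Lemma nmV x : nm x^-1 = (nm x)^-1.
Proof. by apply: complexI; rewrite fmorphV/= -!normE normfV. Qed.

Lemma nmD x y : nm (x + y) <= nm x + nm y.
Proof. by rewrite -lecR rmorphD/= -!normE ler_normD. Qed.

Lemma nm_eq0 x : (nm x == 0) = (x == 0).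
Proof. by rewrite -(inj_eq (@complexI R)) -normE normr_eq0. Qed.

Lemma nm_gt0 x : (0 < nm x) = (x != 0).
Proof. by rewrite lt_def nm_ge0 andbT nm_eq0. Qed.

Lemma nmC (a : R) : nm a%:C = `|a|.
Proof. by rewrite /nm normc_def/= expr0n/= addr0 sqrtr_sqr. Qed.

Lemma normlt x (r : R) : (`|x| < r%:C) = (nm x < r).
Proof. by rewrite normE ltcR. Qed.

Lemma Re_le_nm x : `|complex.Re x| <= nm x.
Proof. by rewrite -lecR -normE normc_ge_Re. Qed.

Lemma Im_le_nm x : `|complex.Im x| <= nm x.
Proof.
have := Re_le_nm (x * 'i%C); rewrite ReiNIm normrN nmM.
by rewrite {2}/nm normc_def/= expr0n expr1n/= add0r sqrtr1 mulr1.
Qed.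

Lemma nm_le_ReIm x : nm x <= `|complex.Re x| + `|complex.Im x|.
Proof.
rewrite {1}[x]complexE; apply: (le_trans (nmD _ _)).
rewrite nmM !nmC lerD2l {1}/nm normc_def/= expr0n expr1n/= add0r sqrtr1 mul1r//.
Qed.

Lemma nm_prod I (r : seq I) (F : I -> R[i]) :
  nm (\prod_(i <- r) F i) = \prod_(i <- r) nm (F i).
Proof.
by elim: r => [|i r IH]; rewrite ?big_nil ?nm1// !big_cons nmM IH.
Qed.

End Modulus.

(** * Unordered sums of nonnegative families, with values in the extended reals *)

Definition nsum {R : realType} {I : choiceType} (g : I -> R) : \bar R :=
  \esum_(i in [set: I]) (g i)%:E.

Section NonnegativeSums.
Context {R : realType}.
Local Open Scope ereal_scope.

Lemma nsum_ge0 (I : choiceType) (g : I -> R) :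
  (forall i, 0 <= g i)%R -> 0 <= nsum g.
Proof. by move=> g0; apply: esum_ge0 => i _; rewrite lee_fin. Qed.

Lemma le_nsum (I : choiceType) (g h : I -> R) :
  (forall i, g i <= h i)%R -> nsum g <= nsum h.
Proof. by move=> gh; apply: le_esum => i _; rewrite lee_fin. Qed.

Lemma eq_nsum (I : choiceType) (g h : I -> R) : g =1 h -> nsum g = nsum h.
Proof. by move=> gh; apply: eq_esum => i _; rewrite gh. Qed.

Lemma nsumD (I : choiceType) (g h : I -> R) :
  (forall i, 0 <= g i)%R -> (forall i, 0 <= h i)%R ->
  nsum (fun i => g i + h i)%R = nsum g + nsum h.
Proof.
move=> g0 h0; rewrite /nsum -esumD; last 2 first.
- by move=> i _; rewrite lee_fin.
- by move=> i _; rewrite lee_fin.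
by apply: eq_esum => i _; rewrite EFinD.
Qed.

Lemma nsum_fin (I : choiceType) (g : I -> R) :
  (forall i, 0 <= g i)%R -> nsum g < +oo -> (fine (nsum g))%:E = nsum g.
Proof. by move=> g0 goo; rewrite fineK// ge0_fin_numE// nsum_ge0. Qed.

Lemma le_nsumZ (I : choiceType) (c : R) (g : I -> R) :
  (0 <= c)%R -> (forall i, 0 <= g i)%R ->
  nsum (fun i => c * g i)%R <= c%:E * nsum g.
Proof.
move=> c0 g0; apply: ge_ereal_sup => _ [X [finX XI] <-].
have -> : \sum_(x \in X) (c * g x)%:E = c%:E * \sum_(x \in X) (g x)%:E.
  rewrite !fsbig_finite//= ge0_sume_distrr//.
  by move=> i _; rewrite lee_fin.
apply: lee_wpmul2l; first by rewrite lee_fin.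
by apply: ereal_sup_ubound; exists X.
Qed.

Lemma nsumZ_fin (I : choiceType) (c : R) (g : I -> R) :
  (0 <= c)%R -> (forall i, 0 <= g i)%R -> nsum g < +oo ->
  nsum (fun i => c * g i)%R < +oo.
Proof.
move=> c0 g0 goo; apply: le_lt_trans (le_nsumZ c0 g0) _.
by rewrite -nsum_fin// -EFinM ltry.
Qed.

Lemma nsumZ (I : choiceType) (c : R) (g : I -> R) :
  (0 <= c)%R -> (forall i, 0 <= g i)%R -> nsum g < +oo ->
  nsum (fun i => c * g i)%R = c%:E * nsum g.
Proof.
rewrite le_eqVlt => /predU1P[<- g0 _|c0 g0 goo].
  by rewrite mul0e; apply: esum1 => i _; rewrite mul0r.
apply/eqP; rewrite eq_le; apply/andP; split.
  by apply: le_nsumZ => //; exact: ltW.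
have cg0 i : (0 <= c * g i)%R by rewrite mulr_ge0// ltW.
have cgoo : nsum (fun i => c * g i)%R < +oo by apply: nsumZ_fin => //; exact: ltW.
(* The reverse inequality is [le_nsumZ] for the factor 1 / c and the family c g. *)
have := @le_nsumZ _ c^-1%R (fun i => c * g i)%R; rewrite invr_ge0 ltW//.
move=> /(_ isT cg0); under eq_nsum do rewrite mulKf ?gt_eqF//.
rewrite -(nsum_fin g0 goo) -(nsum_fin cg0 cgoo) -!EFinM !lee_fin.
by move=> h; rewrite -ler_pdivlMl.
Qed.

Lemma nsum_pair (I J : choiceType) (g : I * J -> R) :
  (forall k, 0 <= g k)%R ->
  nsum g = \esum_(i in [set: I]) nsum (fun j => g (i, j)).
Proof.
move=> g0; rewrite /nsum esum_esum; last by move=> i j _ _; rewrite lee_fin.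
rewrite (_ : [set: I] `*`` _ = [set: I * J])//.
  by apply: eq_esum => -[i j].
by apply/seteqP; split.
Qed.

Lemma nsum_inj (I J : choiceType) (e : I -> J) (g : J -> R) :
  injective e -> (forall j, (forall i, e i != j) -> g j = 0%R) ->
  nsum g = nsum (g \o e).
Proof.
move=> ie g0; rewrite /nsum -(esum_image setT e (fun j => (g j)%:E)).
  rewrite [RHS]esum_mkcond; apply: eq_esum => j _; case: ifPn => //.
  rewrite notin_setE => eNj; rewrite g0// => i; apply/eqP => eij.
  by apply: eNj; exists i.
by move=> i j _ _ /ie.
Qed.

Lemma nsum_seq (I : choiceType) (r : seq I) (g : I -> R) :
  uniq r -> (forall i, 0 <= g i)%R -> (forall i, i \notin r -> g i = 0%R) ->
  nsum g = (\sum_(i <- r) g i)%:E.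
Proof.
move=> ur g0 gr.
rewrite /nsum (_ : \esum_(i in setT) _ = \esum_(i in [set` r]) (g i)%:E).
  rewrite esum_fset//; last by move=> i _; rewrite lee_fin.
  by rewrite -fsbig_seq// sumEFin.
rewrite [RHS]esum_mkcond; apply: eq_esum => i _; case: ifPn => //.
by rewrite notin_setE => /negP/gr ->.
Qed.

Lemma nsum_pair_fin (I J : choiceType) (g : I * J -> R) (B : I -> R) :
  (forall k, 0 <= g k)%R -> (forall i, nsum (fun j => g (i, j)) <= (B i)%:E) ->
  nsum B < +oo -> nsum g < +oo.
Proof.
move=> g0 gB; apply: le_lt_trans; rewrite nsum_pair//.
by apply: le_esum => i _.
Qed.

End NonnegativeSums.

(** * Sums of real families *)

Section RealSums.
Context {R : realType}.

(* A summable family may be summed after any splitting into a difference of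
   nonnegative summable families, not only into positive and negative parts. *)
Lemma sumR_dec (I : choiceType) (g a b : I -> R) :
  (forall i, 0 <= a i) -> (forall i, 0 <= b i) -> (forall i, g i = a i - b i) ->
  (nsum a < +oo)%E -> (nsum b < +oo)%E ->
  sumR g = fine (nsum a) - fine (nsum b).
Proof.
move=> a0 b0 gE aoo boo.
have p0 i : 0 <= Num.max (g i) 0 by rewrite le_max lexx orbT.
have n0 i : 0 <= Num.max (- g i) 0 by rewrite le_max lexx orbT.
have pa i : Num.max (g i) 0 <= a i.
  by rewrite ge_max a0 gE gerBl b0.
have nb i : Num.max (- g i) 0 <= b i.
  by rewrite ge_max b0 gE opprB gerBl a0.
have poo := le_lt_trans (le_nsum pa) aoo.
have noo := le_lt_trans (le_nsum nb) boo.
have : (nsum (fun i => Num.max (g i) 0)%R + nsum b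
       = nsum (fun i => Num.max (- g i) 0)%R + nsum a)%E.
  rewrite -!nsumD//; apply: eq_nsum => i.
  by rewrite gE; case: (leP (a i - b i) 0); case: (leP (- (a i - b i)) 0); lra.
rewrite -(nsum_fin p0 poo) -(nsum_fin n0 noo) -(nsum_fin a0 aoo).
rewrite -(nsum_fin b0 boo) -!EFinD => -[].
rewrite /sumR -/(nsum (fun i => Num.max (g i) 0)).
by rewrite -/(nsum (fun i => Num.max (- g i) 0)); lra.
Qed.

Lemma eq_sumR (I : choiceType) (g h : I -> R) : g =1 h -> sumR g = sumR h.
Proof. by move=> /funext ->. Qed.

Definition psum {I : choiceType} (g : I -> R) : Prop :=
  (nsum (fun i => `|g i|%R) < +oo)%E.

Lemma posp_le (x : R) : Num.max x 0 <= `|x|.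
Proof. by rewrite ge_max ler_norm normr_ge0. Qed.

Lemma psum_pos (I : choiceType) (g : I -> R) : psum g ->
  (nsum (fun i => Num.max (g i) 0%R) < +oo)%E.
Proof. by apply: le_lt_trans; apply: le_nsum => i; exact: posp_le. Qed.

Lemma psum_neg (I : choiceType) (g : I -> R) : psum g ->
  (nsum (fun i => Num.max (- g i)%R 0%R) < +oo)%E.
Proof.
by apply: le_lt_trans; apply: le_nsum => i; rewrite -normrN; exact: posp_le.
Qed.

Lemma max0_ge0 (x : R) : 0 <= Num.max x 0. Proof. by rewrite le_max lexx orbT. Qed.

Lemma max0B (x : R) : x = Num.max x 0 - Num.max (- x) 0.
Proof. by case: (leP x 0); case: (leP (- x) 0); lra. Qed.

Lemma sumRD (I : choiceType) (g h : I -> R) : psum g -> psum h ->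
  sumR (fun i => g i + h i) = sumR g + sumR h.
Proof.
move=> sg sh.
rewrite (@sumR_dec _ _ (fun i => Num.max (g i) 0 + Num.max (h i) 0)
                       (fun i => Num.max (- g i) 0 + Num.max (- h i) 0)).
- rewrite !nsumD; try (move=> i; exact: max0_ge0).
  rewrite !fineD; first by rewrite /sumR -!/(nsum _); lra.
  + by rewrite ge0_fin_numE; [exact: psum_neg|apply: nsum_ge0 => i; exact: max0_ge0].
  + by rewrite ge0_fin_numE; [exact: psum_neg|apply: nsum_ge0 => i; exact: max0_ge0].
  + by rewrite ge0_fin_numE; [exact: psum_pos|apply: nsum_ge0 => i; exact: max0_ge0].
  + by rewrite ge0_fin_numE; [exact: psum_pos|apply: nsum_ge0 => i; exact: max0_ge0].
- by move=> i; rewrite addr_ge0// max0_ge0.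
- by move=> i; rewrite addr_ge0// max0_ge0.
- by move=> i; rewrite {1}(max0B (g i)) {1}(max0B (h i)); lra.
- rewrite nsumD; try (move=> i; exact: max0_ge0).
  by apply: lte_add_pinfty; exact: psum_pos.
- rewrite nsumD; try (move=> i; exact: max0_ge0).
  by apply: lte_add_pinfty; exact: psum_neg.
Qed.

Lemma sumRN (I : choiceType) (g : I -> R) : sumR (fun i => - g i) = - sumR g.
Proof.
rewrite /sumR opprB; congr (_ - fine _); apply: eq_esum => i _.
by rewrite opprK.
Qed.

Lemma sumRZ (I : choiceType) c (g : I -> R) : psum g ->
  sumR (fun i => c * g i) = c * sumR g.
Proof.
move=> sg; wlog c0 : c / 0 <= c => [hw|].
  have [/hw//|/ltW c0] := leP 0 c.
  have := hw (- c); rewrite oppr_ge0 => /(_ c0) h.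
  transitivity (- sumR (fun i => - c * g i)); last by rewrite h mulNr opprK.
  by rewrite -sumRN; apply: eq_sumR => i; rewrite mulNr opprK.
rewrite (@sumR_dec _ _ (fun i => c * Num.max (g i) 0)
                       (fun i => c * Num.max (- g i) 0)).
- rewrite !nsumZ//; try (move=> i; exact: max0_ge0); try exact: psum_pos;
    try exact: psum_neg.
  rewrite -(nsum_fin _ (psum_pos sg))//; last by move=> i; exact: max0_ge0.
  rewrite -(nsum_fin _ (psum_neg sg))//; last by move=> i; exact: max0_ge0.
  by rewrite -!EFinM /= /sumR mulrBr.
- by move=> i; rewrite mulr_ge0// max0_ge0.
- by move=> i; rewrite mulr_ge0// max0_ge0.
- by move=> i; rewrite -mulrBr -max0B.
- by apply: nsumZ_fin => //; [move=> i; exact: max0_ge0|exact: psum_pos].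
- by apply: nsumZ_fin => //; [move=> i; exact: max0_ge0|exact: psum_neg].
Qed.

(** The sums of the positive and of the negative parts both lie between 0 and the bound, hence so
    does the modulus of their difference. *)
Lemma ler_sumR (I : choiceType) (g h : I -> R) :
  (forall i, `|g i| <= h i) -> (nsum h < +oo)%E ->
  `|sumR g| <= fine (nsum h).
Proof.
move=> gh hoo; have h0 i : 0 <= h i by apply: le_trans (gh i).
have sg : psum g by apply: le_lt_trans hoo; exact: le_nsum.
have pg0 i : 0 <= Num.max (g i) 0 by exact: max0_ge0.
have ng0 i : 0 <= Num.max (- g i) 0 by exact: max0_ge0.
have : fine (nsum (fun i => Num.max (g i) 0)) <= fine (nsum h).
  rewrite -lee_fin !nsum_fin//; last exact: psum_pos.
  by apply: le_nsum => i; apply: le_trans (posp_le _) _.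
have : fine (nsum (fun i => Num.max (- g i) 0)) <= fine (nsum h).
  rewrite -lee_fin !nsum_fin//; last exact: psum_neg.
  by apply: le_nsum => i; apply: le_trans (posp_le _) _; rewrite normrN.
have : 0 <= fine (nsum (fun i => Num.max (g i) 0)).
  by apply: fine_ge0; exact: nsum_ge0.
have : 0 <= fine (nsum (fun i => Num.max (- g i) 0)).
  by apply: fine_ge0; exact: nsum_ge0.
rewrite /sumR -/(nsum (fun i => Num.max (g i) 0)).
rewrite -/(nsum (fun i => Num.max (- g i) 0)) ler_norml; lra.
Qed.

Lemma nsum_row_fin (I J : choiceType) (g : I * J -> R) i :
  (forall k, 0 <= g k) -> (nsum g < +oo)%E ->
  (nsum (fun j => g (i, j)) < +oo)%E.
Proof.
move=> g0; apply: le_lt_trans; rewrite nsum_pair//.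
apply: esum_ge; exists [set i]; last by rewrite fsbig_set1.
by split.
Qed.

Lemma nsum_pair_fine (I J : choiceType) (g : I * J -> R) :
  (forall k, 0 <= g k) -> (nsum g < +oo)%E ->
  nsum g = nsum (fun i => fine (nsum (fun j => g (i, j)))).
Proof.
move=> g0 goo; rewrite nsum_pair//; apply: eq_esum => i _.
by rewrite nsum_fin//; exact: nsum_row_fin.
Qed.

(** The row sums of the positive and negative parts are in general not the positive and negative
    parts of the row sums, but they split them into nonnegative summable families, which is all that
    [sumR_dec] asks. *)
Lemma sumR_pair (I J : choiceType) (g : I * J -> R) : psum g ->
  sumR g = sumR (fun i => sumR (fun j => g (i, j))).
Proof.
move=> sg; set p := fun k => Num.max (g k) 0; set n := fun k => Num.max (- g k) 0.
have p0 k : 0 <= p k by exact: max0_ge0.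
have n0 k : 0 <= n k by exact: max0_ge0.
have poo : (nsum p < +oo)%E by exact: psum_pos.
have noo : (nsum n < +oo)%E by exact: psum_neg.
rewrite [RHS](@sumR_dec _ _ (fun i => fine (nsum (fun j => p (i, j))))
                       (fun i => fine (nsum (fun j => n (i, j)))))//.
- by rewrite -!nsum_pair_fine.
- by move=> i; rewrite fine_ge0// nsum_ge0.
- by move=> i; rewrite fine_ge0// nsum_ge0.
- by rewrite -nsum_pair_fine.
- by rewrite -nsum_pair_fine.
Qed.

Lemma sumR_inj (I J : choiceType) (e : I -> J) (g : J -> R) :
  injective e -> (forall j, (forall i, e i != j) -> g j = 0) ->
  sumR g = sumR (g \o e).
Proof.
move=> ie g0; rewrite /sumR; congr (fine _ - fine _).
- apply: (nsum_inj (g := fun j => Num.max (g j) 0) ie) => j /g0 ->.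
  by rewrite maxxx.
- apply: (nsum_inj (g := fun j => Num.max (- g j) 0) ie) => j /g0 ->.
  by rewrite oppr0 maxxx.
Qed.

Lemma sumR_seq (I : choiceType) (r : seq I) (g : I -> R) :
  uniq r -> (forall i, i \notin r -> g i = 0) -> sumR g = \sum_(i <- r) g i.
Proof.
move=> ur gr; rewrite /sumR -/(nsum (fun i => Num.max (g i) 0)).
rewrite -/(nsum (fun i => Num.max (- g i) 0)).
rewrite !(@nsum_seq _ _ r)//=; try (by move=> i; exact: max0_ge0);
  try by move=> i /gr ->; rewrite ?oppr0 maxxx.
by rewrite -sumrB; apply: eq_bigr => i _; rewrite -max0B.
Qed.

End RealSums.

(** * Absolutely convergent complex families *)

Section ComplexSums.
Context {R : realType}.
Local Notation C := R[i].

Lemma abs_cvgE (I : choiceType) (f : I -> C) :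
  abs_cvg f <-> (nsum (fun i => nm (f i)) < +oo)%E.
Proof.
rewrite /abs_cvg /summable /nsum; under eq_esum do
  rewrite gee0_abs ?lee_fin ?(@nm_ge0 _ (f _))//.
by [].
Qed.

Lemma abs_cvg_Re (I : choiceType) (f : I -> C) :
  abs_cvg f -> psum (fun i => complex.Re (f i)).
Proof.
move=> /abs_cvgE; apply: le_lt_trans; apply: le_nsum => i; exact: Re_le_nm.
Qed.

Lemma abs_cvg_Im (I : choiceType) (f : I -> C) :
  abs_cvg f -> psum (fun i => complex.Im (f i)).
Proof.
move=> /abs_cvgE; apply: le_lt_trans; apply: le_nsum => i; exact: Im_le_nm.
Qed.

Lemma eq_sumC (I : choiceType) (f g : I -> C) : f =1 g -> sumC f = sumC g.
Proof. by move=> /funext ->. Qed.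

Lemma abs_cvg_le (I : choiceType) (f : I -> C) (B : I -> R) :
  (forall i, nm (f i) <= B i) -> (nsum B < +oo)%E -> abs_cvg f.
Proof.
by move=> fB Boo; apply/abs_cvgE; apply: le_lt_trans Boo; exact: le_nsum.
Qed.

Lemma abs_cvg_nsum (I : choiceType) (f : I -> C) :
  abs_cvg f -> (nsum (fun i => nm (f i)) < +oo)%E.
Proof. by move/abs_cvgE. Qed.

Lemma abs_cvg_dom (I : choiceType) (f g : I -> C) :
  (forall i, nm (f i) <= nm (g i)) -> abs_cvg g -> abs_cvg f.
Proof. by move=> fg /abs_cvg_nsum; exact: abs_cvg_le. Qed.

Lemma abs_cvgD (I : choiceType) (f g : I -> C) :
  abs_cvg f -> abs_cvg g -> abs_cvg (fun i => f i + g i).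
Proof.
move=> sf sg; apply: (@abs_cvg_le _ _ (fun i => nm (f i) + nm (g i))).
  by move=> i; exact: nmD.
rewrite nsumD; try (by move=> i; exact: nm_ge0).
by apply: lte_add_pinfty; exact: abs_cvg_nsum.
Qed.

Lemma abs_cvgZ (I : choiceType) c (f : I -> C) :
  abs_cvg f -> abs_cvg (fun i => c * f i).
Proof.
move=> sf; apply: (@abs_cvg_le _ _ (fun i => nm c * nm (f i))).
  by move=> i; rewrite nmM.
by apply: nsumZ_fin; [exact: nm_ge0|move=> i; exact: nm_ge0|exact: abs_cvg_nsum].
Qed.

Lemma abs_cvg0 (I : choiceType) : abs_cvg (fun _ : I => 0 : C).
Proof.
by apply/abs_cvgE; rewrite (@nsum_seq _ _ [::]) ?ltry// => i; rewrite nm0.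
Qed.

Lemma sumC0 (I : choiceType) : sumC (fun _ : I => 0 : C) = 0.
Proof. by rewrite /sumC !(@sumR_seq _ _ [::])// !big_nil. Qed.

Lemma sumCD (I : choiceType) (f g : I -> C) : abs_cvg f -> abs_cvg g ->
  sumC (fun i => f i + g i) = sumC f + sumC g.
Proof.
move=> sf sg; rewrite /sumC /=.
rewrite (_ : _ +i* _ + _ = (sumR (fun i => complex.Re (f i)) + sumR (fun i => complex.Re (g i)))
  +i* (sumR (fun i => complex.Im (f i)) + sumR (fun i => complex.Im (g i))))//.
rewrite -!sumRD; [|exact: abs_cvg_Im|exact: abs_cvg_Im|exact: abs_cvg_Re
  |exact: abs_cvg_Re].
by congr (_ +i* _); apply: eq_sumR => i; case: (f i); case: (g i).
Qed.

Lemma psumZ (I : choiceType) c (f : I -> R) : psum f -> psum (fun i => c * f i).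
Proof.
move=> sf; apply: (@le_lt_trans _ _ (nsum (fun i => `|c| * `|f i|))).
  by apply: le_nsum => i; rewrite normrM.
exact: nsumZ_fin.
Qed.

Lemma sumCZ (I : choiceType) c (f : I -> C) : abs_cvg f ->
  sumC (fun i => c * f i) = c * sumC f.
Proof.
move=> sf; have sr := abs_cvg_Re sf; have si := abs_cvg_Im sf.
case: c => a b; rewrite /sumC.
rewrite (_ : (a +i* b) * _ =
  (a * sumR (fun i => complex.Re (f i)) + - b * sumR (fun i => complex.Im (f i)))
  +i* (a * sumR (fun i => complex.Im (f i)) + b * sumR (fun i => complex.Re (f i))));
  last by rewrite mulNr.
rewrite -!sumRZ// -!sumRD; try exact: psumZ.
by congr (_ +i* _); apply: eq_sumR => i; case: (f i) => x y /=; rewrite ?mulNr.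
Qed.

Lemma sumC_pair (I J : choiceType) (f : I * J -> C) : abs_cvg f ->
  sumC f = sumC (fun i => sumC (fun j => f (i, j))).
Proof.
move=> sf; rewrite /sumC/=; congr (_ +i* _).
- by rewrite (sumR_pair (abs_cvg_Re sf)).
- by rewrite (sumR_pair (abs_cvg_Im sf)).
Qed.

Lemma sumC_inj (I J : choiceType) (e : I -> J) (f : J -> C) :
  injective e -> (forall j, (forall i, e i != j) -> f j = 0) ->
  sumC f = sumC (f \o e).
Proof.
move=> ie f0; rewrite /sumC; congr (_ +i* _); apply: (sumR_inj ie) => j /f0.
- by move=> ->.
- by move=> ->.
Qed.

Lemma abs_cvg_inj (I J : choiceType) (e : I -> J) (f : J -> C) :
  injective e -> (forall j, (forall i, e i != j) -> f j = 0) ->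
  abs_cvg f <-> abs_cvg (f \o e).
Proof.
move=> ie f0; split => /abs_cvg_nsum h; apply/abs_cvgE; move: h;
  rewrite (nsum_inj (g := fun j => nm (f j)) ie)// => j /f0 ->; exact: nm0.
Qed.

(** Off the image of [e] the family is replaced by zero, which keeps it summable and makes
    [abs_cvg_inj] applicable. *)
Lemma abs_cvg_sub (I J : choiceType) (e : I -> J) (f : J -> C) :
  injective e -> abs_cvg f -> abs_cvg (f \o e).
Proof.
move=> ie sf; pose g j := if `[< exists i, e i = j >] then f j else 0.
have -> : f \o e = g \o e.
  by apply/funext => i /=; rewrite /g ifT//; apply/asboolP; exists i.
apply/(abs_cvg_inj ie) => [j ej|].
  rewrite /g ifF//; apply/negbTE/asboolPn => -[i eij]; move: (ej i).
  by rewrite eij eqxx.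
apply: abs_cvg_dom sf => j; rewrite /g; case: ifP => // _.
by rewrite nm0 nm_ge0.
Qed.

Lemma abs_cvg_row (I J : choiceType) (f : I * J -> C) i :
  abs_cvg f -> abs_cvg (fun j => f (i, j)).
Proof. by move=> sf; apply: (@abs_cvg_sub _ _ (pair i)) sf => a b []. Qed.

(** Real and imaginary parts are estimated separately, whence the factor 2; it is paid for by
    halving a radius where it matters. *)
Lemma nm_sumC (I : choiceType) (f : I -> C) (B : I -> R) :
  (forall i, nm (f i) <= B i) -> (nsum B < +oo)%E ->
  nm (sumC f) <= fine (nsum B) *+ 2.
Proof.
move=> fB Boo; apply: le_trans (nm_le_ReIm _) _; rewrite mulr2n /=.
apply: lerD; apply: ler_sumR => // i; apply: le_trans (fB i).
  exact: Re_le_nm.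
exact: Im_le_nm.
Qed.

Lemma abs_cvg_sumC (I J : choiceType) (f : I * J -> C) : abs_cvg f ->
  abs_cvg (fun i => sumC (fun j => f (i, j))).
Proof.
move=> sf; have n0 k : 0 <= nm (f k) by exact: nm_ge0.
have foo := abs_cvg_nsum sf.
apply: (@abs_cvg_le _ _ (fun i => 2 * fine (nsum (fun j => nm (f (i, j)))))).
  move=> i; rewrite mulr_natl; apply: nm_sumC => //.
  exact: (nsum_row_fin (g := fun k => nm (f k))).
apply: nsumZ_fin => //; first by move=> i; rewrite fine_ge0// nsum_ge0.
by rewrite -(nsum_pair_fine (g := fun k => nm (f k))).
Qed.

Lemma abs_cvg_pair (I J : choiceType) (f : I * J -> C) (B : I -> R) :
  (forall i, (nsum (fun j => nm (f (i, j))) <= (B i)%:E)%E) ->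
  (nsum B < +oo)%E -> abs_cvg f.
Proof.
by move=> fB Boo; apply/abs_cvgE; apply: nsum_pair_fin Boo => // k; exact: nm_ge0.
Qed.

Lemma sumC_seq (I : choiceType) (r : seq I) (f : I -> C) :
  uniq r -> (forall i, i \notin r -> f i = 0) -> sumC f = \sum_(i <- r) f i.
Proof.
move=> ur fr; rewrite /sumC !(@sumR_seq _ _ r)//; try by move=> i /fr ->.
apply/eqP; rewrite eq_complex/=.
elim: r {ur fr} => [|i r IH]; first by rewrite !big_nil/= !eqxx.
rewrite !big_cons; case: (f i) => a b /=; move: IH.
case: (\sum_(j <- r) f j) => c d /= /andP[/eqP -> /eqP ->].
by rewrite !eqxx.
Qed.

Lemma abs_cvg_seq (I : choiceType) (r : seq I) (f : I -> C) :
  uniq r -> (forall i, i \notin r -> f i = 0) -> abs_cvg f.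
Proof.
move=> ur fr; apply/abs_cvgE; rewrite (@nsum_seq _ _ r)// ?ltry//.
  by move=> i; exact: nm_ge0.
by move=> i /fr ->; exact: nm0.
Qed.

Lemma sumC1 (I : choiceType) (i0 : I) (f : I -> C) :
  (forall i, i != i0 -> f i = 0) -> sumC f = f i0.
Proof.
move=> f0; rewrite (@sumC_seq _ [:: i0])//; first by rewrite big_seq1.
by move=> i; rewrite inE; exact: f0.
Qed.

Lemma abs_cvg_swap (I J : choiceType) (f : I * J -> C) :
  abs_cvg f -> abs_cvg (fun k : J * I => f (k.2, k.1)).
Proof.
move=> sf; apply: (@abs_cvg_sub _ _ (fun k : J * I => (k.2, k.1))) sf.
by move=> [a b] [c d] /= [-> ->].
Qed.

Lemma sumC_swap (I J : choiceType) (f : I * J -> C) : abs_cvg f ->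
  sumC (fun i => sumC (fun j => f (i, j))) = sumC (fun j => sumC (fun i => f (i, j))).
Proof.
move=> sf; rewrite -sumC_pair// -(sumC_pair (abs_cvg_swap sf)).
rewrite (@sumC_inj _ _ (fun k : J * I => (k.2, k.1)))//.
  by move=> [a b] [c d] /= [-> ->].
by move=> [i j] /(_ (j, i)); rewrite eqxx.
Qed.

Section Regroup.
Context {I J : choiceType} (phi : I -> J) (f : I -> C) (sf : abs_cvg f).
(** The family [f] carried by the graph of [phi] inside [J * I]; Fubini there is summation along the
    fibres of [phi]. *)
Let F (k : J * I) : C := if phi k.2 == k.1 then f k.2 else 0.

Let sF : abs_cvg F.
Proof.
apply/(@abs_cvg_inj _ _ (fun i => (phi i, i))).
- by move=> i j [].
- move=> [j i] /(_ i); rewrite /F/= xpair_eqE eqxx andbT => /negbTE/= ->//.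
- by rewrite (_ : F \o _ = f)//; apply/funext => i; rewrite /F/= eqxx.
Qed.

Lemma abs_cvg_regroup : abs_cvg (fun j => sumC (fun i => if phi i == j then f i else 0)).
Proof. exact: (abs_cvg_sumC sF). Qed.

Lemma sumC_regroup :
  sumC f = sumC (fun j => sumC (fun i => if phi i == j then f i else 0)).
Proof.
rewrite -(sumC_pair sF) (@sumC_inj _ _ (fun i => (phi i, i)) F).
- by apply: eq_sumC => i; rewrite /F/= eqxx.
- by move=> i j [].
- move=> [j i] /(_ i); rewrite /F/= xpair_eqE eqxx andbT => /negbTE/= ->//.
Qed.

Lemma abs_cvg_cond j : abs_cvg (fun i => if phi i == j then f i else 0).
Proof. exact: (abs_cvg_row j sF). Qed.

End Regroup.

Lemma abs_cvgM (I J : choiceType) (f : I -> C) (g : J -> C) :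
  abs_cvg f -> abs_cvg g -> abs_cvg (fun k : I * J => f k.1 * g k.2).
Proof.
move=> sf sg; have g0 i : 0 <= nm (g i) by exact: nm_ge0.
have goo := abs_cvg_nsum sg.
apply: (@abs_cvg_pair _ _ _ (fun i => fine (nsum (fun j => nm (g j))) * nm (f i))).
- move=> i /=; apply: (@le_trans _ _ (nsum (fun j => nm (f i) * nm (g j)))).
    by apply: le_nsum => j; rewrite nmM.
  by rewrite nsumZ// ?nm_ge0// mulrC EFinM nsum_fin.
- apply: nsumZ_fin; [by rewrite fine_ge0// nsum_ge0|by move=> i; exact: nm_ge0|].
  exact: abs_cvg_nsum.
Qed.

Lemma sumCM (I J : choiceType) (f : I -> C) (g : J -> C) :
  abs_cvg f -> abs_cvg g ->
  sumC (fun k : I * J => f k.1 * g k.2) = sumC f * sumC g.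
Proof.
move=> sf sg; rewrite (sumC_pair (abs_cvgM sf sg)) mulrC -sumCZ//.
by apply: eq_sumC => i /=; rewrite sumCZ// mulrC.
Qed.

Lemma abs_cvg_sum (I : choiceType) (K : Type) (r : seq K) (f : K -> I -> C) :
  (forall k, abs_cvg (f k)) -> abs_cvg (fun i => \sum_(k <- r) f k i).
Proof.
move=> sf; elim: r => [|k r IH].
  by apply: abs_cvg_dom (abs_cvg0 I) => i; rewrite big_nil.
rewrite (_ : (fun i => _) = fun i => f k i + \sum_(k <- r) f k i).
  exact: abs_cvgD.
by apply/funext => i; rewrite big_cons.
Qed.

Lemma sumC_sum (I : choiceType) (K : Type) (r : seq K) (f : K -> I -> C) :
  (forall k, abs_cvg (f k)) ->
  sumC (fun i => \sum_(k <- r) f k i) = \sum_(k <- r) sumC (f k).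
Proof.
move=> sf; elim: r => [|k r IH].
  by rewrite big_nil (eq_sumC (g := fun=> 0)) ?sumC0// => i; rewrite big_nil.
rewrite big_cons -IH -sumCD//; last exact: abs_cvg_sum.
by apply: eq_sumC => i; rewrite big_cons.
Qed.

End ComplexSums.

(** * Analytic functions *)

Section Composition.
Context {R : realType}.
Local Notation C := R[i].

Lemma nsum_prod (I J : choiceType) (g : I -> R) (h : J -> R) :
  (forall i, 0 <= g i) -> (forall j, 0 <= h j) ->
  (nsum g < +oo)%E -> (nsum h < +oo)%E ->
  nsum (fun k : I * J => g k.1 * h k.2) = (fine (nsum g) * fine (nsum h))%:E.
Proof.
move=> g0 h0 goo hoo; rewrite nsum_pair; last by move=> k; rewrite mulr_ge0.
transitivity (nsum (fun i => fine (nsum h) * g i)).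
  apply: eq_esum => i _ /=; rewrite nsumZ//.
  by rewrite -(nsum_fin h0 hoo) -EFinM mulrC.
rewrite nsumZ//; last by rewrite fine_ge0// nsum_ge0.
by rewrite -(nsum_fin g0 goo) -EFinM mulrC.
Qed.

Section SeqPower.
Context {E : choiceType}.

(** Word expansion of a power: the n-th power of the sum of [x] is the sum, over the words of length
    n, of the products of their letters. Words in place of multinomial coefficients make the
    rearrangements mere reindexings. *)
Definition sized (T : pzRingType) (x : E -> T) n (s : seq E) : T :=
  if size s == n then \prod_(e <- s) x e else 0.

Let consp (k : E * seq E) := k.1 :: k.2.

Let consp_inj : injective consp. Proof. by move=> [a s] [b t] [-> ->]. Qed.

Let sized_cons (T : pzRingType) (x : E -> T) n k :
  sized x n.+1 (consp k) = x k.1 * sized x n k.2.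
Proof.
by rewrite /sized/= eqSS big_cons; case: ifP => // _; rewrite mulr0.
Qed.

Let sized0 (T : pzRingType) (x : E -> T) n s :
  (forall k, consp k != s) -> sized x n.+1 s = 0.
Proof. by case: s => [//|e s] /(_ (e, s)); rewrite eqxx. Qed.

Lemma sized_nsum (x : E -> R) n : (forall e, 0 <= x e) -> (nsum x < +oo)%E ->
  nsum (sized x n) = (fine (nsum x) ^+ n)%:E.
Proof.
move=> x0 xoo; elim: n => [|n IH].
  rewrite expr0 (@nsum_seq _ _ [:: [::]])//.
  - by rewrite big_seq1 /sized/= big_nil.
  - by rewrite /sized; case=> [|e s]//=; rewrite big_nil.
  - by case.
have s0 m s : 0 <= sized x m s.
  by rewrite /sized; case: ifP => // _; rewrite prodr_ge0.
rewrite (nsum_inj (g := sized x n.+1) consp_inj (@sized0 _ x n)).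
rewrite (eq_nsum (@sized_cons _ x n)) nsum_prod//; last by rewrite IH ltry.
by rewrite IH/= exprS.
Qed.

Lemma sized_abs_cvg (x : E -> C) n : abs_cvg x -> abs_cvg (sized x n).
Proof.
move=> sx; apply: (@abs_cvg_le _ _ _ (sized (fun e => nm (x e)) n)).
  by move=> s; rewrite /sized; case: ifP => _; rewrite ?nm0// nm_prod.
rewrite sized_nsum ?ltry//; first by move=> e; exact: nm_ge0.
exact: abs_cvg_nsum.
Qed.

Lemma sized_sumC (x : E -> C) n : abs_cvg x ->
  sumC (sized x n) = sumC x ^+ n.
Proof.
move=> sx; elim: n => [|n IH].
  rewrite expr0 (@sumC1 _ _ [::]) /sized/= ?big_nil//.
  by case.
rewrite (sumC_inj consp_inj (@sized0 _ x n)) (eq_sumC (@sized_cons _ x n)).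
by rewrite sumCM ?IH ?exprS//; exact: sized_abs_cvg.
Qed.

End SeqPower.

(** Convergence is required only after multiplication by [c]. This matters when [c] is a power of a
    variable that may vanish, since then nothing is known about [f] itself. *)
Lemma sumCZ_any (I : choiceType) c (f : I -> C) : abs_cvg (fun i => c * f i) ->
  sumC (fun i => c * f i) = c * sumC f.
Proof.
have [->|c0] := eqVneq c 0.
  move=> _; rewrite mul0r (eq_sumC (g := fun=> 0)) ?sumC0// => i.
  by rewrite mul0r.
move=> scf; rewrite sumCZ//.
have := abs_cvgZ c^-1 scf; congr abs_cvg; apply/funext => i.
by rewrite mulKf.
Qed.

Definition pterm (c : nat -> nat -> C) (h k : C) (e : nat * nat) : C :=
  c e.1 e.2 * h ^+ e.1 * k ^+ e.2.

(** The constant term is removed so that the value is small near the centre and can be substituted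
    into another series. *)
Definition tail (c : nat -> nat -> C) i j : C :=
  if (i == 0)%N && (j == 0)%N then 0 else c i j.

Lemma pterm_tail c h k :
  abs_cvg (pterm c h k) ->
  abs_cvg (pterm (tail c) h k) /\
  sumC (pterm c h k) = c 0%N 0%N + sumC (pterm (tail c) h k).
Proof.
move=> sc; set d := fun e : nat * nat => if e == (0, 0)%N then c 0%N 0%N else 0.
have sd : abs_cvg d.
  apply: (@abs_cvg_seq _ _ [:: (0, 0)%N]) => // e; rewrite inE /d.
  by move=> /negbTE ->.
have st : abs_cvg (pterm (tail c) h k).
  apply: abs_cvg_dom sc => -[i j]; rewrite /pterm /tail/=.
  by case: ifP => // _; rewrite !mul0r nm0 nm_ge0.
split => //; rewrite (_ : c 0%N 0%N = sumC d).
  rewrite -sumCD//; apply: eq_sumC => -[[|i] [|j]]; rewrite /pterm /tail /d/=.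
  - by rewrite !expr0 !mulr1 addr0.
  - by rewrite add0r.
  - by rewrite add0r.
  - by rewrite add0r.
rewrite (@sumC1 _ _ (0, 0)%N) /d ?eqxx// => e.
by move=> /negbTE ->.
Qed.

(** Shrinking the polydisc by a factor t multiplies a term of degree i + j by at most t^(i + j),
    hence by at most t once the constant term is gone. The sum of the moduli thus drops from M to at
    most t M. *)
Lemma pterm_small (c : nat -> nat -> C) (r rho : R) : 0 < r -> 0 < rho ->
  (forall h k, nm h < r -> nm k < r -> abs_cvg (pterm c h k)) ->
  exists2 r', 0 < r' <= r & forall h k, nm h < r' -> nm k < r' ->
    (nsum (fun e => nm (pterm (tail c) h k e)) < rho%:E)%E.
Proof.
move=> r0 rho0 sc; set u := r / 2.
have u0 : 0 < u by rewrite divr_gt0.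
have ur : u < r by rewrite /u; lra.
have su : abs_cvg (pterm c u%:C u%:C) by apply: sc; rewrite nmC gtr0_norm.
set M := fine (nsum (fun e => nm (pterm c u%:C u%:C e))).
have M0 : 0 <= M by rewrite fine_ge0// nsum_ge0// => e; exact: nm_ge0.
(* Chosen so that t < 1 and t M < rho at once, also when M = 0. *)
set t := rho / (rho + M + 1).
have D0 : 0 < rho + M + 1 by lra.
have t0 : 0 < t by rewrite divr_gt0.
have t1 : t < 1 by rewrite ltr_pdivrMr// mul1r; lra.
have tM : t * M < rho.
  by rewrite /t mulrAC ltr_pdivrMr// ltr_pM2l//; lra.
exists (t * u); first by rewrite mulr_gt0//= (le_trans _ (ltW ur))// ger_pMl// ltW.
move=> h k hu ku; apply: (@le_lt_trans _ _ (t * M)%:E); last by rewrite lte_fin.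
rewrite EFinM nsum_fin; [|by move=> e; exact: nm_ge0|exact: abs_cvg_nsum].
apply: (@le_trans _ _ (nsum (fun e => t * nm (pterm c u%:C u%:C e)))); last first.
  by apply: le_nsumZ; [exact: ltW|move=> e; exact: nm_ge0].
apply: le_nsum => -[i j]; rewrite /pterm /tail/=; case: ifPn => [_|ij].
  by rewrite !mul0r nm0 mulr_ge0 ?nm_ge0// ltW.
rewrite !nmM !nmX !nmC !gtr0_norm//.
have hx n (x : C) : nm x < t * u -> nm x ^+ n <= t ^+ n * u ^+ n.
  by move=> /ltW xu; rewrite -exprMn lerXn2r ?nnegrE ?nm_ge0// mulr_ge0// ltW.
rewrite -[leLHS]mulrA.
rewrite [leRHS](_ : _ = nm (c i j) * (t * (u ^+ i * u ^+ j))); last by ring.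
rewrite ler_wpM2l ?nm_ge0//.
apply: (@le_trans _ _ (t ^+ i * u ^+ i * (t ^+ j * u ^+ j))).
  by apply: ler_pM; rewrite ?exprn_ge0 ?nm_ge0//; exact: hx.
rewrite (_ : _ * _ = t ^+ (i + j) * (u ^+ i * u ^+ j)); last by rewrite exprD; ring.
have u0' := ltW u0; have t0' := ltW t0; have t1' := ltW t1.
apply: ler_wpM2r; first by rewrite mulr_ge0// exprn_ge0.
by case: i j ij => [|i] [|j]//= _; rewrite ?add0n ?addn0 ?addSn exprS;
  rewrite ger_pMr// exprn_ile1.
Qed.

Lemma analytic2_coef (f : C -> C -> C) a b c r : 0 < r ->
  (forall h k, nm h < r -> nm k < r ->
     abs_cvg (pterm c h k) /\ f (a + h) (b + k) = sumC (pterm c h k)) ->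
  analytic2_at f a b.
Proof.
move=> r0 fc; exists c, r; split => // h k; rewrite !normlt => hr kr.
exact: fc.
Qed.

Lemma analytic2_atP (f : C -> C -> C) a b : analytic2_at f a b ->
  exists c r, 0 < r /\ forall h k, nm h < r -> nm k < r ->
     abs_cvg (pterm c h k) /\ f (a + h) (b + k) = sumC (pterm c h k).
Proof.
move=> [c [r [r0 fc]]]; exists c, r; split => // h k hr kr.
by apply: fc; rewrite normlt.
Qed.

Lemma pterm00 c : sumC (pterm c 0 0) = c 0%N 0%N.
Proof.
rewrite (@sumC1 _ _ (0, 0)%N) => [|[[|i] [|j]]//= _]; rewrite /pterm/=.
- by rewrite !expr0 !mulr1.
- by rewrite exprS !mul0r mulr0.
- by rewrite exprS !mul0r mulr0 mul0r.
- by rewrite exprS !mul0r mulr0 mul0r.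
Qed.

(** The nonconstant parts x and y of g and h are substituted into the expansion of F; their powers
    are expanded into words, and all products of letters are regrouped by their total degrees in the
    two increments. What permits the regrouping is the convergence of the expansion of F at the sums
    of the moduli of x and y. *)
Lemma analytic2_comp (F g h : C -> C -> C) a b :
  analytic2_at F (g a b) (h a b) -> analytic2_at g a b -> analytic2_at h a b ->
  analytic2_at (fun x y => F (g x y) (h x y)) a b.
Proof.
move=> /analytic2_atP[c [r [r0 Fc]]].
move=> /analytic2_atP[gc [r1 [r10 gE]]] /analytic2_atP[hc [r2 [r20 hE]]].
(* Half the radius of F, because [nm_sumC] bounds a sum by twice the sum of the moduli. *)
have r20' : 0 < r / 2 by rewrite divr_gt0.
have [r1' /andP[r1'0 r1'r] gs] :=
  pterm_small r10 r20' (fun h k hr kr => (gE h k hr kr).1).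
have [r2' /andP[r2'0 r2'r] hs] :=
  pterm_small r20 r20' (fun h k hr kr => (hE h k hr kr).1).
have g00 : g a b = gc 0%N 0%N.
  have [||_] := gE 0 0; rewrite ?nm0// !addr0 pterm00 //.
have h00 : h a b = hc 0%N 0%N.
  have [||_] := hE 0 0; rewrite ?nm0// !addr0 pterm00 //.
(* The total degrees in the two increments of the product of all letters of two words. *)
set phi := fun st : seq (nat * nat) * seq (nat * nat) =>
  ((\sum_(e <- st.1) e.1 + \sum_(e <- st.2) e.1)%N,
   (\sum_(e <- st.1) e.2 + \sum_(e <- st.2) e.2)%N).
set G := fun st : seq (nat * nat) * seq (nat * nat) =>
  c (size st.1) (size st.2) * (\prod_(e <- st.1) tail gc e.1 e.2)
    * (\prod_(e <- st.2) tail hc e.1 e.2).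
pose d (m n : nat) : C := sumC (fun st => if phi st == (m, n) then G st else 0).
apply: (@analytic2_coef (fun x y => F (g x y) (h x y)) a b d (Num.min r1' r2')).
  by rewrite lt_min r1'0 r2'0.
move=> H K; rewrite !lt_min => /andP[H1 H2] /andP[K1 K2].
have [sg0 gHK] := gE H K (lt_le_trans H1 r1'r) (lt_le_trans K1 r1'r).
have [sh0 hHK] := hE H K (lt_le_trans H2 r2'r) (lt_le_trans K2 r2'r).
have [sg gsum] := pterm_tail sg0; have [sh hsum] := pterm_tail sh0.
rewrite gHK hHK gsum hsum -g00 -h00.
set x := pterm (tail gc) H K in sg gsum *.
set y := pterm (tail hc) H K in sh hsum *.
have x0 e : 0 <= nm (x e) by exact: nm_ge0.
have y0 e : 0 <= nm (y e) by exact: nm_ge0.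
have xoo := abs_cvg_nsum sg; have yoo := abs_cvg_nsum sh.
set X := fine (nsum (fun e => nm (x e))).
set Y := fine (nsum (fun e => nm (y e))).
have X0 : 0 <= X by rewrite fine_ge0// nsum_ge0.
have Y0 : 0 <= Y by rewrite fine_ge0// nsum_ge0.
have Xr : X < r / 2 by rewrite -lte_fin nsum_fin//; exact: gs.
have Yr : Y < r / 2 by rewrite -lte_fin nsum_fin//; exact: hs.
have nX : nm (sumC x) < r.
  apply: (@le_lt_trans _ _ (X *+ 2)); first exact: nm_sumC.
  by rewrite mulr2n; lra.
have nY : nm (sumC y) < r.
  apply: (@le_lt_trans _ _ (Y *+ 2)); first exact: nm_sumC.
  by rewrite mulr2n; lra.
have [sF ->] := Fc _ _ nX nY.
(* The degrees (i, j) are kept as an index beside the two words, so that summing over the words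
   first returns x^i y^j. As the words determine the degrees, this index is dropped afterwards. *)
set Psi := fun k : (nat * nat) * (seq (nat * nat) * seq (nat * nat)) =>
  c k.1.1 k.1.2 * (sized x k.1.1 k.2.1 * sized y k.1.2 k.2.2).
have sPsi : abs_cvg Psi.
  apply: (@abs_cvg_pair _ _ _ _ (fun e => nm (c e.1 e.2) * (X ^+ e.1 * Y ^+ e.2))).
    move=> [i j] /=; rewrite /Psi/=.
    rewrite (@eq_nsum _ _ _ (fun st => nm (c i j) *
      (sized (fun e => nm (x e)) i st.1 * sized (fun e => nm (y e)) j st.2))); last first.
      move=> [s t]/=; rewrite !nmM /sized; congr (_ * (_ * _)); case: ifP => _;
        by rewrite ?nm0 ?nm_prod.
    have z0 (z : nat * nat -> C) n s : 0 <= sized (fun e => nm (z e)) n s.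
      by rewrite /sized; case: ifP => // _; rewrite prodr_ge0// => e _; exact: nm_ge0.
    apply: le_trans (le_nsumZ _ _) _; first exact: nm_ge0.
      by move=> st; rewrite mulr_ge0.
    rewrite nsum_prod// ?sized_nsum// ?ltry//.
  (* The majorant is the expansion of F at the real point (X, Y), taken in moduli. *)
  have Xr' : nm X%:C < r by rewrite nmC ger0_norm//; lra.
  have Yr' : nm Y%:C < r by rewrite nmC ger0_norm//; lra.
  have [/abs_cvg_nsum sXY _] := Fc _ _ Xr' Yr'.
  apply: le_lt_trans sXY.
  apply: le_nsum => -[i j]; rewrite /pterm/= !nmM !nmX !nmC !ger0_norm//.
  by rewrite mulrA.
set e := fun st : seq (nat * nat) * seq (nat * nat) => ((size st.1, size st.2), st).
have ei : injective e by move=> [s t] [s' t'] [_ _ -> ->].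
have Psi0 k : (forall st, e st != k) -> Psi k = 0.
  case: k => [[i j] [s t]] /(_ (s, t)); rewrite /e /Psi /sized/=.
  by rewrite !xpair_eqE !eqxx !andbT negb_and; case: eqP => //= [_|_];
    case: eqP => //= *; rewrite ?mulr0 ?mul0r ?mulr0.
have PhiE st : (Psi \o e) st = G st * (H ^+ (phi st).1 * K ^+ (phi st).2).
  case: st => s t; rewrite /= /Psi /sized/= !eqxx /G/=.
  have px z s' : \prod_(e <- s') pterm z H K e = (\prod_(e <- s') z e.1 e.2)
    * (H ^+ (\sum_(e <- s') e.1)%N * K ^+ (\sum_(e <- s') e.2)%N).
    elim: s' => [|e' s' IH]; first by rewrite !big_nil !expr0 !mulr1.
    by rewrite !big_cons IH /pterm !exprD; ring.
  by rewrite !px !exprD; ring.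
have sPhi : abs_cvg (Psi \o e) by exact: abs_cvg_sub.
have coefE e' : sumC (fun st => if phi st == e' then (Psi \o e) st else 0)
   = pterm d H K e'.
  (* H or K may be 0, in which case only the multiplied family is known to converge; hence
     [sumCZ_any]. *)
  case: e' => m n; rewrite /pterm /d/= -mulrA mulrC -sumCZ_any; last first.
    have := abs_cvg_cond phi sPhi (m, n); congr abs_cvg.
    apply/funext => st; case: eqP => [pst|]; last by rewrite mulr0.
    by rewrite PhiE pst/= mulrC.
  apply: eq_sumC => st; case: eqP => [pst|]; last by rewrite mulr0.
  by rewrite -[LHS]/((Psi \o e) st) PhiE pst/= mulrC.
split.
  have := abs_cvg_regroup phi sPhi; congr abs_cvg; apply/funext => e'.
  exact: coefE.
transitivity (sumC Psi).
  rewrite (sumC_pair sPsi); apply: eq_sumC => -[i j]; rewrite /pterm /Psi/=.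
  rewrite sumCZ; last by apply: abs_cvgM; exact: sized_abs_cvg.
  by rewrite sumCM ?sized_sumC ?mulrA//; exact: sized_abs_cvg.
rewrite (sumC_inj ei Psi0) (sumC_regroup phi sPhi).
by apply: eq_sumC => e'; exact: coefE.
Qed.

End Composition.

(** * The exponential series *)

Section ExponentialSeries.
Context {R : realType}.
Local Notation C := R[i].

Lemma cvg_nsum (a : nat -> R) : (forall n, 0 <= a n) -> (nsum a < +oo)%E ->
  series a @ \oo --> fine (nsum a).
Proof.
move=> a0 aoo.
have sa : summable (fun=> true : bool) (fun n => (a n)%:E).
  rewrite /summable; move: aoo; congr (_ < _)%E.
  rewrite /nsum -set_true; apply: eq_esum => n _.
  by rewrite /= ger0_norm.
have ca := summable_cvg (P := xpredT) (f := fun n => (a n)%:E) _ sa.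
have := summable_nneseries_lim (P := xpredT) (f := fun n => (a n)%:E) _ sa.
rewrite nneseries_esumT => [|n]; last by rewrite lee_fin.
rewrite -/(nsum a) => ->; last by move=> n _; rewrite lee_fin.
by rewrite /=; apply: ca => n _; rewrite lee_fin.
Qed.

Lemma nsum_cvg (a : nat -> R) : (forall n, 0 <= a n) -> cvgn (series a) ->
  (nsum a < +oo)%E.
Proof.
move=> a0 ca; rewrite /nsum -nneseries_esumT; last by move=> n; rewrite lee_fin.
rewrite (_ : (fun n => _) = EFin \o series a); last first.
  by apply/funext => n; rewrite /series/= sumEFin.
by rewrite EFin_lim// ltry.
Qed.

Lemma cvg_sumR (g : nat -> R) : psum g -> series g @ \oo --> sumR g.
Proof.
move=> sg; rewrite (_ : series g = series (fun n => Num.max (g n) 0)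
                               - series (fun n => Num.max (- g n) 0)).
  apply: cvgB; apply: cvg_nsum; try (by move=> n; exact: max0_ge0).
    exact: psum_pos.
  exact: psum_neg.
apply/funext => n; rewrite /series/= -[RHS]/(_ - _) -sumrB.
by apply: eq_bigr => i _; exact: max0B.
Qed.

Definition expterm (h : C) (n : nat) : C := h ^+ n / n`!%:R.

Lemma nm_nat n : nm (n%:R : C) = n%:R.
Proof. by rewrite -(rmorph_nat (real_complex R)) nmC ger0_norm. Qed.

Lemma exp_nsum (x : R) : (nsum (fun n => `|x| ^+ n / n`!%:R)%R < +oo)%E.
Proof.
apply: nsum_cvg; first by move=> n; rewrite divr_ge0// exprn_ge0.
exact: is_cvg_series_exp_coeff.
Qed.

Lemma expterm_abs_cvg h : abs_cvg (expterm h).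
Proof.
apply: abs_cvg_le (exp_nsum (nm h)) => n.
by rewrite /expterm nmM nmX nmV nm_nat ger0_norm ?nm_ge0.
Qed.

(** Cauchy product: the pairs are grouped along i + j = n, and each group is the binomial
    formula. *)
Lemma expterm_sumD (x y : C) :
  sumC (expterm (x + y)) = sumC (expterm x) * sumC (expterm y).
Proof.
rewrite -sumCM; try exact: expterm_abs_cvg.
rewrite (sumC_regroup (fun k : nat * nat => (k.1 + k.2)%N)); last first.
  by apply: abs_cvgM; exact: expterm_abs_cvg.
apply: eq_sumC => n; rewrite (@sumC_seq _ _ [seq (i, (n - i)%N) | i <- iota 0 n.+1]).
- rewrite big_map -/(index_iota 0 n.+1) big_mkord/=.
  rewrite {1}/expterm addrC exprDn mulr_suml; apply: eq_bigr => i _.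
  have le_in : (i <= n)%N by rewrite -ltnS.
  rewrite subnKC// eqxx /expterm.
  rewrite -mulr_natr -(bin_fact le_in) !natrM.
  have f0 k : (k`!%:R : C) != 0 by rewrite pnatr_eq0 -lt0n fact_gt0.
  have b0 : ('C(n, i)%:R : C) != 0 by rewrite pnatr_eq0 -lt0n bin_gt0.
  by field; rewrite b0 !f0.
- by rewrite map_inj_uniq ?iota_uniq// => i j [].
- move=> [i j] nij; rewrite [LHS]/=; case: eqP => // ijn; case/negP: nij.
  rewrite -ijn; apply/mapP; exists i; last by rewrite addKn.
  by rewrite mem_iota/= add0n ltnS leq_addr.
Qed.

(** The series at x + i y factors by [expterm_sumD]; at x it is the real exponential series, and at
    i y its real and imaginary parts are the cosine and sine series. *)
Lemma sumC_cexp (h : C) : sumC (expterm h) = cexp h.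
Proof.
case: h => x y; rewrite {1}[_ +i* _]complexE/= expterm_sumD /cexp/=.
have seriesE (z : C) (g : R^nat) l (p : C -> R) :
    (forall n, p (expterm z n) = g n) -> psum (fun n => p (expterm z n)) ->
    series g @ \oo --> l -> sumR (fun n => p (expterm z n)) = l.
  move=> zg pz gl; apply: (@cvg_unique _ _ _ _ _ _ _ gl) => //.
  have := cvg_sumR pz; rewrite (_ : series g = series (fun n => p (expterm z n)))//.
  by congr series; apply/funext => n; rewrite zg.
have sRe z := abs_cvg_Re (expterm_abs_cvg z).
have sIm z := abs_cvg_Im (expterm_abs_cvg z).
have natc n : (n%:R : C) = (n%:R)%:C by rewrite (rmorph_nat (real_complex R)).
have -> : sumC (expterm x%:C) = (expR x)%:C.
  rewrite /sumC.
  have e n : expterm x%:C n = (x ^+ n / n`!%:R)%:C.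
    by rewrite /expterm natc -!rmorphXn -!fmorphV/= -rmorphM.
  rewrite (@seriesE _ (exp_coeff x) (expR x))//; last 2 first.
  - by move=> n; rewrite e.
  - exact: is_cvg_series_exp_coeff.
  rewrite (_ : sumR _ = 0)//.
  rewrite (eq_sumR (h := fun=> 0)) => [|n]; last by rewrite e.
  by rewrite (@sumR_seq _ _ [::])// big_nil.
have i2 n : ('i%C : C) ^+ n.*2 = ((-1) ^+ n)%:C.
  by rewrite -mul2n exprM sqr_i rmorphXn/= rmorphN1.
have e n : expterm ('i%C * y%:C) n = (cos_coeff y n) +i* (sin_coeff y n).
  rewrite /expterm exprMn natc -rmorphXn/= -mulrA -fmorphV/= -rmorphM/=.
  rewrite /cos_coeff /sin_coeff/= -[in 'i ^+ _](odd_double_half n) exprD i2.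
  (* The sign in [sin_coeff] is read off from half of n - 1, which for odd n agrees with the
     integral half of n. *)
  have h1 : odd n -> n.-1./2 = n./2.
    by move=> on; rewrite -{1}[n]odd_double_half on/= doubleK.
  rewrite -!exprnP; case: (odd n) h1 => [->//|_]; rewrite ?expr1 ?expr0 ?mul1r/=.
    rewrite mul0r; apply/eqP; rewrite eq_complex/=.
    by apply/andP; split; apply/eqP; ring.
  apply/eqP; rewrite eq_complex/=.
  by apply/andP; split; apply/eqP; ring.
have -> : sumC (expterm ('i%C * y%:C)) = cos y +i* sin y.
  rewrite /sumC (@seriesE _ (cos_coeff y) (cos y))//; last 2 first.
  - by move=> n; rewrite e.
  - by rewrite cos.unlock; exact: is_cvg_series_cos_coeff.
  rewrite (@seriesE _ (sin_coeff y) (sin y))//.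
  - by move=> n; rewrite e.
  - by rewrite sin.unlock; exact: is_cvg_series_sin_coeff.
by apply/eqP; rewrite eq_complex/=; apply/andP; split; apply/eqP; ring.
Qed.

Lemma cexpD (x y : C) : cexp (x + y) = cexp x * cexp y.
Proof. by rewrite -!sumC_cexp expterm_sumD. Qed.

Lemma nm_cexp (z : C) : nm (cexp z) = expR (complex.Re z).
Proof.
rewrite /nm normc_def/= !exprMn -mulrDr cos2Dsin2 mulr1 sqrtr_sqr.
by rewrite ger0_norm// expR_ge0.
Qed.

Lemma cexp_neq0 (z : C) : cexp z != 0.
Proof. by rewrite -nm_gt0 nm_cexp expR_gt0. Qed.

Lemma cexp0 : cexp 0 = 1 :> C.
Proof. by rewrite /cexp/= expR0 cos0 sin0 !mul1r. Qed.

Lemma cexpN (z : C) : cexp (- z) = (cexp z)^-1.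
Proof.
apply: (mulfI (cexp_neq0 z)); rewrite -cexpD subrr cexp0 mulfV//.
exact: cexp_neq0.
Qed.

End ExponentialSeries.

(** * Power series in one variable and their derivatives *)

Section OneVariable.
Context {R : realType}.
Local Notation C := R[i].

Definition pser (q : nat -> C) (h : C) (i : nat) : C := q i * h ^+ i.

(** The coefficients are an argument, so that the derivative can be named: it is [q 1]. *)
Definition analytic1_with (q : nat -> C) (f : C -> C) (a : C) : Prop :=
  exists2 r : R, 0 < r & forall h, nm h < r ->
    abs_cvg (pser q h) /\ f (a + h) = sumC (pser q h).

Lemma pser_abs_cvg (q : nat -> C) (u : R) h : nm h <= u ->
  abs_cvg (pser q u%:C) -> abs_cvg (pser q h).
Proof.
move=> hu; have u0 : 0 <= u by apply: le_trans hu; exact: nm_ge0.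
apply: abs_cvg_dom => i; rewrite /pser !nmM !nmX nmC ger0_norm//.
by rewrite ler_wpM2l ?nm_ge0// lerXn2r// nnegrE ?nm_ge0.
Qed.

Lemma pser0 q : sumC (pser q 0) = q 0%N.
Proof.
rewrite (@sumC1 _ _ 0%N) /pser ?expr0 ?mulr1//.
by case=> // i _; rewrite exprS mul0r mulr0.
Qed.

(** For i >= 2 and |h| <= u, |h|^i is at most |h|^2 u^(i - 2), so the remainder after the linear
    term is |h|^2 times a convergent series. This linear approximation gives the derivatives, and
    later the smallness of the logarithm near 1. *)
Lemma pser_quad (q : nat -> C) (u : R) : 0 < u -> abs_cvg (pser q u%:C) ->
  exists B, forall h, nm h <= u ->
    nm (sumC (pser q h) - q 0%N - q 1%N * h) <= B * nm h ^+ 2.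
Proof.
move=> u0 su; have soo := abs_cvg_nsum su.
set M := nsum (fun i => nm (pser q u%:C i)) in soo.
exists (fine M / u ^+ 2 *+ 2) => h hu.
have sh := pser_abs_cvg hu su.
pose d i := if (i < 2)%N then pser q h i else 0.
have sd : abs_cvg d.
  apply: (@abs_cvg_seq _ _ [:: 0; 1]%N) => // i.
  by rewrite !inE /d; case: i => [|[|i]].
have -> : sumC (pser q h) - q 0%N - q 1%N * h
    = sumC (fun i => pser q h i + (-1) * d i).
  rewrite sumCD//; last exact: abs_cvgZ.
  rewrite sumCZ// (@sumC_seq _ _ [:: 0; 1]%N d)//; last first.
    by move=> i; rewrite !inE /d; case: i => [|[|i]].
  by rewrite !big_cons big_nil /d /pser/= expr0 expr1; ring.
pose B i := nm h ^+ 2 * (u ^- 2 * nm (pser q u%:C i)).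
have h0 := nm_ge0 h.
have hn i : 0 <= nm (pser q u%:C i) by exact: nm_ge0.
have hB i : 0 <= u ^- 2 * nm (pser q u%:C i).
  by rewrite mulr_ge0// invr_ge0 exprn_ge0// ltW.
have u2 : 0 <= u ^- 2 by rewrite invr_ge0 exprn_ge0// ltW.
have Boo : (nsum B < +oo)%E.
  by apply: nsumZ_fin; rewrite ?exprn_ge0//; exact: nsumZ_fin.
apply: le_trans (nm_sumC _ Boo) _ => [i|].
  rewrite /d; case: ltnP => i2.
    by rewrite mulN1r subrr nm0 /B mulr_ge0// exprn_ge0.
  rewrite mulr0 addr0 /B /pser !nmM !nmX nmC gtr0_norm//.
  rewrite [leRHS](_ : _ = nm (q i) * (nm h ^+ 2 * (u ^- 2 * u ^+ i))); last by ring.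
  rewrite ler_wpM2l ?nm_ge0// -(subnK i2) [in leLHS]exprD [u ^+ (_ + _)]exprD.
  have un : u != 0 by rewrite gt_eqF.
  rewrite [leRHS](_ : _ = u ^+ (i - 2) * nm h ^+ 2); last by field.
  apply: ler_wpM2r; first exact: exprn_ge0.
  by apply: lerXn2r => //; rewrite nnegrE ltW.
rewrite (_ : fine _ = nm h ^+ 2 * (u ^- 2 * fine M)).
  have un : u != 0 by rewrite gt_eqF.
  by rewrite le_eqVlt; apply/orP; left; apply/eqP; field.
apply/EFin_inj; rewrite nsum_fin//; last first.
  by move=> i; rewrite /B mulr_ge0// exprn_ge0.
rewrite nsumZ ?exprn_ge0//; last exact: nsumZ_fin.
by rewrite nsumZ// -(nsum_fin hn soo) !EFinM.
Qed.

Lemma quad_is_derive (f : C -> C) a d (B r : R) : 0 < r ->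
  (forall h, nm h < r -> nm (f (a + h) - f a - d * h) <= B * nm h ^+ 2) ->
  is_derive (a : R[i]^o) 1 (f : R[i]^o -> R[i]^o) d.
Proof.
move=> r0 fB.
have fd : (fun h : R[i]^o => h^-1 *: ((f (h *: 1 + a) - f a) : R[i]^o)) @ 0^' --> (d : R[i]^o).
  apply/cvgrPdist_lt => e e0.
  have eE : e = (complex.Re e)%:C by rewrite RRe_real// gtr0_real.
  have e0' : 0 < complex.Re e by rewrite -ltcR -eE.
  have D0 : 0 < `|B| + 1 by rewrite ltr_pwDr.
  have dl : 0 < Num.min r (complex.Re e / (`|B| + 1)).
    by rewrite lt_min r0 divr_gt0.
  apply/nbhs_ballP; exists (Num.min r (complex.Re e / (`|B| + 1)))%:C => /=.
    by rewrite ltcR.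
  move=> h; rewrite /ball/= sub0r normrN normlt lt_min => /andP[hr he] h0.
  rewrite eE normlt [h *: _]mulr1 [h + a]addrC.
  have nh : 0 < nm h by rewrite nm_gt0.
  have nE (x y z : C) : z != 0 -> x - z^-1 * y = - (z^-1 * (y - x * z)).
    by move=> z0; field.
  rewrite [_ *: _]/(_ * _) nE//.
  rewrite nmN nmM nmV; apply: (@le_lt_trans _ _ ((nm h)^-1 * (B * nm h ^+ 2))).
    by rewrite ler_wpM2l ?invr_ge0 ?nm_ge0// fB.
  have nh' : nm h != 0 by rewrite gt_eqF.
  rewrite [ltLHS](_ : _ = B * nm h); last by field.
  apply: (@le_lt_trans _ _ ((`|B| + 1) * nm h)).
    by rewrite ler_wpM2r ?nm_ge0// (le_trans (ler_norm _))// lerDl.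
  by rewrite mulrC -ltr_pdivlMr.
split; first by apply/cvg_ex; exists d.
exact/cvg_lim.
Qed.

Lemma analytic1_derive q f a : analytic1_with q f a ->
  is_derive (a : R[i]^o) 1 (f : R[i]^o -> R[i]^o) (q 1%N).
Proof.
move=> [r r0 fq].
have u0 : 0 < r / 2 by rewrite divr_gt0.
have ur : r / 2 < r by lra.
have su : abs_cvg (pser q (r / 2)%:C).
  by apply: (fq _ _).1; rewrite nmC gtr0_norm.
have [B qB] := pser_quad u0 su.
apply: (@quad_is_derive _ _ _ B (r / 2)) => // h hu.
have [_ ->] := fq h (lt_trans hu ur).
have [|_] := fq 0; first by rewrite nm0.
rewrite addr0 => ->.
by rewrite pser0; apply: qB; exact: ltW.
Qed.

Lemma analytic1_fst q f a b : analytic1_with q f a ->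
  analytic2_at (fun x _ => f x) a b.
Proof.
move=> [r r0 fq]; pose c i j := if j == 0%N then q i else 0.
apply: (@analytic2_coef _ _ _ _ c r) => // h k hr kr.
have [sq ->] := fq h hr; pose e i := (i, 0%N) : nat * nat.
have ei : injective e by move=> i j [].
have c0 k' : (forall i, e i != k') -> pterm c h k k' = 0.
  case: k' => i [|j] /(_ i); first by rewrite eqxx.
  by rewrite /pterm /c/= !mul0r.
have ce : pterm c h k \o e = pser q h.
  by apply/funext => i; rewrite /pterm /c/= expr0 mulr1.
split; first by apply/(abs_cvg_inj ei c0); rewrite ce.
by rewrite (sumC_inj ei c0) ce.
Qed.

Lemma analytic2_swap f a b : analytic2_at f a b ->
  analytic2_at (fun x y => f y x : C) b a.
Proof.
move=> /analytic2_atP[c [r [r0 fc]]].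
apply: (@analytic2_coef _ _ _ _ (fun i j => c j i) r) => // h k hr kr.
have [sc ->] := fc k h kr hr; pose e (k : nat * nat) := (k.2, k.1).
have ei : injective e by move=> [i j] [i' j'] [-> ->].
have e0 f' k' : (forall i, e i != k') -> f' k' = 0 :> C.
  by case: k' => i j /(_ (j, i)); rewrite eqxx.
have ce : pterm c k h \o e = pterm (fun i j => c j i) h k.
  by apply/funext => -[i j]; rewrite /pterm /= mulrAC.
split; first by rewrite -ce; apply: abs_cvg_sub.
by rewrite -ce -(sumC_inj ei (@e0 _)).
Qed.

Lemma analytic1_snd q f a b : analytic1_with q f b ->
  analytic2_at (fun _ y => f y) a b.
Proof. by move=> /(analytic1_fst a)/analytic2_swap. Qed.

Lemma analytic2_row f a b : analytic2_at f a b ->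
  exists q, analytic1_with q (fun x => f x b) a.
Proof.
move=> /analytic2_atP[c [r [r0 fc]]]; exists (fun i => c i 0%N), r => // h hr.
have [|sc] := fc h 0 hr; first by rewrite nm0.
rewrite addr0 => ->; pose e i := (i, 0%N) : nat * nat.
have ei : injective e by move=> i j [].
have c0 k' : (forall i, e i != k') -> pterm c h 0 k' = 0.
  case: k' => i [|j] /(_ i); first by rewrite eqxx.
  by rewrite /pterm /= exprS mul0r mulr0.
have ce : pterm c h 0 \o e = pser (c^~ 0%N) h.
  by apply/funext => i; rewrite /pterm /= expr0 mulr1.
split; first by rewrite -ce; apply: abs_cvg_sub.
by rewrite (sumC_inj ei c0) ce.
Qed.

Lemma analytic2_eq f g a b (rho : R) : 0 < rho ->
  (forall h k, nm h < rho -> nm k < rho -> f (a + h) (b + k) = g (a + h) (b + k)) ->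
  analytic2_at f a b -> analytic2_at g a b.
Proof.
move=> rho0 fg /analytic2_atP[c [r [r0 fc]]].
apply: (@analytic2_coef _ _ _ _ c (Num.min r rho)); first by rewrite lt_min r0.
move=> h k; rewrite !lt_min => /andP[hr hrho] /andP[kr krho].
by rewrite -fg//; exact: fc.
Qed.

Lemma analytic1_poly1 (c d a : C) :
  analytic1_with (fun i => if i == 0%N then c + d * a else if i == 1%N then d else 0)
    (fun x => c + d * x) a.
Proof.
exists 1 => // h _; set q := fun i : nat => _.
have q0 i : i \notin [:: 0; 1]%N -> pser q h i = 0.
  by rewrite !inE; case: i => [|[|i]]//= _; rewrite /pser mul0r.
split; first exact: abs_cvg_seq q0.
rewrite (sumC_seq _ q0)// !big_cons big_nil /pser /q/= expr0 expr1; ring.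
Qed.

Lemma analytic2_fst a b : analytic2_at (fun x _ => x : C) a b.
Proof.
apply: (@analytic2_eq (fun x y => 0 + 1 * x) _ _ _ 1) => //.
  by move=> h k _ _; ring.
exact: analytic1_fst (analytic1_poly1 _ _ _).
Qed.

Lemma analytic2_snd a b : analytic2_at (fun _ y => y : C) a b.
Proof. exact: analytic2_swap (analytic2_fst b a). Qed.

Lemma analytic2_cst c a b : analytic2_at (fun _ _ => c : C) a b.
Proof.
apply: (@analytic2_eq (fun x y => c + 0 * x) _ _ _ 1) => //.
  by move=> h k _ _; ring.
exact: analytic1_fst (analytic1_poly1 _ _ _).
Qed.

Lemma analytic2_poly a b (r : seq (nat * nat)) (c : nat -> nat -> C) f :
  uniq r -> (forall e, e \notin r -> c e.1 e.2 = 0) ->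
  (forall h k, f (a + h) (b + k) = \sum_(e <- r) c e.1 e.2 * h ^+ e.1 * k ^+ e.2) ->
  analytic2_at f a b.
Proof.
move=> ur c0 fE; apply: (@analytic2_coef _ _ _ _ c 1) => // h k _ _.
have t0 e : e \notin r -> pterm c h k e = 0 by move=> /c0; rewrite /pterm => ->; rewrite !mul0r.
split; first exact: abs_cvg_seq t0.
by rewrite (sumC_seq _ t0).
Qed.

Lemma analytic2_add a b : analytic2_at (fun x y => x + y : C) a b.
Proof.
pose c (i j : nat) : C := match i, j with 0%N, 0%N => a + b | 1%N, 0%N => 1 | 0%N, 1%N => 1 | _, _ => 0 end.
apply: (@analytic2_poly _ _ [:: (0, 0); (1, 0); (0, 1)]%N c) => //.
  by move=> [[|[|i]] [|[|j]]].
by move=> h k; rewrite !big_cons big_nil/= !expr0 !expr1; ring.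
Qed.

Lemma analytic2_mul a b : analytic2_at (fun x y => x * y : C) a b.
Proof.
pose c (i j : nat) : C := match i, j with 0%N, 0%N => a * b | 1%N, 0%N => b
  | 0%N, 1%N => a | 1%N, 1%N => 1 | _, _ => 0 end.
apply: (@analytic2_poly _ _ [:: (0, 0); (1, 0); (0, 1); (1, 1)]%N c) => //.
  by move=> [[|[|i]] [|[|j]]].
by move=> h k; rewrite !big_cons big_nil/= !expr0 !expr1; ring.
Qed.

Lemma analytic2D f g a b : analytic2_at f a b -> analytic2_at g a b ->
  analytic2_at (fun x y => f x y + g x y : C) a b.
Proof. by move=> af ag; apply: analytic2_comp (analytic2_add _ _) af ag. Qed.

Lemma analytic2M f g a b : analytic2_at f a b -> analytic2_at g a b ->
  analytic2_at (fun x y => f x y * g x y : C) a b.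
Proof. by move=> af ag; apply: analytic2_comp (analytic2_mul _ _) af ag. Qed.

Lemma analytic2X f n a b : analytic2_at f a b ->
  analytic2_at (fun x y => f x y ^+ n : C) a b.
Proof.
move=> af; elim: n => [|n IH].
  apply: (@analytic2_eq (fun _ _ => 1) _ _ _ 1) => //.
  exact: analytic2_cst.
apply: (@analytic2_eq (fun x y => f x y * f x y ^+ n) _ _ _ 1) => //.
  by move=> h k _ _; rewrite exprS.
exact: analytic2M.
Qed.

Lemma analytic2_sum (K : Type) (r : seq K) (f : K -> C -> C -> C) a b :
  (forall k, analytic2_at (f k) a b) ->
  analytic2_at (fun x y => \sum_(k <- r) f k x y) a b.
Proof.
move=> af; elim: r => [|k r IH].
  apply: (@analytic2_eq (fun _ _ => 0) _ _ _ 1) => //; first by move=> h k' _ _; rewrite big_nil.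
  exact: analytic2_cst.
apply: (@analytic2_eq (fun x y => f k x y + \sum_(k <- r) f k x y) _ _ _ 1) => //.
  by move=> h k' _ _; rewrite big_cons.
exact: analytic2D.
Qed.

Lemma analytic2_comp1 q F g a b : analytic1_with q F (g a b) ->
  analytic2_at g a b -> analytic2_at (fun x y => F (g x y)) a b.
Proof.
move=> aF ag.
by apply: (analytic2_comp (F := fun x _ => F x) (analytic1_fst (g a b) aF) ag ag).
Qed.

Lemma cexp_analytic a :
  analytic1_with (fun i => cexp a / i`!%:R) (@cexp R) a.
Proof.
exists 1 => // h _.
have e : pser (fun i => cexp a / i`!%:R) h = fun i => cexp a * expterm h i.
  by apply/funext => i; rewrite /pser /expterm mulrA mulrAC.
rewrite e; split; first by apply: abs_cvgZ; exact: expterm_abs_cvg.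
by rewrite sumCZ ?sumC_cexp ?cexpD//; exact: expterm_abs_cvg.
Qed.

Lemma cexp_derive a : is_derive (a : R[i]^o) 1 (@cexp R : R[i]^o -> R[i]^o) (cexp a).
Proof.
have := analytic1_derive (cexp_analytic a).
by rewrite (_ : 1`! = 1%N)// divr1.
Qed.

(** Fubini for a jointly summable double family: a sum of power series is the power series whose
    coefficients are the column sums. This plays the part of the theorem of Weierstrass on series of
    analytic functions. *)
Lemma analytic1_family (N : choiceType) (c : N -> nat -> C) (f : C -> C) a (rho : R) :
  0 < rho ->
  (forall h, nm h < rho -> abs_cvg (fun k : N * nat => c k.1 k.2 * h ^+ k.2)) ->
  (forall h, nm h < rho -> f (a + h) = sumC (fun n => sumC (pser (c n) h))) ->
  analytic1_with (fun j => sumC (c^~ j)) f a.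
Proof.
move=> rho0 sc fE; exists rho => // h hr; have s := sc h hr.
have e j : sumC (fun n => c n j * h ^+ j) = sumC (c^~ j) * h ^+ j.
  rewrite mulrC -sumCZ_any; first by apply: eq_sumC => n; rewrite mulrC.
  have := abs_cvg_row j (abs_cvg_swap s); congr abs_cvg.
  by apply/funext => n; rewrite mulrC.
split.
  have := abs_cvg_sumC (abs_cvg_swap s); congr abs_cvg.
  by apply/funext => j; rewrite /= e.
rewrite (fE h hr) -(sumC_pair s) -[RHS](eq_sumC (f := fun j => sumC (fun n => c n j * h ^+ j)))//.
by rewrite -(sumC_swap s) sumC_pair.
Qed.

(** Joint summability is used at one nonzero point, where the power of h can be divided out. *)
Lemma analytic1_family_coef (N : choiceType) (c : N -> nat -> C) (rho : R) j :
  0 < rho ->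
  (forall h, nm h < rho -> abs_cvg (fun k : N * nat => c k.1 k.2 * h ^+ k.2)) ->
  abs_cvg (c^~ j).
Proof.
move=> rho0 sc; have r2 : 0 < rho / 2 by rewrite divr_gt0.
have rn : (rho / 2)%:C != 0 :> C by rewrite -nm_gt0 nmC gtr0_norm.
have h1 : nm (rho / 2)%:C < rho by rewrite nmC gtr0_norm//; lra.
have := abs_cvgZ ((rho / 2)%:C ^- j) (abs_cvg_row j (abs_cvg_swap (sc _ h1))).
congr abs_cvg; apply/funext => n /=.
by rewrite mulrC mulfK// expf_neq0.
Qed.

(** The m-th term at u + h is expanded by the binomial formula. Summability of all resulting terms
    is convergence of the series at the real point |u| + |h|, which is why h is restricted to |h| <
    r - |u|. *)
Lemma pser_recenter (q : nat -> C) (r : R) u :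
  (forall h, nm h < r -> abs_cvg (pser q h)) -> nm u < r ->
  abs_cvg (fun m => q m.+1 * m.+1%:R * u ^+ m) /\
  exists2 q', analytic1_with q' (fun x => sumC (pser q x)) u
            & q' 1%N = sumC (fun m => q m.+1 * m.+1%:R * u ^+ m).
Proof.
move=> sq ur.
pose c m j : C := if (j <= m)%N then q m * ('C(m, j)%:R * u ^+ (m - j)) else 0.
have cin m j h : j \notin iota 0 m.+1 -> c m j * h ^+ j = 0.
  by rewrite mem_iota/= add0n ltnS => /negbTE jm; rewrite /c jm mul0r.
have rho0 : 0 < r - nm u by rewrite subr_gt0.
have sc h : nm h < r - nm u -> abs_cvg (fun k : nat * nat => c k.1 k.2 * h ^+ k.2).
    move=> hr; pose B m := nm (q m) * (nm u + nm h) ^+ m.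
    have uh0 : 0 <= nm u + nm h by rewrite addr_ge0// nm_ge0.
    apply: (@abs_cvg_pair _ _ _ _ B).
      move=> m /=; rewrite (@nsum_seq _ _ (iota 0 m.+1)) ?iota_uniq//; last 2 first.
      + by move=> j; exact: nm_ge0.
      + by move=> j /(cin m j h) ->; rewrite nm0.
      rewrite lee_fin -/(index_iota 0 m.+1) big_mkord /B exprDn mulr_sumr.
      apply: ler_sum => j _; rewrite /c -ltnS ltn_ord !nmM !nmX nm_nat.
      rewrite -mulr_natr le_eqVlt; apply/orP; left; apply/eqP; ring.
    have /abs_cvg_nsum : abs_cvg (pser q (nm u + nm h)%:C).
      by apply: sq; rewrite nmC ger0_norm//; lra.
    apply: le_lt_trans; apply: le_nsum => m.
    by rewrite /pser nmM nmX nmC ger0_norm.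
split.
  have Si : injective S by move=> i j [].
  have := abs_cvg_sub Si (analytic1_family_coef 1%N rho0 sc); congr abs_cvg.
  by apply/funext => m; rewrite /c/= bin1 subn1/= mulrA.
exists (fun j => sumC (c^~ j)).
  apply: (analytic1_family rho0 sc).
    move=> h hr; apply: eq_sumC => m.
    rewrite (@sumC_seq _ _ (iota 0 m.+1)) ?iota_uniq//; last first.
      by move=> j; exact: cin.
    rewrite -/(index_iota 0 m.+1) big_mkord /pser exprDn mulr_sumr.
    apply: eq_bigr => j _; rewrite /c -ltnS ltn_ord -mulr_natr; ring.
rewrite (@sumC_inj _ _ _ S); last 2 first.
- by move=> i j [].
- by case=> [_|m /(_ m)]; rewrite ?eqxx.
by apply: eq_sumC => m; rewrite /c/= bin1 subn1/= mulrA.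
Qed.

Lemma sumC_recl (f : nat -> C) : abs_cvg f -> sumC f = f 0%N + sumC (f \o S).
Proof.
move=> sf; pose d i := if i == 0%N then f 0%N else 0.
have d0 i : i \notin [:: 0%N] -> d i = 0 by rewrite inE /d => /negbTE ->.
have sd : abs_cvg d by exact: abs_cvg_seq d0.
have -> : f 0%N = sumC d by rewrite (sumC_seq _ d0)// big_seq1.
have Si : injective S by move=> i j [].
pose g i := if i == 0%N then 0 else f i.
have g0 j : (forall i, S i != j) -> g j = 0.
  by case: j => // j /(_ j); rewrite eqxx.
have -> : f \o S = g \o S by [].
rewrite -(sumC_inj Si g0) -sumCD//.
  by apply: eq_sumC; case=> [|i]; rewrite /d /g/= ?addr0 ?add0r.
by apply: abs_cvg_dom sf => i; rewrite /g; case: eqP; rewrite ?nm0 ?nm_ge0.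
Qed.

(** Induction on m by dividing the series by h. The quotient is known to vanish only for h different
    from 0, so its constant term has to be reached as a limit. *)
Lemma pser_eq0 (q : nat -> C) (r : R) : 0 < r ->
  (forall h, nm h < r -> abs_cvg (pser q h)) ->
  (forall h, nm h < r -> sumC (pser q h) = 0) -> forall m, q m = 0.
Proof.
move=> r0 sq q0 m; elim: m q sq q0 => [|m IH] q sq q0.
  by rewrite -pser0 q0// nm0.
have q00 : q 0%N = 0 by rewrite -pser0 q0// nm0.
pose p i := q i.+1.
have pq h : h != 0 -> nm h < r -> abs_cvg (pser p h) /\ sumC (pser p h) = 0.
  move=> h0 hr; have e : pser q h \o S = fun i => h * pser p h i.
    by apply/funext => i; rewrite /= /pser /p exprS; ring.
  have s1 : abs_cvg (fun i => h * pser p h i).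
    by rewrite -e; apply: abs_cvg_sub; [move=> i j []|exact: sq].
  split.
    have := abs_cvgZ h^-1 s1; congr abs_cvg; apply/funext => i.
    by rewrite mulKf.
  have := sumC_recl (sq h hr); rewrite q0// /pser expr0 mulr1 q00 add0r.
  rewrite -/(pser q h) e sumCZ_any// => /esym/eqP.
  by rewrite mulf_eq0 (negbTE h0)/= => /eqP.
have sp h : nm h < r -> abs_cvg (pser p h).
  have [-> _|h0 hr] := eqVneq h 0; last by case: (pq h h0 hr).
  apply: (@abs_cvg_seq _ _ [:: 0%N]) => // i; rewrite inE.
  by case: i => // i _; rewrite /pser exprS mul0r mulr0.
have u0 : 0 < r / 2 by rewrite divr_gt0.
have ur : r / 2 < r by lra.
have nu : nm (r / 2)%:C < r by rewrite nmC gtr0_norm.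
(* If the constant term were nonzero, the linear approximation at a small real t > 0, where the sum
   is 0, would bound its modulus by half of itself. *)
have p0 : p 0%N = 0.
  have [B pB] := pser_quad u0 (sp _ nu).
  apply/eqP; rewrite -nm_eq0; apply/negPn/negP => p0.
  have P0 : 0 < nm (p 0%N) by rewrite lt_def p0 nm_ge0.
  set D := nm (p 1%N) + `|B| * (r / 2) + 1.
  have D0 : 0 < D.
    by rewrite /D ltr_pwDr// addr_ge0 ?nm_ge0// mulr_ge0// ltW.
  set t := Num.min (r / 2) (nm (p 0%N) / D / 2).
  have t0 : 0 < t by rewrite lt_min u0 !divr_gt0.
  have tu : t <= r / 2 by rewrite ge_min lexx.
  have tp : t * D <= nm (p 0%N) / 2.
    rewrite -ler_pdivlMr//; rewrite {1}/t ge_min; apply/orP; right.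
    by rewrite mulrAC.
  have t0' : t%:C != 0 :> C by rewrite -nm_gt0 nmC gtr0_norm.
  have nt : nm t%:C = t by rewrite nmC gtr0_norm.
  have tr : nm t%:C < r by rewrite nt; exact: le_lt_trans ur.
  have := pB t%:C; rewrite nt => /(_ tu); rewrite (pq _ t0' tr).2 => h1.
  have : nm (p 0%N) <= B * t ^+ 2 + nm (p 1%N) * t.
    have e0 : p 0%N = - ((0 - p 0%N - p 1%N * t%:C) + p 1%N * t%:C) by ring.
    rewrite {1}e0 nmN; apply: le_trans (nmD _ _) _.
    by rewrite [nm (_ * t%:C)]nmM nt lerD2r.
  have : B * t ^+ 2 <= `|B| * (r / 2) * t.
    rewrite expr2 mulrA; apply: ler_wpM2r; first exact: ltW.
    apply: (@le_trans _ _ (`|B| * t)); first by rewrite ler_wpM2r ?ler_norm// ltW.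
    by rewrite ler_wpM2l.
  move: tp; rewrite /D; nra.
by apply: (IH p) => // h hr; have [->|h0] := eqVneq h 0;
  [rewrite pser0|case: (pq h h0 hr)].
Qed.

End OneVariable.

(** * General Dirichlet series *)

Section Dirichlet.
Context {R : realType}.
Local Notation C := R[i].

Definition dterm (a : R -> C) (t : C) (n : R) : C := a n * cexp (n%:C * t).

Lemma Re_realM (n : R) (t : C) : complex.Re (n%:C * t) = n * complex.Re t.
Proof. by case: t => x y /=; rewrite mul0r subr0. Qed.

(** Around t the n-th term is its value at t times the exponential series of n h, whose moduli add
    up to e^(|n| |h|), at most e^(n |h|) + e^(-n |h|). Convergence at t + |h| and t - |h|, which
    stay in the left half-plane for |h| < - Re t, thus makes the double family in n and the power of
    h summable. *)
Lemma dirichlet (a : R -> C) :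
  (forall t, complex.Re t < 0 -> abs_cvg (dterm a t)) ->
  forall t, complex.Re t < 0 ->
    abs_cvg (dterm (fun n => n%:C * a n) t) /\
    exists2 q, analytic1_with q (fun x => sumC (dterm a x)) t
             & q 1%N = sumC (dterm (fun n => n%:C * a n) t).
Proof.
move=> sa t t0; set rho := - complex.Re t.
have rho0 : 0 < rho by rewrite oppr_gt0.
pose c n j := dterm a t n * (n%:C ^+ j / j`!%:R).
have ce n h : pser (c n) h = fun j => dterm a t n * expterm (n%:C * h) j.
  by apply/funext => j; rewrite /pser /c /expterm exprMn; ring.
have sc h : nm h < rho -> abs_cvg (fun k : R * nat => c k.1 k.2 * h ^+ k.2).
  move=> hr.
  pose B n := nm (dterm a (t + (nm h)%:C) n) + nm (dterm a (t - (nm h)%:C) n).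
  have rp : complex.Re (t + (nm h)%:C) < 0.
    by rewrite raddfD/=; move: hr; rewrite /rho; lra.
  have rm : complex.Re (t - (nm h)%:C) < 0.
    by rewrite raddfB/=; have := nm_ge0 h; lra.
  have B0 n : 0 <= B n by rewrite addr_ge0// nm_ge0.
  have sumE n : expR (`|n| * nm h) = fine (nsum (fun j => nm (expterm (`|n|%:C * (nm h)%:C) j))).
    have e0 j : 0 <= nm (expterm (`|n|%:C * (nm h)%:C) j) by exact: nm_ge0.
    have soo := abs_cvg_nsum (expterm_abs_cvg (`|n|%:C * (nm h)%:C)).
    have := cvg_nsum e0 soo; rewrite (_ : (fun j => _) = exp_coeff (`|n| * nm h)).
      move=> /(cvg_lim (@Rhausdorff R)) <-.
      by rewrite /expR.
    apply/funext => j; rewrite /expterm nmM nmX nmV nm_nat -rmorphM/= nmC.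
    by rewrite ger0_norm// mulr_ge0// nm_ge0.
  apply: (@abs_cvg_pair _ _ _ _ B); last first.
    rewrite nsumD; try (by move=> n; exact: nm_ge0).
    by apply: lte_add_pinfty; apply: abs_cvg_nsum; exact: sa.
  move=> n /=.
  have soo := abs_cvg_nsum (expterm_abs_cvg (`|n|%:C * (nm h)%:C)).
  have e0 j : 0 <= nm (expterm (`|n|%:C * (nm h)%:C) j) by exact: nm_ge0.
  apply: (@le_trans _ _ (nsum (fun j => nm (dterm a t n) * nm (expterm (`|n|%:C * (nm h)%:C) j)))).
    apply: le_nsum => j; rewrite -/(pser (c n) h j) ce nmM.
    by rewrite /expterm !nmM !nmX !nmM !nmC normr_id [`|nm h|]ger0_norm ?nm_ge0.
  rewrite nsumZ// ?nm_ge0// -(nsum_fin e0 soo) -sumE -EFinM lee_fin.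
  rewrite /B /dterm !nmM !nm_cexp !Re_realM !raddfD raddfN/=.
  rewrite -mulrA -mulrDr; apply: ler_wpM2l; first exact: nm_ge0.
  rewrite !mulrDr !expRD -mulrDr; apply: ler_wpM2l; first exact: expR_ge0.
  rewrite mulrN; case: (ger0P n) => n0.
    by rewrite lerDl expR_ge0.
  by rewrite mulNr lerDr expR_ge0.
have fE h : nm h < rho ->
    sumC (dterm a (t + h)) = sumC (fun n => sumC (pser (c n) h)).
  move=> hr; apply: eq_sumC => n; rewrite ce sumCZ ?sumC_cexp; last exact: expterm_abs_cvg.
  by rewrite /dterm mulrDr cexpD mulrA.
have e1 : dterm (fun n => n%:C * a n) t = c^~ 1%N.
  by apply/funext => n; rewrite /dterm /c /dterm expr1 divr1; ring.
split; first by rewrite e1; exact: analytic1_family_coef rho0 sc.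
exists (fun j => sumC (c^~ j)); last by rewrite e1.
exact: (analytic1_family rho0 sc fE).
Qed.

End Dirichlet.

Lemma is_derive_chain (K : numFieldType) (f g : K -> K) (x df dg : K) :
  is_derive (g x) 1 f df -> is_derive x 1 g dg ->
  is_derive x 1 (f \o g) (df * dg).
Proof.
move=> [f1 f2] [g1 g2].
have df1 : differentiable f (g x) by apply/derivable1_diffP.
have dg1 : differentiable g x by apply/derivable1_diffP.
have dfg : differentiable (f \o g) x by exact: differentiable_comp.
split; first exact: diff_derivable.
have e := congr1 (fun h => h 1) (diff_comp dg1 df1).
transitivity ('d (f \o g) x (1 : K)); first exact: deriveE dfg.
have e1 : 'd g x (1 : K) = dg by rewrite -g2; apply/esym; exact: deriveE dg1.
transitivity ('d f (g x) dg); first exact: etrans e (congr1 ('d f (g x)) e1).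
have -> : dg = dg *: (1 : K) by rewrite [RHS]mulr1.
have e2 : 'd f (g x) (1 : K) = df by rewrite -f2; apply/esym; exact: deriveE df1.
rewrite linearZ e2.
by rewrite mulrC [dg *: 1]mulr1.
Qed.

(** * The logarithm near 1 *)

Section Logarithm.
Context {R : realType}.
Local Notation C := R[i].

Lemma near_derive (f g : C -> C) (x d : C) (rho : R) : 0 < rho ->
  (forall h, nm h < rho -> f (x + h) = g (x + h)) ->
  is_derive (x : R[i]^o) 1 (f : R[i]^o -> R[i]^o) d ->
  is_derive (x : R[i]^o) 1 (g : R[i]^o -> R[i]^o) d.
Proof.
move=> rho0 fg; apply: near_eq_is_derive.
apply/nbhs_ballP; exists rho%:C => /=; first by rewrite ltcR.
move=> y; rewrite /ball/= normlt => hy.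
by rewrite -(subrK x y) addrC fg// -nmN opprB.
Qed.

Lemma derive_near_uniq (f g : C -> C) (x d1 d2 : C) (rho : R) : 0 < rho ->
  (forall h, nm h < rho -> f (x + h) = g (x + h)) ->
  is_derive (x : R[i]^o) 1 (f : R[i]^o -> R[i]^o) d1 ->
  is_derive (x : R[i]^o) 1 (g : R[i]^o -> R[i]^o) d2 -> d1 = d2.
Proof.
move=> rho0 fg f1 [_ <-]; have [_ <-] := near_derive rho0 fg f1.
by [].
Qed.

Definition lcoef (i : nat) : C := if i == 0%N then 0 else - (-1) ^+ i / i%:R.

Lemma geom_abs_cvg (u : C) : nm u < 1 -> abs_cvg (fun i => u ^+ i).
Proof.
move=> u1; apply: (@abs_cvg_le _ _ _ (fun i => nm u ^+ i)).
  by move=> i; rewrite nmX.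
apply: nsum_cvg; first by move=> i; rewrite exprn_ge0// nm_ge0.
rewrite (_ : (fun i => _) = geometric 1 (nm u)).
  by apply: is_cvg_geometric_series; rewrite ger0_norm ?nm_ge0.
by apply/funext => i; rewrite /= mul1r.
Qed.

Lemma lcoef_abs_cvg u : nm u < 1 -> abs_cvg (pser lcoef u).
Proof.
move=> u1; apply: abs_cvg_dom (geom_abs_cvg u1) => i.
rewrite /pser /lcoef; case: i => [|i]; first by rewrite mul0r nm0 nm_ge0.
rewrite !nmM nmN nmV nm_nat !nmX nmN nm1 expr1n mul1r.
by rewrite ler_piMl ?exprn_ge0 ?nm_ge0// invf_le1// ler1n.
Qed.

Definition log1p (u : C) : C := sumC (pser lcoef u).

(** Termwise differentiation of the series leaves the geometric series of - u. *)
Lemma log1p_derive u : nm u < 1 ->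
  is_derive (u : R[i]^o) 1 (log1p : R[i]^o -> R[i]^o) ((1 + u)^-1).
Proof.
move=> u1; have [_ [q qu q1]] := pser_recenter lcoef_abs_cvg u1.
have := analytic1_derive qu; rewrite q1.
rewrite (eq_sumC (g := fun m => (- u) ^+ m)); last first.
  move=> m; rewrite /lcoef/= exprS mulN1r opprK [(- u) ^+ m]exprNn divfK//.
have nu : nm (- u) < 1 by rewrite nmN.
have u0 : 1 + u != 0.
  apply/eqP => u0; move: u1; rewrite (_ : u = -1) ?nmN ?nm1 ?ltxx//.
  by rewrite -(addrK u 1) u0; ring.
have sE : (1 + u) * sumC (fun m => (- u) ^+ m) = 1.
  rewrite mulrDl mul1r {1}(sumC_recl (geom_abs_cvg nu)) expr0 -addrA.
  rewrite -sumCZ; last exact: geom_abs_cvg.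
  rewrite (eq_sumC (g := fun m => (- u) * (- u) ^+ m)); last by move=> m; rewrite -exprS.
  rewrite sumCZ ?sumCZ; try exact: geom_abs_cvg.
  by rewrite mulNr addNr addr0.
by rewrite -[sumC _](mulKf u0) sE mulr1.
Qed.

Lemma log1p_analytic : analytic1_with lcoef log1p 0.
Proof.
exists 1 => [|h h1]; first exact: ltr01.
split; first exact: lcoef_abs_cvg.
exact: (congr1 log1p (add0r h)).
Qed.

(** G(u) = exp(log1p u) satisfies (1 + u) G' = G and G(0) = 1. On the coefficients this reads (m +
    1) g_(m+1) = (1 - m) g_m, whose only solution with g_0 = 1 is 1 + u. *)
Lemma cexp_log1p : exists2 r : R, 0 < r <= 1 & forall u, nm u < r ->
  cexp (log1p u) = 1 + u.
Proof.
have log0 : log1p 0 = 0 by rewrite /log1p pser0.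
have aG : analytic2_at (fun x _ : C => cexp (log1p x)) 0 0.
  apply: analytic2_comp1 (cexp_analytic _) _.
  exact: analytic1_fst log1p_analytic.
have [g [r' r'0 gE']] := analytic2_row aG.
set r := Num.min r' 1.
have r0 : 0 < r by rewrite lt_min r'0 ltr01.
have r1 : r <= 1 by rewrite ge_min lexx orbT.
have rr' : r <= r' by rewrite ge_min lexx.
have sg h : nm h < r -> abs_cvg (pser g h).
  by move=> hr; apply: (gE' h _).1; exact: lt_le_trans rr'.
have gE h : nm h < r -> cexp (log1p h) = sumC (pser g h).
  by move=> hr; rewrite -(gE' h _).2 ?add0r//; exact: lt_le_trans rr'.
have g0 : g 0%N = 1 by rewrite -pser0 -gE ?nm0// log0 cexp0.
pose g1 m := g m.+1 * m.+1%:R.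
have dG u : nm u < r -> abs_cvg (pser g1 u) /\ (1 + u) * sumC (pser g1 u) = sumC (pser g u).
  move=> ur; have [sg1 [q qu q1]] := pser_recenter sg ur.
  have u1 : nm u < 1 by exact: lt_le_trans r1.
  have dL := log1p_derive u1.
  have dE := @is_derive_chain R[i] _ _ _ _ _ (cexp_derive (log1p u)) dL.
  have dq := analytic1_derive qu.
  have e1 : sumC (pser g1 u) = q 1%N by rewrite q1.
  have u0 : 1 + u != 0.
    apply/eqP => u0; move: u1; rewrite (_ : u = -1) ?nmN ?nm1 ?ltxx//.
    by rewrite -(addrK u 1) u0; ring.
  split => //; rewrite e1 -(gE u ur).
  have <- : cexp (log1p u) * (1 + u)^-1 = q 1%N.
    have ru : 0 < r - nm u by rewrite subr_gt0.
    apply: (derive_near_uniq ru _ dE dq) => h hu /=; apply: gE.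
    by apply: le_lt_trans (nmD _ _) _; move: hu; lra.
  by rewrite mulrCA mulfV// mulr1.
(* The coefficients of (1 + u) G' - G, which all vanish by [pser_eq0]. *)
pose d m := m.+1%:R * g m.+1 + m%:R * g m - g m.
have gd u : nm u < r -> abs_cvg (pser d u) /\ sumC (pser d u) = 0.
  move=> ur; have [s1 e1] := dG u ur.
  have s2 : abs_cvg (fun m => m%:R * g m * u ^+ m).
    apply/(@abs_cvg_inj _ _ _ S) => [i j []//|[|m /(_ m)]|].
    - by rewrite !mul0r.
    - by rewrite eqxx.
    - have := abs_cvgZ u s1; congr abs_cvg; apply/funext => m /=.
      by rewrite /pser /g1 exprS; ring.
  have dE m : pser d u m = pser g1 u m + m%:R * g m * u ^+ m + (-1) * pser g u m.
    by rewrite /pser /d /g1; ring.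
  have s3 := abs_cvgD (abs_cvgD s1 s2) (abs_cvgZ (-1) (sg u ur)).
  split; first by apply: abs_cvg_dom s3 => m; rewrite dE.
  rewrite (eq_sumC dE) sumCD; [|exact: abs_cvgD|by apply: abs_cvgZ; exact: sg].
  rewrite sumCD// sumCZ; last exact: sg.
  rewrite -e1 mulrDl mul1r (sumC_recl s2) !mul0r add0r -(sumCZ u s1).
  rewrite [X in _ + X + _](eq_sumC (g := fun m => u * pser g1 u m)).
    by rewrite mulN1r subrr.
  by move=> m /=; rewrite /pser /g1 exprS; ring.
have dz := pser_eq0 r0 (fun h hr => (gd h hr).1) (fun h hr => (gd h hr).2).
have gS m : m.+1%:R * g m.+1 = (1 - m%:R) * g m.
  by apply/eqP; rewrite -subr_eq0 -[X in _ == X](dz m) /d; apply/eqP; ring.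
have gg1 : g 1%N = 1 by have := gS 0%N; rewrite mul1r subr0 mul1r g0.
have g2 m : g m.+2 = 0.
  elim: m => [|m IH].
    by have /eqP := gS 1%N; rewrite subrr mul0r mulf_eq0 pnatr_eq0 => /eqP.
  by have /eqP := gS m.+2; rewrite IH mulr0 mulf_eq0 pnatr_eq0 => /eqP.
exists r; first by rewrite r0.
move=> u ur; rewrite gE// (@sumC_seq _ _ [:: 0; 1]%N)//.
  by rewrite !big_cons big_nil /pser g0 gg1 expr0 expr1 !mul1r addr0.
by move=> m; rewrite !inE /pser; case: m => [|[|m]]// _; rewrite g2 mul0r.
Qed.

End Logarithm.

(** * Branches of the logarithm and termwise differentiation *)

Section Branches.
Context {R : realType}.
Local Notation C := R[i].

Lemma nm_sqr (z : C) : nm z ^+ 2 = complex.Re z ^+ 2 + complex.Im z ^+ 2.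
Proof. by rewrite /nm normc_def/= sqr_sqrtr// addr_ge0// sqr_ge0. Qed.

Lemma nmE (z : C) : complex.Re `|z| = nm z. Proof. by []. Qed.

Lemma ImD (x y : C) : complex.Im (x + y) = complex.Im x + complex.Im y.
Proof. by case: x; case: y. Qed.

Lemma cos2piB (t : R) : cos (2 * pi - t) = cos t.
Proof. by rewrite mulr_natl addrC cosD2pi cosN. Qed.

Lemma sin2piB (t : R) : sin (2 * pi - t) = - sin t.
Proof. by rewrite mulr_natl addrC sinD2pi sinN. Qed.

Lemma carg_spec (z : C) : z != 0 ->
  [/\ 0 <= carg z < 2 * pi, cos (carg z) = complex.Re z / nm z
    & sin (carg z) = complex.Im z / nm z].
Proof.
move=> z0; have nz : 0 < nm z by rewrite nm_gt0.
have nz' : nm z != 0 by rewrite gt_eqF.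
set x := complex.Re z / nm z; set y := complex.Im z / nm z.
have xy : x ^+ 2 + y ^+ 2 = 1.
  by rewrite /x /y !expr_div_n -mulrDl -nm_sqr mulfV// expf_neq0.
have x1 : -1 <= x <= 1.
  by have := sqr_ge0 y; move: xy; rewrite !expr2 => xy y0; apply/andP; split; nra.
have xin : x \in `[(-1), 1] by rewrite in_itv.
have pi0 := pi_gt0 R.
have sa : sin (acos x) = `|y|.
  by rewrite sin_acos// -sqrtr_sqr; congr Num.sqrt; rewrite -xy addrAC subrr add0r.
have a0 := acos_ge0 x1; have a1 := acos_lepi x1.
rewrite /carg nmE -/x; case: ifPn => [iz|].
  have y0 : 0 <= y by rewrite divr_ge0// ltW.
  split; [|exact: acosK|by rewrite sa ger0_norm].
  by rewrite a0/=; apply: le_lt_trans a1 _; lra.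
rewrite -ltNge => iz.
have y0 : y < 0 by rewrite ltr_pdivrMr// mul0r.
have ag : 0 < acos x.
  apply: acos_gt0; move: x1 => /andP[-> x1]; rewrite lt_neqAle x1 andbT.
  apply/eqP => xE; move: xy; rewrite xE expr1n => /eqP.
  by rewrite -subr_eq0 addrAC subrr add0r sqrf_eq0 lt_eqF.
split; [|by rewrite cos2piB acosK|by rewrite sin2piB sa ltr0_norm// opprK].
by apply/andP; split; lra.
Qed.

Lemma cexp_clog (z : C) : z != 0 -> cexp (clog z) = z.
Proof.
move=> z0; have nz : 0 < nm z by rewrite nm_gt0.
have [_ cz sz] := carg_spec z0.
rewrite /clog nmE /cexp/= cz sz lnK ?posrE// mulrC divfK ?gt_eqF//.
by rewrite mulrC divfK ?gt_eqF//; case: (z).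
Qed.

Lemma clogK (s : C) : 0 <= complex.Im s < 2 * pi -> clog (cexp s) = s.
Proof.
move=> /andP[y0 y2]; have ne := nm_cexp s.
have e0 := expR_gt0 (complex.Re s).
rewrite /clog nmE ne expRK; apply/eqP; rewrite eq_complex/= eqxx/=.
have cE : complex.Re (cexp s) / expR (complex.Re s) = cos (complex.Im s).
  by rewrite /= mulrAC mulfV ?mul1r// gt_eqF.
rewrite /carg nmE ne cE [complex.Im (cexp s)]/= pmulr_rge0//.
have pi0 := pi_gt0 R.
case: (leP (complex.Im s) pi) => ypi.
  rewrite sin_ge0_pi ?y0//; apply/eqP; apply: cosK.
  by rewrite in_itv/= y0.
have sy : sin (complex.Im s) < 0.
  have := @sin_gt0_pi R (2 * pi - complex.Im s).
  by rewrite sin2piB oppr_gt0; apply; apply/andP; split; lra.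
rewrite leNgt sy/=; apply/eqP.
rewrite -(cos2piB (complex.Im s)) cosK; first by ring.
by rewrite in_itv/=; apply/andP; split; lra.
Qed.

Lemma cexp_2pi (p : int) : cexp ((2 * pi * p%:~R) *i : C) = 1.
Proof.
have nat_case (n : nat) : cexp ((2 * pi * n%:R) *i : C) = 1.
  elim: n => [|n IH].
    by rewrite mulr0 (_ : 0 *i = 0)// cexp0.
  have -> : (2 * pi * n.+1%:R) *i = (2 * pi * n%:R) *i + (2 * pi) *i :> C.
    apply/eqP; rewrite eq_complex/= addr0 eqxx/=.
    by apply/eqP; rewrite -natr1; ring.
  rewrite cexpD IH mul1r /cexp/= expR0 !mul1r mulr_natl cos2pi sin2pi.
  by [].
case: p => n; first exact: nat_case.
rewrite NegzE rmorphN/= mulrN.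
have -> : (- (2 * pi * n.+1%:~R)) *i = - ((2 * pi * n.+1%:R) *i) :> C.
  by apply/eqP; rewrite eq_complex/= oppr0 !eqxx.
by rewrite cexpN nat_case invr1.
Qed.

Lemma cexp_lbranch p (z : C) : z != 0 -> cexp (lbranch p z) = z.
Proof. by move=> z0; rewrite /lbranch cexpD cexp_2pi mulr1 cexp_clog. Qed.

Lemma Re_lbranch p (z : C) : complex.Re (lbranch p z) = ln (nm z).
Proof. by rewrite /lbranch raddfD/= addr0. Qed.

(** Off the cut, adding log1p (h / z) to [clog z] moves the argument by less than its distance to 0
    and to 2 pi, so the sum still lies in the strip on which [clog] inverts [cexp]. *)
Lemma clog_near (z : C) : z != 0 -> 0 < carg z < 2 * pi ->
  exists2 rho : R, 0 < rho & forall h, nm h < rho ->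
    [/\ nm (h / z) < 1, clog (z + h) = clog z + log1p (h / z), z + h != 0
      & 0 < carg (z + h) < 2 * pi].
Proof.
move=> z0 /andP[a0 a2]; have nz : 0 < nm z by rewrite nm_gt0.
have [r /andP[r0 r1] rE] := @cexp_log1p R.
have h1 : (0 : R) < 1 / 2 by rewrite divr_gt0.
have s1 : abs_cvg (pser (@lcoef R) (1 / 2)%:C).
  by apply: lcoef_abs_cvg; rewrite nmC gtr0_norm//; lra.
have [B BE] := pser_quad h1 s1.
(* A Lipschitz constant at 0: |log1p u| <= D |u| for |u| < 1 / 2. *)
set D := `|B| + 1; have D0 : 0 < D by rewrite ltr_pwDr.
set e := Num.min (carg z) (2 * pi - carg z).
have e0 : 0 < e by rewrite lt_min a0 subr_gt0.
set d := Num.min r (Num.min (1 / 2) (e / D)).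
have d0 : 0 < d by rewrite !lt_min r0 h1 divr_gt0.
have small u : nm u < d -> `|complex.Im (log1p u)| < e.
  move=> ud; have /and3P[ur uh ue] : [&& nm u < r, nm u < 1 / 2 & nm u < e / D].
    by move: ud; rewrite /d !lt_min.
  apply: le_lt_trans (Im_le_nm _) _.
  have := BE u (ltW uh); rewrite -/(log1p u) /lcoef/= expr1 opprK divr1 subr0 mul1r => Bu.
  have : nm (log1p u) <= nm (log1p u - u) + nm u by rewrite -{1}(subrK u (log1p u)) nmD.
  move: ue; rewrite ltr_pdivlMr// => ue.
  have : B * nm u ^+ 2 <= `|B| * nm u.
    have u0 := nm_ge0 u; rewrite expr2 mulrA; apply: ler_wpM2r => //.
    apply: (@le_trans _ _ (`|B| * nm u)); first by rewrite ler_wpM2r ?ler_norm.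
    by rewrite ler_piMr//; lra.
  move: ue; rewrite /D; lra.
have dr : d <= r by rewrite ge_min lexx.
exists (nm z * d) => [|h hd]; first by rewrite mulr_gt0.
have ud : nm (h / z) < d by rewrite nmM nmV ltr_pdivrMr// mulrC.
have zE : z + h = cexp (clog z + log1p (h / z)).
  rewrite cexpD cexp_clog// rE; first by field.
  exact: lt_le_trans dr.
have e1 : e <= carg z by rewrite ge_min lexx.
have e2 : e <= 2 * pi - carg z by rewrite ge_min lexx orbT.
have := small _ ud; rewrite ltr_norml => /andP[s2 s3].
have clogE : clog (z + h) = clog z + log1p (h / z).
  rewrite zE; apply: clogK; rewrite ImD -[complex.Im (clog z)]/(carg z).
  by apply/andP; split; lra.
split => //.
- exact: lt_le_trans ud (le_trans dr r1).
- by rewrite zE cexp_neq0.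
- rewrite -[carg (z + h)]/(complex.Im (clog (z + h))) clogE ImD.
  by rewrite -[complex.Im (clog z)]/(carg z); apply/andP; split; lra.
Qed.

Lemma lbranch_analytic p (z : C) : z != 0 -> 0 < carg z < 2 * pi ->
  exists2 q, analytic1_with q (lbranch p) z & q 1%N = z^-1.
Proof.
move=> z0 az; have [rho rho0 near] := clog_near z0 az.
exists (fun i => if i == 0%N then lbranch p z else @lcoef R i * z^-1 ^+ i); last first.
  by rewrite /= /lcoef/= expr1 opprK divr1 mul1r.
set q := fun i : nat => _.
exists rho => // h hd; have [ud clogE _ _] := near h hd.
have su : abs_cvg (pser (@lcoef R) (h / z)) by exact: lcoef_abs_cvg.
pose c i : C := if i == 0%N then lbranch p z else 0.
have c0 i : i \notin [:: 0%N] -> c i = 0 by rewrite inE /c => /negbTE ->.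
have sc : abs_cvg c by exact: abs_cvg_seq c0.
have qE i : pser q h i = c i + pser (@lcoef R) (h / z) i.
  case: i => [|i]; rewrite /pser /q /c /=.
    by rewrite /lcoef/= mul0r addr0 expr0 mulr1.
  by rewrite add0r exprMn; ring.
split; first by have := abs_cvgD sc su; congr abs_cvg; apply/funext => i; rewrite qE.
rewrite (eq_sumC qE) sumCD// (sumC_seq _ c0)// big_seq1 /c/=.
by rewrite /lbranch clogE -/(log1p (h / z)); ring.
Qed.

End Branches.

(** * Families that can be differentiated term by term *)

Section GoodFamilies.
Context {R : realType}.
Local Notation C := R[i].

Definition der1 (f : C -> C -> C) a b d :=
  is_derive (a : R[i]^o) 1 ((fun z => f z b) : R[i]^o -> R[i]^o) d.

Definition der2 (f : C -> C -> C) a b d :=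
  is_derive (b : R[i]^o) 1 ((fun z => f a z) : R[i]^o -> R[i]^o) d.

Lemma der1_uniq f a b d d' : der1 f a b d -> der1 f a b d' -> d = d'.
Proof. by move=> [_ <-] [_ <-]. Qed.

Lemma der2_uniq f a b d d' : der2 f a b d -> der2 f a b d' -> d = d'.
Proof. by move=> [_ <-] [_ <-]. Qed.

Lemma analytic2_der1 f a b : analytic2_at f a b -> exists d, der1 f a b d.
Proof. by move=> /analytic2_row[q /analytic1_derive]; exists (q 1%N). Qed.

Lemma analytic2_der2 f a b : analytic2_at f a b -> exists d, der2 f a b d.
Proof. by move=> /analytic2_swap/analytic2_der1. Qed.

Lemma der1D f g a b d e : der1 f a b d -> der1 g a b e ->
  der1 (fun x y => f x y + g x y) a b (d + e).
Proof. by move=> df dg; exact: (is_deriveD df dg). Qed.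

Lemma der2D f g a b d e : der2 f a b d -> der2 g a b e ->
  der2 (fun x y => f x y + g x y) a b (d + e).
Proof. by move=> df dg; exact: (is_deriveD df dg). Qed.

Lemma der1M f g a b d e : der1 f a b d -> der1 g a b e ->
  der1 (fun x y => f x y * g x y) a b (f a b * e + g a b * d).
Proof. by move=> df dg; exact: (is_deriveM df dg). Qed.

Lemma der2M f g a b d e : der2 f a b d -> der2 g a b e ->
  der2 (fun x y => f x y * g x y) a b (f a b * e + g a b * d).
Proof. by move=> df dg; exact: (is_deriveM df dg). Qed.

Definition open2 (Om : C -> C -> Prop) : Prop := forall a b, Om a b ->
  exists2 rho : R, 0 < rho &
    forall h k, nm h < rho -> nm k < rho -> Om (a + h) (b + k).

(* The loci Re s2 < Re s1 and Re s1 < Re s2 are the coverings of the regions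
   |z1| > |z2| > 0 and |z2| > |z1| > 0. *)
Definition ReGt (a b : C) : Prop := complex.Re b < complex.Re a.

Definition ReLt (a b : C) : Prop := ReGt b a.

Lemma ReGt_open : open2 ReGt.
Proof.
move=> a b; rewrite /ReGt => ab; exists ((complex.Re a - complex.Re b) / 2); first by lra.
move=> h k hr kr; rewrite !raddfD/=.
have := Re_le_nm h; have := Re_le_nm k; rewrite !ler_norml => /andP[_ k1] /andP[h1 _].
by lra.
Qed.

Lemma ReLt_open : open2 ReLt.
Proof. by move=> a b /ReGt_open[rho rho0 op]; exists rho => // h k hr kr; exact: op. Qed.

Context {N : choiceType} (Om : C -> C -> Prop) (Om_open : open2 Om).

Definition sumF (T : N -> C -> C -> C) x y := sumC (fun n => T n x y).

(** The derivatives [D1] and [D2] of the terms are recorded together with the fact that they sum to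
    the derivatives of the sum, because the L(-1)-derivative property identifies them only term by
    term. *)
Record good_at (T : N -> C -> C -> C) (a b : C) (D1 D2 : N -> C) : Prop := {
  good_cvg : abs_cvg (fun n => T n a b) ;
  good_an : analytic2_at (sumF T) a b ;
  good_der1 : forall n, der1 (T n) a b (D1 n) ;
  good_cvg1 : abs_cvg D1 ;
  good_sum1 : der1 (sumF T) a b (sumC D1) ;
  good_der2 : forall n, der2 (T n) a b (D2 n) ;
  good_cvg2 : abs_cvg D2 ;
  good_sum2 : der2 (sumF T) a b (sumC D2) }.

Definition good (T : N -> C -> C -> C) : Prop :=
  forall a b, Om a b -> exists D1 D2, good_at T a b D1 D2.

(** [sumF] is additive only where both families converge. The derivatives of the sum need this
    identity in a neighbourhood, which is where openness of [Om] enters. *)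
Lemma goodD T T' : good T -> good T' -> good (fun n x y => T n x y + T' n x y).
Proof.
move=> gT gT' a b ab; have [D1 [D2 g]] := gT a b ab.
have [D1' [D2' g']] := gT' a b ab; have [rho rho0 op] := Om_open ab.
have sE h k : nm h < rho -> nm k < rho -> sumF T (a + h) (b + k) + sumF T' (a + h) (b + k)
    = sumF (fun n x y => T n x y + T' n x y) (a + h) (b + k).
  move=> hr kr; have [E1 [E2 u]] := gT _ _ (op h k hr kr).
  have [E1' [E2' u']] := gT' _ _ (op h k hr kr).
  by rewrite /sumF sumCD; [|exact: good_cvg u|exact: good_cvg u'].
exists (fun n => D1 n + D1' n), (fun n => D2 n + D2' n); split.
- exact: abs_cvgD (good_cvg g) (good_cvg g').
- exact: (analytic2_eq rho0 sE (analytic2D (good_an g) (good_an g'))).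
- by move=> n; exact: der1D (good_der1 g n) (good_der1 g' n).
- exact: abs_cvgD (good_cvg1 g) (good_cvg1 g').
- rewrite sumCD; [|exact: good_cvg1 g|exact: good_cvg1 g'].
  apply: (near_derive rho0 _ (der1D (good_sum1 g) (good_sum1 g'))) => h hr.
  by have := sE h 0 hr; rewrite nm0 addr0; exact.
- by move=> n; exact: der2D (good_der2 g n) (good_der2 g' n).
- exact: abs_cvgD (good_cvg2 g) (good_cvg2 g').
- rewrite sumCD; [|exact: good_cvg2 g|exact: good_cvg2 g'].
  apply: (near_derive rho0 _ (der2D (good_sum2 g) (good_sum2 g'))) => h hr.
  by have := sE 0 h _ hr; rewrite nm0 addr0; exact.
Qed.

Lemma good_sum (K : Type) (r : seq K) (T : K -> N -> C -> C -> C) :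
  (forall k, good (T k)) -> good (fun n x y => \sum_(k <- r) T k n x y).
Proof.
move=> gT; elim: r => [|k r IH].
  have -> : (fun n x y => \sum_(k <- [::]) T k n x y) = fun _ _ _ => 0.
    by apply/funext => n; apply/funext => x; apply/funext => y; rewrite big_nil.
  move=> a b ab; exists (fun=> 0), (fun=> 0).
  have F0 : sumF (fun _ _ _ => 0) = fun _ _ => 0.
    by apply/funext => x; apply/funext => y; rewrite /sumF sumC0.
  have d0 (z : R[i]^o) : is_derive z 1 ((fun=> 0) : R[i]^o -> R[i]^o) (0 : C).
    exact: is_derive_cst.
  split; rewrite ?F0 ?sumC0; try exact: abs_cvg0; try exact: d0.
  - exact: analytic2_cst.
  - by move=> n; exact: d0.
  - by move=> n; exact: d0.
have -> : (fun n x y => \sum_(k <- k :: r) T k n x y) =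
    fun n x y => T k n x y + \sum_(k <- r) T k n x y.
  by apply/funext => n; apply/funext => x; apply/funext => y; rewrite big_cons.
exact: goodD.
Qed.

Lemma goodM (E : C -> C -> C) T : (forall a b, Om a b -> analytic2_at E a b) ->
  good T -> good (fun n x y => E x y * T n x y).
Proof.
move=> aE gT a b ab; have [D1 [D2 g]] := gT a b ab.
have [rho rho0 op] := Om_open ab.
have [e1 dE1] := analytic2_der1 (aE a b ab).
have [e2 dE2] := analytic2_der2 (aE a b ab).
have sE h k : nm h < rho -> nm k < rho -> E (a + h) (b + k) * sumF T (a + h) (b + k)
    = sumF (fun n x y => E x y * T n x y) (a + h) (b + k).
  move=> hr kr; have [E1 [E2 u]] := gT _ _ (op h k hr kr).
  by rewrite /sumF sumCZ//; exact: good_cvg u.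
have sM (D : N -> C) e : abs_cvg D -> abs_cvg (fun n => E a b * D n + T n a b * e) /\
    sumC (fun n => E a b * D n + T n a b * e) = E a b * sumC D + sumF T a b * e.
  move=> sD; have sT := good_cvg g; have sTe := abs_cvgZ e sT.
  have -> : (fun n => E a b * D n + T n a b * e) = fun n => E a b * D n + e * T n a b.
    by apply/funext => n; rewrite (mulrC e).
  split; first by apply: abs_cvgD => //; exact: abs_cvgZ.
  by rewrite sumCD ?sumCZ// ?(mulrC e)//; exact: abs_cvgZ.
exists (fun n => E a b * D1 n + T n a b * e1), (fun n => E a b * D2 n + T n a b * e2).
split.
- exact: abs_cvgZ (good_cvg g).
- exact: (analytic2_eq rho0 sE (analytic2M (aE a b ab) (good_an g))).
- by move=> n; exact: der1M dE1 (good_der1 g n).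
- exact: (sM _ _ (good_cvg1 g)).1.
- rewrite (sM _ _ (good_cvg1 g)).2.
  apply: (near_derive rho0 _ (der1M dE1 (good_sum1 g))) => h hr.
  by have := sE h 0 hr; rewrite nm0 addr0; exact.
- by move=> n; exact: der2M dE2 (good_der2 g n).
- exact: (sM _ _ (good_cvg2 g)).1.
- rewrite (sM _ _ (good_cvg2 g)).2.
  apply: (near_derive rho0 _ (der2M dE2 (good_sum2 g))) => h hr.
  by have := sE 0 h _ hr; rewrite nm0 addr0; exact.
Qed.

Lemma good_eq T T' : (forall n x y, T n x y = T' n x y) -> good T -> good T'.
Proof.
move=> e; congr good; apply/funext => n; apply/funext => x; apply/funext => y.
exact: e.
Qed.

End GoodFamilies.

Section GoodDirichlet.
Context {R : realType}.
Local Notation C := R[i].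

Lemma is_derive_affine (c d x : C) :
  is_derive (x : R[i]^o) 1 ((fun z => c + d * z) : R[i]^o -> R[i]^o) d.
Proof. exact: (analytic1_derive (analytic1_poly1 c d x)). Qed.

Lemma good_dirichlet (a : R -> C) :
  (forall t, complex.Re t < 0 -> abs_cvg (dterm a t)) ->
  good ReGt (fun n x y => dterm a (y - x) n).
Proof.
move=> sa x y xy; have t0 : complex.Re (y - x) < 0.
  by rewrite raddfB/=; move: xy; rewrite /ReGt; lra.
have [s1 [q aq q1]] := dirichlet sa t0.
have dq := analytic1_derive aq; rewrite q1 in dq.
have dn n : is_derive ((y - x) : R[i]^o) 1 ((fun t => dterm a t n) : R[i]^o -> R[i]^o)
    (dterm (fun n => n%:C * a n) (y - x) n).
  have := @is_derive_chain R[i] (@cexp R) (fun z => 0 + n%:C * z) _ _ _ (cexp_derive (0 + n%:C * (y - x))) (is_derive_affine 0 n%:C (y - x)).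
  move=> /(is_deriveM (is_derive_cst (a n : R[i]^o) _ _)).
  congr is_derive.
    by apply/funext => t; rewrite /dterm -[LHS]/(a n * cexp (0 + n%:C * t)) add0r.
  rewrite scaler0 addr0 add0r.
  transitivity (a n * (cexp (n%:C * (y - x)) * n%:C)) => //.
  by rewrite /dterm; ring.
have chain1 (f : C -> C) d : is_derive ((y - x) : R[i]^o) 1 (f : R[i]^o -> R[i]^o) d ->
    der1 (fun x y => f (y - x)) x y (- d).
  have e : y - x = y + (-1) * x by ring.
  rewrite /der1 e => fd; have := @is_derive_chain R[i] f (fun z => y + (-1) * z) _ _ _ fd (is_derive_affine y (-1) x).
  rewrite mulrN1; congr is_derive.
  by apply/funext => z /=; congr f; ring.
have chain2 (f : C -> C) d : is_derive ((y - x) : R[i]^o) 1 (f : R[i]^o -> R[i]^o) d ->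
    der2 (fun x y => f (y - x)) x y d.
  have e : y - x = - x + 1 * y by ring.
  rewrite /der2 e => fd; have := @is_derive_chain R[i] f (fun z => - x + 1 * z) _ _ _ fd (is_derive_affine (- x) 1 y).
  rewrite mulr1; congr is_derive.
  by apply/funext => z /=; congr f; ring.
have sN : (fun n => - dterm (fun n0 => n0%:C * a n0) (y - x) n)
   = fun n => (-1) * dterm (fun n0 => n0%:C * a n0) (y - x) n.
  by apply/funext => n; rewrite mulN1r.
exists (fun n => - dterm (fun n0 => n0%:C * a n0) (y - x) n),
       (dterm (fun n0 => n0%:C * a n0) (y - x)); split.
- exact: sa.
- apply: (analytic2_comp1 (F := fun t => sumC (dterm a t)) (g := fun x y => y - x) aq).
  apply: (@analytic2_eq _ (fun x y => y + (-1) * x) _ _ _ 1) => //.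
    by move=> h k _ _; ring.
  apply: analytic2D; first exact: analytic2_snd.
  by apply: analytic2M; [exact: analytic2_cst|exact: analytic2_fst].
- by move=> n; exact: (chain1 (fun t => dterm a t n)).
- by rewrite sN; exact: abs_cvgZ.
- rewrite sN sumCZ// mulN1r.
  exact: (chain1 (fun t => sumC (dterm a t))).
- by move=> n; exact: (chain2 (fun t => dterm a t n)).
- exact: s1.
- exact: (chain2 (fun t => sumC (dterm a t))).
Qed.

Lemma good_swap (N : choiceType) (T : N -> C -> C -> C) :
  good ReGt T -> good ReLt (fun n x y => T n y x).
Proof.
move=> gT x y /gT[D1 [D2 [c a d1 c1 s1 d2 c2 s2]]]; exists D2, D1.
by split => //; exact: (analytic2_swap (f := sumF T) a).
Qed.

End GoodDirichlet.

(** * Separation of the powers of the logarithms *)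

Section Interpolation.
Context {R : realType}.
Local Notation C := R[i].

(** The inverse of the Vandermonde matrix of K distinct nodes, which does not depend on n, writes
    every coefficient as a fixed combination of K of the given convergent families. *)
Lemma vandermonde_abs_cvg (N : choiceType) K (b : nat -> N -> C) (x : nat -> C) :
  injective x ->
  (forall p, abs_cvg (fun n => \sum_(i < K) b i n * x p ^+ i)) ->
  forall i : 'I_K, abs_cvg (b i).
Proof.
move=> xi sb i0; pose v : 'rV[C]_K := \row_j x j.
pose V : 'M[C]_K := Vandermonde K v.
have Vu : V \in unitmx.
  rewrite unitmxE det_Vandermonde unitfE; apply/prodf_neq0 => i _.
  apply/prodf_neq0 => j ij; rewrite !mxE subr_eq0.
  by apply/eqP => /xi/ord_inj ji; move: ij; rewrite ji ltnn.
have bE n : b i0 n = \sum_(p <- index_enum 'I_K)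
    invmx V p i0 * \sum_(i < K) b i n * x p ^+ i.
  have := mulmxK Vu (\row_i b i n) => /rowP/(_ i0); rewrite !mxE => <-.
  apply: eq_bigr => p _; rewrite mulrC mxE; congr (_ * _).
  by apply: eq_bigr => i _; rewrite !mxE.
have -> : b i0 = fun n => \sum_(p <- index_enum 'I_K)
    invmx V p i0 * \sum_(i < K) b i n * x p ^+ i by apply/funext.
by apply: abs_cvg_sum => p; exact: abs_cvgZ.
Qed.

(* The imaginary parts of s1 and s2 are free, and do not affect the modulus of
   e^(n (s2 - s1)), so finitely many shifts of them separate the powers of s1
   and s2 by Vandermonde interpolation. *)
Lemma dirichlet_coef (K : nat) (a : nat -> nat -> R -> C) :
  (forall s1 s2, ReGt s1 s2 -> abs_cvg (fun n =>
     (\sum_(i < K) \sum_(j < K) a i j n * s1 ^+ i * s2 ^+ j)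
       * cexp (n%:C * (s2 - s1)))) ->
  forall (i j : 'I_K) t, complex.Re t < 0 -> abs_cvg (dterm (a i j) t).
Proof.
move=> sa i j t t0.
pose x p : C := p%:R *i; pose y q : C := t + q%:R *i.
have xi : injective x by move=> p q [/eqP]; rewrite eqr_nat => /eqP.
have yi : injective y by move=> p q /addrI/xi.
have h p q : abs_cvg (fun n => \sum_(i < K)
    ((\sum_(j < K) a i j n * y q ^+ j) * cexp (n%:C * t)) * x p ^+ i).
  have xy : ReGt (x p) (y q) by rewrite /ReGt /y raddfD/= addr0.
  apply: abs_cvg_dom (sa _ _ xy) => n.
  rewrite [leRHS]nmM nm_cexp Re_realM raddfB raddfD/= addr0 subr0.
  rewrite -Re_realM -nm_cexp -nmM mulr_suml le_eqVlt; apply/orP; left; apply/eqP.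
  congr nm; apply: eq_bigr => i' _; rewrite mulrAC; congr (_ * _).
  by rewrite mulr_suml; apply: eq_bigr => j' _; ring.
have hq q := vandermonde_abs_cvg
  (b := fun i n => (\sum_(j < K) a i j n * y q ^+ j) * cexp (n%:C * t)) xi (h^~ q) i.
have hq' q : abs_cvg (fun n => \sum_(j < K) (a i j n * cexp (n%:C * t)) * y q ^+ j).
  have := hq q; congr abs_cvg; apply/funext => n.
  by rewrite mulr_suml; apply: eq_bigr => j' _; rewrite mulrAC.
exact: (vandermonde_abs_cvg (b := fun j n => a i j n * cexp (n%:C * t)) yi hq' j).
Qed.

(** The exponential prefactor has no zeros and is divided out before the coefficients are separated.
    Afterwards it goes, with the monomial in s1 and s2, into an analytic factor common to all n,
    which leaves K^2 Dirichlet series. *)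
Lemma good_polylog (K : nat) (a : nat -> nat -> R -> C) (c d : C) :
  (forall s1 s2, ReGt s1 s2 -> abs_cvg (fun n =>
     (\sum_(i < K) \sum_(j < K) a i j n * s1 ^+ i * s2 ^+ j)
       * (cexp (c * s1 + d * s2) * cexp (n%:C * (s2 - s1))))) ->
  good ReGt (fun n s1 s2 =>
     (\sum_(i < K) \sum_(j < K) a i j n * s1 ^+ i * s2 ^+ j)
       * (cexp (c * s1 + d * s2) * cexp (n%:C * (s2 - s1)))).
Proof.
move=> sa.
have sa' s1 s2 : ReGt s1 s2 -> abs_cvg (fun n =>
     (\sum_(i < K) \sum_(j < K) a i j n * s1 ^+ i * s2 ^+ j)
       * cexp (n%:C * (s2 - s1))).
  move=> /sa/(abs_cvgZ (cexp (c * s1 + d * s2))^-1); congr abs_cvg.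
  have e (x y u : C) : u != 0 -> u^-1 * (x * (u * y)) = x * y by move=> u0; field.
  by apply/funext => n; rewrite e// cexp_neq0.
have sd := dirichlet_coef sa'.
pose E i j (x y : C) := cexp (c * x + d * y) * (x ^+ i * y ^+ j).
have aE i j x y : analytic2_at (E i j) x y.
  have aX := analytic2_fst x y; have aY := analytic2_snd x y.
  apply: analytic2M; last by apply: analytic2M; apply: analytic2X.
  apply: analytic2_comp1 (cexp_analytic _) _.
  by apply: analytic2D; apply: analytic2M => //; exact: analytic2_cst.
apply: (@good_eq _ _ _ (fun n x y => \sum_(i <- index_enum 'I_K) \sum_(j <- index_enum 'I_K)
   E i j x y * dterm (a i j) (y - x) n)).
  move=> n x y; rewrite mulr_suml; apply: eq_bigr => i _.
  by rewrite mulr_suml; apply: eq_bigr => j _; rewrite /E /dterm; ring.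
apply: (good_sum ReGt_open) => i; apply: (good_sum ReGt_open) => j.
by apply: (goodM ReGt_open) => [x y _|]; [exact: aE|apply: good_dirichlet; exact: sd].
Qed.

End Interpolation.

(** * Pullback along the branches of the logarithm *)

Section Pullback.
Context {R : realType}.
Local Notation C := R[i].
Context (D : set (C * C)) (Om : C -> C -> Prop).
Hypothesis D_open : open2 (fun z1 z2 => D (z1, z2)).
Hypothesis D0 : forall z, D z -> z.1 != 0 /\ z.2 != 0.
Hypothesis DOm : forall z1 z2, z1 != 0 -> z2 != 0 ->
  D (z1, z2) <-> Om (clog z1) (clog z2).
Hypothesis OmRe : forall a b a' b', complex.Re a = complex.Re a' ->
  complex.Re b = complex.Re b' -> Om a b -> Om a' b'.
Context {X : Type} (F : X -> C -> C -> C) (d1 : X -> X) (d2 : X -> seq X).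
Hypothesis F_an : forall x a b, Om a b -> analytic2_at (F x) a b.
Hypothesis F1 : forall x a b, Om a b -> der1 (F x) a b (cexp a * F (d1 x) a b).
Hypothesis F2 : forall x a b, Om a b ->
  der2 (F x) a b (cexp b * \sum_(y <- d2 x) F y a b).

Definition pull p q (x : X) (z1 z2 : C) := F x (lbranch p z1) (lbranch q z2).

Lemma cut_regionP z1 z2 : cut_region D (z1, z2) ->
  [/\ z1 != 0, z2 != 0, 0 < carg z1 < 2 * pi, 0 < carg z2 < 2 * pi &
      forall p q, Om (lbranch p z1) (lbranch q z2)].
Proof.
move=> [Dz [a1 a2]]; have [z10 z20] := D0 Dz; split => // p q.
by move: Dz => /(DOm z10 z20); apply: OmRe; rewrite Re_lbranch.
Qed.

Lemma cut_region_open z1 z2 : cut_region D (z1, z2) ->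
  exists2 rho : R, 0 < rho & forall h k, nm h < rho -> nm k < rho ->
    cut_region D (z1 + h, z2 + k).
Proof.
move=> Dc; have Dz := Dc.1; have [z10 z20 a1 a2 om] := cut_regionP Dc.
have [r1 r10 n1] := clog_near z10 a1; have [r2 r20 n2] := clog_near z20 a2.
have [r3 r30 op] := D_open Dz.
exists (Num.min r3 (Num.min r1 r2)); first by rewrite !lt_min r10 r20 r30.
move=> h k; rewrite !lt_min => /and3P[h3 h1 _] /and3P[k3 _ k2].
have [_ _ y10 b1] := n1 _ h1; have [_ _ y20 b2] := n2 _ k2.
by split; first exact: op.
Qed.

Lemma pull_analytic p q x : analytic2_on (cut_region D) (pull p q x).
Proof.
move=> z1 z2 /cut_regionP[z10 z20 a1 a2 om].
have [q1 l1 _] := lbranch_analytic p z10 a1.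
have [q2 l2 _] := lbranch_analytic q z20 a2.
apply: (analytic2_comp (g := fun x _ => lbranch p x) (h := fun _ y => lbranch q y)).
- exact: F_an.
- exact: analytic1_fst l1.
- exact: analytic1_snd l2.
Qed.

(** F is differentiated with respect to s, whereas L(-1) corresponds to z: the factor e^a in [F1],
    which is z_1 at the branch, cancels against the derivative 1 / z_1 of the logarithm. *)
Lemma pull_der1 p q x z1 z2 : cut_region D (z1, z2) ->
  der1 (pull p q x) z1 z2 (pull p q (d1 x) z1 z2).
Proof.
move=> /cut_regionP[z10 z20 a1 a2 om].
have [q1 l1 q1E] := lbranch_analytic p z10 a1.
have := analytic1_derive l1; rewrite q1E => dl.
have := @is_derive_chain R[i] (fun z => F x z (lbranch q z2)) (lbranch p) z1 _ _
  (F1 x (om p q)) dl.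
by rewrite cexp_lbranch// mulrAC mulfV// mul1r.
Qed.

Lemma pull_der2 p q x z1 z2 : cut_region D (z1, z2) ->
  der2 (pull p q x) z1 z2 (\sum_(y <- d2 x) pull p q y z1 z2).
Proof.
move=> /cut_regionP[z10 z20 a1 a2 om].
have [q2 l2 q2E] := lbranch_analytic q z20 a2.
have := analytic1_derive l2; rewrite q2E => dl.
have := @is_derive_chain R[i] (fun z => F x (lbranch p z1) z) (lbranch q) z2 _ _
  (F2 x (om p q)) dl.
by rewrite cexp_lbranch// mulrAC mulfV// mul1r.
Qed.

(** The equality is required on the cut region only, which is open, so [g] may itself be an iterated
    derivative known nowhere else. *)
Lemma pull_pderiv1 p q (g : C -> C -> C) (s : seq X) :
  (forall z1 z2, cut_region D (z1, z2) -> g z1 z2 = \sum_(y <- s) pull p q y z1 z2) ->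
  forall z1 z2, cut_region D (z1, z2) ->
    pderiv1 g z1 z2 = \sum_(y <- [seq d1 y | y <- s]) pull p q y z1 z2.
Proof.
move=> gE z1 z2 Dz; have [rho rho0 op] := cut_region_open Dz.
have dS : der1 (fun z1 z2 => \sum_(y <- s) pull p q y z1 z2) z1 z2
    (\sum_(y <- [seq d1 y | y <- s]) pull p q y z1 z2).
  elim: {gE} s => [|y s IH].
    rewrite big_nil; have -> : (fun z1 z2 => \sum_(y <- [::]) pull p q y z1 z2) = fun _ _ => 0.
      by apply/funext => a; apply/funext => b; rewrite big_nil.
    exact: is_derive_cst.
  rewrite /= big_cons.
  have -> : (fun z1 z2 => \sum_(y <- y :: s) pull p q y z1 z2) =
     fun z1 z2 => pull p q y z1 z2 + \sum_(y <- s) pull p q y z1 z2.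
    by apply/funext => a; apply/funext => b; rewrite big_cons.
  by apply: der1D => //; exact: pull_der1.
have := near_derive (g := g^~ z2) rho0 _ dS; case => [h hr|_ //].
by rewrite gE//; have := op h 0 hr; rewrite nm0 addr0; exact.
Qed.

Lemma pull_pderiv2 p q (g : C -> C -> C) (s : seq X) :
  (forall z1 z2, cut_region D (z1, z2) -> g z1 z2 = \sum_(y <- s) pull p q y z1 z2) ->
  forall z1 z2, cut_region D (z1, z2) ->
    pderiv2 g z1 z2 = \sum_(y <- flatten [seq d2 y | y <- s]) pull p q y z1 z2.
Proof.
move=> gE z1 z2 Dz; have [rho rho0 op] := cut_region_open Dz.
have dS : der2 (fun z1 z2 => \sum_(y <- s) pull p q y z1 z2) z1 z2
    (\sum_(y <- flatten [seq d2 y | y <- s]) pull p q y z1 z2).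
  elim: {gE} s => [|y s IH].
    rewrite big_nil; have -> : (fun z1 z2 => \sum_(y <- [::]) pull p q y z1 z2) = fun _ _ => 0.
      by apply/funext => a; apply/funext => b; rewrite big_nil.
    exact: is_derive_cst.
  rewrite /= big_cat.
  have -> : (fun z1 z2 => \sum_(y <- y :: s) pull p q y z1 z2) =
     fun z1 z2 => pull p q y z1 z2 + \sum_(y <- s) pull p q y z1 z2.
    by apply/funext => a; apply/funext => b; rewrite big_cons.
  by apply: der2D => //; exact: pull_der2.
have := near_derive (g := g z1) rho0 _ dS; case => [h hr|_ //].
by rewrite gE//; have := op 0 h _ hr; rewrite nm0 addr0; exact.
Qed.

(** A list with repetitions: in an iterate the z_2-derivative acts on two vectors, so [d2] branches,
    and the multiplicities become binomial coefficients. The derivatives in the second variable come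
    first, as in [pderiv]. *)
Definition pderiv_index k l (x : X) : seq X :=
  map (iter k d1) (iter l (fun s => flatten [seq d2 y | y <- s]) [:: x]).

Lemma pull_pderiv p q k l x z1 z2 : cut_region D (z1, z2) ->
  pderiv k l (pull p q x) z1 z2
  = \sum_(y <- pderiv_index k l x) pull p q y z1 z2.
Proof.
elim: k z1 z2 => [|k IH] z1 z2.
  rewrite /pderiv /pderiv_index /= map_id.
  elim: l z1 z2 => [|l IH] z1 z2 Dz; first by rewrite /= big_seq1.
  exact: pull_pderiv2.
move=> Dz; rewrite /pderiv iterS (pull_pderiv1 IH)//.
by rewrite /pderiv_index -map_comp.
Qed.

(** [clog] inverts [cexp] only up to the imaginary part, and [Om] depends on the real parts
    alone. *)
Lemma Om_cexp s1 s2 : D (cexp s1, cexp s2) -> Om s1 s2.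
Proof.
move=> /(DOm (cexp_neq0 s1) (cexp_neq0 s2)); apply: OmRe;
  by rewrite -[LHS]/(ln (nm (cexp _))) nm_cexp expRK.
Qed.

(** One function on the covering, a finite sum of the [F y], serves all p and q. *)
Lemma pull_multivalued (s : seq X) (f : int -> int -> C -> C -> C) :
  (forall p q z1 z2, cut_region D (z1, z2) ->
     f p q z1 z2 = \sum_(y <- s) pull p q y z1 z2) ->
  multivalued_branches D f.
Proof.
move=> fE; exists (fun s1 s2 => \sum_(y <- s) F y s1 s2); split.
  move=> s1 s2 /Om_cexp om.
  by apply: analytic2_sum => y; exact: F_an.
by move=> p q z1 z2 /fE ->.
Qed.

End Pullback.

(** * Modules and intertwining maps *)

(* Reflection for the tactic lmod, which decides linear identities in a module by
   comparing the coefficients of the atoms. *)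
Inductive lexp (K : Type) : Type :=
  | LVar of nat | LAdd of lexp K & lexp K | LOpp of lexp K
  | LScale of K & lexp K | LZero.

Section ReflectLinear.
Context {K : comPzRingType} {W : lmodType K}.

Fixpoint ldenote (env : seq W) (e : lexp K) : W :=
  match e with
  | LVar n => nth 0 env n
  | LAdd a b => ldenote env a + ldenote env b
  | LOpp a => - ldenote env a
  | LScale c a => c *: ldenote env a
  | LZero => 0
  end.

Fixpoint lcoefs (e : lexp K) (i : nat) : K :=
  match e with
  | LVar n => if eqn n i then 1 else 0
  | LAdd a b => lcoefs a i + lcoefs b i
  | LOpp a => - lcoefs a i
  | LScale c a => c * lcoefs a i
  | LZero => 0
  end.

Fixpoint lvars_lt (m : nat) (e : lexp K) : bool :=
  match e with
  | LVar n => (n < m)%N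
  | LAdd a b => lvars_lt m a && lvars_lt m b
  | LOpp a => lvars_lt m a
  | LScale c a => lvars_lt m a
  | LZero => true
  end.

Lemma ldenoteE env e : lvars_lt (size env) e ->
  ldenote env e = \sum_(i < size env) lcoefs e i *: env`_i.
Proof.
elim: e => [n|a IHa b IHb|a IHa|c a IHa|] /=.
- move=> nlt; rewrite (bigD1 (Ordinal nlt))//= -[eqn n n]/(n == n) eqxx scale1r big1 ?addr0// => i.
  by rewrite -val_eqE /= eq_sym -[eqn n i]/(n == i) => /negbTE ->; rewrite scale0r.
- move=> /andP[/IHa -> /IHb ->]; rewrite -big_split; apply: eq_bigr => i _.
  by rewrite scalerDl.
- by move=> /IHa ->; rewrite -sumrN; apply: eq_bigr => i _; rewrite scaleNr.
- by move=> /IHa ->; rewrite scaler_sumr; apply: eq_bigr => i _; rewrite scalerA.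
- by move=> _; rewrite big1// => i _; rewrite scale0r.
Qed.

Fixpoint leq_coefs (m : nat) (e1 e2 : lexp K) : Prop :=
  if m is m'.+1 then lcoefs e1 m' = lcoefs e2 m' /\ leq_coefs m' e1 e2 else True.

Lemma ldenote_eq env e1 e2 :
  lvars_lt (size env) e1 && lvars_lt (size env) e2 ->
  leq_coefs (size env) e1 e2 -> ldenote env e1 = ldenote env e2.
Proof.
move=> /andP[l1 l2] h; rewrite !ldenoteE//; apply: eq_bigr => i _; congr (_ *: _).
elim: (size env) h i => [|m IH] /=; first by move=> _ [].
move=> [e12 h] i; have [im|] := ltnP i m; first exact: (IH h (Ordinal im)).
by move=> mi; have -> : (i : nat) = m by apply/eqP; rewrite eqn_leq mi -ltnS ltn_ord.
Qed.

End ReflectLinear.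

Ltac latoms l t :=
  match t with
  | ?a + ?b => let l1 := latoms l a in latoms l1 b
  | - ?a => latoms l a
  | ?c *: ?a => latoms l a
  | 0 => l
  | _ => let rec mem l' := match l' with
           | cons t _ => l | cons _ ?l'' => mem l'' | _ => constr:(cons t l) end in mem l
  end.

Ltac lindex l t :=
  match l with
  | cons t _ => constr:(0%N)
  | cons _ ?l' => let n := lindex l' t in constr:(S n)
  end.

Ltac lreify K l t :=
  match t with
  | ?a + ?b => let x := lreify K l a in let y := lreify K l b in constr:(@LAdd K x y)
  | - ?a => let x := lreify K l a in constr:(@LOpp K x)
  | ?c *: ?a => let x := lreify K l a in constr:(@LScale K c x)
  | 0 => constr:(@LZero K)
  | _ => let n := lindex l t in constr:(@LVar K n)
  end.

Tactic Notation "lmod" constr(K) constr(W) :=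
  match goal with |- ?a = ?b =>
    let l0 := constr:(@nil W) in
    let l1 := latoms l0 a in let l := latoms l1 b in
    let x := lreify K l a in let y := lreify K l b in
    apply: (@ldenote_eq _ _ l x y); [by []|cbv beta iota zeta delta [leq_coefs lcoefs size eqn]; repeat split; ring]
  end.

(** * Sums with finite support *)

Section FiniteSums.
Context {I : choiceType} {M : zmodType}.

Definition fsup (F : I -> M) : Prop :=
  exists s : seq I, forall i, i \notin s -> F i = 0.

Lemma fsum_seq (s : seq I) (F : I -> M) : uniq s ->
  (forall i, i \notin s -> F i = 0) -> \sum_(i \in [set: I]) F i = \sum_(i <- s) F i.
Proof.
move=> us F0; rewrite (@fsbigE _ _ _ _ _ s)//.
  by apply: eq_bigl => i; rewrite in_setT.
by move=> i _; exact: F0.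
Qed.

Lemma fsum1 (i0 : I) (F : I -> M) : (forall i, i != i0 -> F i = 0) ->
  \sum_(i \in [set: I]) F i = F i0.
Proof.
move=> F0; rewrite (@fsum_seq [:: i0])// ?big_seq1// => i.
by rewrite inE; exact: F0.
Qed.

Lemma fsup_uniq (F : I -> M) : fsup F ->
  exists2 s : seq I, uniq s & forall i, i \notin s -> F i = 0.
Proof.
move=> [s F0]; exists (undup s) => [|i]; first exact: undup_uniq.
by rewrite mem_undup; exact: F0.
Qed.

Lemma fsup2 (F G : I -> M) : fsup F -> fsup G ->
  exists s : seq I, [/\ uniq s, forall i, i \notin s -> F i = 0
                      & forall i, i \notin s -> G i = 0].
Proof.
move=> [s F0] [t G0]; exists (undup (s ++ t)); split.
- exact: undup_uniq.
- by move=> i; rewrite mem_undup mem_cat negb_or => /andP[/F0].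
- by move=> i; rewrite mem_undup mem_cat negb_or => /andP[_ /G0].
Qed.

Lemma fsupD (F G : I -> M) : fsup F -> fsup G -> fsup (fun i => F i + G i).
Proof.
move=> sF sG; have [s [_ F0 G0]] := fsup2 sF sG; exists s => i si.
by rewrite F0// G0// addr0.
Qed.

Lemma fsumD (F G : I -> M) : fsup F -> fsup G ->
  \sum_(i \in [set: I]) (F i + G i) =
  \sum_(i \in [set: I]) F i + \sum_(i \in [set: I]) G i.
Proof.
move=> sF sG; have [s [us F0 G0]] := fsup2 sF sG.
rewrite !(fsum_seq us)//; first by rewrite big_split.
by move=> i si; rewrite F0// G0// addr0.
Qed.

Lemma fsup0 : fsup (fun=> 0). Proof. by exists [::]. Qed.

Lemma fsum0 : \sum_(i \in [set: I]) (0 : M) = 0.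
Proof. by rewrite fsbig1. Qed.

End FiniteSums.

Lemma fsum_nat (M : zmodType) (n : nat) (F : nat -> M) :
  (forall i, (n <= i)%N -> F i = 0) ->
  \sum_(i \in [set: nat]) F i = \sum_(i < n) F i.
Proof.
move=> F0; rewrite (@fsum_seq _ _ (iota 0 n)) ?iota_uniq//.
  by rewrite -(subn0 n) -/(index_iota 0 n) big_mkord subn0.
by move=> i; rewrite mem_iota/= add0n -leqNgt; exact: F0.
Qed.

Lemma fsum_ext (I : choiceType) (M : zmodType) (F G : I -> M) :
  F =1 G -> \sum_(i \in [set: I]) F i = \sum_(i \in [set: I]) G i.
Proof. by move=> /funext ->. Qed.

Section LinearMaps.
Context {K : pzRingType} {U W : lmodType K} (f : U -> W) (lf : linear f).

Lemma linD u v : f (u + v) = f u + f v.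
Proof. by rewrite -[u]scale1r lf !scale1r. Qed.

Lemma lin0 : f 0 = 0.
Proof. by apply: (addIr (f 0)); rewrite -linD !add0r. Qed.

Lemma linZ a u : f (a *: u) = a *: f u.
Proof. by rewrite -[a *: u]addr0 lf lin0 addr0. Qed.

Lemma linN u : f (- u) = - f u.
Proof. by rewrite -scaleN1r linZ scaleN1r. Qed.

Lemma lin_sum (I : Type) (r : seq I) (P : pred I) (F : I -> U) :
  f (\sum_(i <- r | P i) F i) = \sum_(i <- r | P i) f (F i).
Proof. by elim/big_rec2: _ => [|i y1 y2 _ <-]; rewrite ?lin0 ?linD. Qed.

End LinearMaps.

Lemma fsupZ (K : pzRingType) (W : lmodType K) (I : choiceType) a (F : I -> W) :
  fsup F -> fsup (fun i => a *: F i).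
Proof. by move=> [s F0]; exists s => i /F0 ->; exact: scaler0. Qed.

Lemma fsumZ (K : pzRingType) (W : lmodType K) (I : choiceType) a (F : I -> W) :
  fsup F -> \sum_(i \in [set: I]) a *: F i = a *: \sum_(i \in [set: I]) F i.
Proof.
move=> /fsup_uniq[s us F0]; rewrite !(fsum_seq us)//; last first.
  by move=> i /F0 ->; exact: scaler0.
by rewrite scaler_sumr.
Qed.

Section Gradings.
Context {R : realType} {I : choiceType} {W : lmodType R[i]} (g : grading I W).

Lemma homog0 i : homog g i 0.
Proof. by rewrite /homog/= linear0. Qed.

Lemma homogD i u v : homog g i u -> homog g i v -> homog g i (u + v).
Proof. by rewrite /homog/= linearD => -> ->. Qed.

Lemma homogZ i a u : homog g i u -> homog g i (a *: u).
Proof. by rewrite /homog/= linearZ/= => ->. Qed.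

Lemma homogN i u : homog g i u -> homog g i (- u).
Proof. by rewrite -scaleN1r; exact: homogZ. Qed.

Lemma homog_proj i w : homog g i (g i w).
Proof. by rewrite /homog/= gproj_orth eqxx. Qed.

Lemma homog_sum i (J : Type) (r : seq J) (F : J -> W) :
  (forall j, homog g i (F j)) -> homog g i (\sum_(j <- r) F j).
Proof.
move=> hF; elim: r => [|j r IH]; first by rewrite big_nil; exact: homog0.
by rewrite big_cons; exact: homogD.
Qed.

Lemma proj_homog i w : homog g i w -> g i w = w. Proof. by []. Qed.

Lemma proj_homog0 i j w : homog g i w -> j != i -> g j w = 0.
Proof. by move=> <- /negbTE ji; rewrite gproj_orth ji. Qed.

Lemma proj_fsup w : fsup (fun i => g i w).
Proof.
have := gproj_finite g w => /finite_seqP[X XE]; exists X => i iX.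
apply/eqP; apply: contraT => gi.
by have : [set i | g i w != 0] i by []; rewrite XE/= (negbTE iX).
Qed.

Lemma grading_dec w : exists2 s : seq I, uniq s & w = \sum_(i <- s) g i w.
Proof.
have [s us s0] := fsup_uniq (proj_fsup w); exists s => //.
by rewrite -{1}(gproj_sum g w) (fsum_seq us).
Qed.

Lemma grading_ind (P : W -> Prop) : P 0 ->
  (forall u v, P u -> P v -> P (u + v)) ->
  (forall i w, homog g i w -> P w) -> forall w, P w.
Proof.
move=> P0 PD Ph w; have [s _ ->] := grading_dec w.
elim/big_ind: _ => // i _; apply: Ph; exact: homog_proj.
Qed.

End Gradings.

Section Operators.
Context {R : realType}.
Local Notation C := R[i].

Lemma LopN1 (W : lmodType C) (L : sl2_ops W) w : Lop L (-1) w = Lneg1 L w.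
Proof. by []. Qed.

Lemma Lop0 (W : lmodType C) (L : sl2_ops W) w : Lop L 0 w = Lzero L w.
Proof. by []. Qed.

Lemma Lop1 (W : lmodType C) (L : sl2_ops W) w : Lop L 1 w = Lone L w.
Proof. by []. Qed.

Lemma Lop_linear (W : lmodType C) (L : sl2_ops W) j : linear (Lop L j).
Proof.
move=> a u v; rewrite /Lop; case: ifP => _; first by rewrite linearP.
case: ifP => _; first by rewrite linearP.
by case: ifP => _; rewrite ?linearP// scaler0 addr0.
Qed.

Lemma is_jN1 : is_j (-1). Proof. by constructor 1. Qed.
Lemma is_j0 : is_j 0. Proof. by constructor 2. Qed.
Lemma is_j1 : is_j 1. Proof. by constructor 3. Qed.

Context {K : pzRingType} {W1 W2 W3 : lmodType C} {L1 : sl2_ops W1}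
  {L2 : sl2_ops W2} {L3 : sl2_ops W3} {op : W1 -> K -> W2 -> W3}.

Lemma Lbracket_N1 : Lbracket L1 L2 L3 op -> forall w1 w2 n,
  Lneg1 L3 (op w1 n w2) = op w1 n (Lneg1 L2 w2) + op (Lneg1 L1 w1) n w2.
Proof.
move=> /(_ _ _ _ _ is_jN1) h w1 w2 n; have := h w1 w2 n.
have e : op (Lop L1 (-1) w1) (n + 0) w2 = op (Lneg1 L1 w1) n w2 by rewrite addr0.
rewrite !LopN1 big_ord_recl big_ord0 addr0 /= scale1r e => <-.
by rewrite addrC subrK.
Qed.

Lemma Lbracket_0 : Lbracket L1 L2 L3 op -> forall w1 w2 n,
  Lzero L3 (op w1 n w2) = op w1 n (Lzero L2 w2) + op (Lzero L1 w1) n w2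
    + op (Lneg1 L1 w1) (n + 1) w2.
Proof.
move=> /(_ _ _ _ _ is_j0) h w1 w2 n; have := h w1 w2 n.
rewrite !Lop0 !big_ord_recl big_ord0 addr0 /= addr0 !scale1r.
have -> : op (Lop L1 (0 - (bump 0%N 0%N)%:Z) w1) (n + (bump 0%N 0%N)%:R) w2 = op (Lneg1 L1 w1) (n + 1) w2.
  by [].
rewrite Lop0 addr0 => hh.
by rewrite -addrA -hh addrC subrK.
Qed.

End Operators.

(** * Generalized weights *)

Section Weights.
Context {R : realType} {A At : zmodType} {emb : {additive A -> At}}.
Context {V : vertex_algebra R A}.
Local Notation C := R[i].
Local Notation gmod := (gmodule emb V).

(** L(0) - h, whose nilpotent vectors are those of generalized weight h. As L(0) need not be
    semisimple, the commutation rules of this operator replace computations with eigenvalues. *)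
Definition Nshift (W : gmod) (h : C) (u : W) : W := Lop (gm_L W) 0 u - h *: u.

Lemma Nshift_linear (W : gmod) h : linear (@Nshift W h).
Proof.
move=> a u v; rewrite /Nshift (Lop_linear _ _ a) scalerDr scalerA [h * a]mulrC -scalerA.
by rewrite scalerBr opprD addrACA.
Qed.

Lemma homogP (W : gmod) h w : homog (gm_wt W) h w <-> exists k, iter k (@Nshift W h) w = 0.
Proof. exact: gm_weight. Qed.

Lemma homog_Nshift (W : gmod) h w :
  homog (gm_wt W) h (Nshift h w) -> homog (gm_wt W) h w.
Proof. by move=> /homogP[k kE]; apply/homogP; exists k.+1; rewrite iterSr. Qed.

Lemma weight_shift (W W' : gmod) (f : W -> W') h h' : f 0 = 0 ->
  (forall w, Nshift h' (f w) = f (Nshift h w)) ->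
  forall w, homog (gm_wt W) h w -> homog (gm_wt W') h' (f w).
Proof.
move=> f0 fN w /homogP[k]; elim: k w => [|k IH] w; first by move=> /= ->; rewrite f0; exact: homog0.
by rewrite iterSr => /IH wh; apply: homog_Nshift; rewrite fN.
Qed.

Lemma gmY_linear (W : gmod) v p : linear (gm_Y W v p).
Proof. exact: linearP. Qed.

Lemma weight_Y (W : gmod) d v p h w : homog (va_wt V) d v ->
  homog (gm_wt W) h w ->
  homog (gm_wt W) (h + d%:~R - p%:~R - 1) (gm_Y W v p w).
Proof.
move=> vd; apply: weight_shift => [|{}w]; first exact: linear0.
rewrite /Nshift !Lop0 (Lbracket_0 (gm_Lbracket (g := W))).
rewrite -[Lzero (va_L V) _]/(Lop (va_L V) 0 v) (va_L0 vd).
rewrite -[Lneg1 (va_L V) _]/(Lop (va_L V) (-1) v) gm_Lneg1.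
rewrite (linZ (gm_Y_linear p w)) (linD (gmY_linear v p)) (linN (gmY_linear v p)) (linZ (gmY_linear v p)).
rewrite addrK rmorphD/= rmorph1.
lmod (R[i]) W.
Qed.

Lemma Lop_weight_shift (W : gmod) j h w : is_j j ->
  Nshift (h - j%:~R) (Lop (gm_L W) j w) = Lop (gm_L W) j (Nshift h w).
Proof.
move=> ij; have := gm_sl2 (g := W) w is_j0 ij; rewrite sub0r add0r => e.
rewrite /Nshift (linD (Lop_linear _ _)) (linN (Lop_linear _ _)) (linZ (Lop_linear _ _)).
move/eqP: e; rewrite subr_eq => /eqP ->.
by rewrite rmorphN/=; lmod (R[i]) W.
Qed.

Lemma weight_L (W : gmod) j h w : is_j j -> homog (gm_wt W) h w ->
  homog (gm_wt W) (h - j%:~R) (Lop (gm_L W) j w).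
Proof.
move=> ij; apply: weight_shift => [|u]; first exact: (lin0 (Lop_linear _ _)).
exact: Lop_weight_shift.
Qed.

Section LogIntertwining.
Context {W1 W2 W3 : gmod} {Y : W1 -> C -> nat -> W2 -> W3}.
Hypothesis Yint : log_intertwining Y.

(** In the L(0)-bracket the term with L(-1) is a derivative in x: differentiating the power of x
    corrects the weight, and differentiating the power of log x gives the last term. *)
Lemma li_Nshift h1 h2 w1 n k w2 :
  Nshift (h1 + h2 - n - 1) (Y w1 n k w2) =
  Y (Nshift h1 w1) n k w2 + Y w1 n k (Nshift h2 w2) + k.+1%:R *: Y w1 n k.+1 w2.
Proof.
rewrite /Nshift [in LHS]Lop0 (Lbracket_0 (li_Lbracket Yint k)) -LopN1 (li_Lneg1 Yint) addrK.
rewrite (linD (li_linear1 Yint n k w2)) (linN (li_linear1 Yint n k w2)).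
rewrite (linZ (li_linear1 Yint n k w2)) (linD (li_linear2 Yint w1 n k)).
rewrite (linN (li_linear2 Yint w1 n k)) (linZ (li_linear2 Yint w1 n k)) !Lop0.
lmod (R[i]) W3.
Qed.

(** Three nested inductions: on the nilpotency orders at [w1] and at [w2], and on the distance of
    [k] from the bound beyond which the coefficients vanish. Each term of [li_Nshift] lowers one of
    the three. *)
Lemma weight_li h1 h2 w1 n k w2 : homog (gm_wt W1) h1 w1 ->
  homog (gm_wt W2) h2 w2 -> homog (gm_wt W3) (h1 + h2 - n - 1) (Y w1 n k w2).
Proof.
move=> /homogP[a]; elim: a w1 w2 k => [|a IHa] w1 w2 k.
  by move=> /= -> _; rewrite (lin0 (li_linear1 Yint n k w2)); exact: homog0.
move=> w1a /homogP[b]; elim: b w2 k => [|b IHb] w2 k.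
  by move=> /= ->; rewrite (lin0 (li_linear2 Yint w1 n k)); exact: homog0.
move=> w2b; have [K0 KE] := li_log Yint w1 w2 n.
have [m mE] : exists m, (K0 <= k + m)%N by exists K0; exact: leq_addl.
elim: m k mE => [|m IHm] k mE; first by rewrite addn0 in mE; rewrite KE//; exact: homog0.
apply: homog_Nshift; rewrite (li_Nshift h1 h2).
apply: homogD; first apply: homogD.
- by apply: IHa; [rewrite -iterSr|apply/homogP; exists b.+1].
- by apply: IHb; rewrite -iterSr.
- by apply: homogZ; apply: IHm; rewrite addSnnS.
Qed.

End LogIntertwining.
End Weights.

Section Extensions.
Context {R : realType} {A At : zmodType} {emb : {additive A -> At}}.
Context {V : vertex_algebra R A}.
Local Notation C := R[i].
Local Notation gmod := (gmodule emb V).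

Lemma ext_shift (W : gmod) (T : W -> W) sh (f : C -> W) n : in_completion f ->
  (forall h w, homog (gm_wt W) h w -> homog (gm_wt W) (h + sh) (T w)) ->
  ext T f n = T (f (n - sh)).
Proof.
move=> cf hT; rewrite /ext (fsum1 (i0 := n - sh)).
  by apply: proj_homog; rewrite -{1}(subrK sh n); exact/hT/cf.
move=> k kn; apply: (proj_homog0 (hT _ _ (cf k))).
by apply: contra kn => /eqP ->; rewrite addrK.
Qed.

Lemma ext_L (W : gmod) j (f : C -> W) n : is_j j -> in_completion f ->
  ext (Lop (gm_L W) j) f n = Lop (gm_L W) j (f (n + j%:~R)).
Proof.
move=> ij cf; rewrite (ext_shift (sh := - j%:~R)) ?opprK// => h w.
exact: weight_L.
Qed.

Lemma weight_Y' (W : gmod) d v p h w : homog (va_wt V) d v ->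
  homog (gm_wt W) h w ->
  homog (gm_wt W) (h + (d%:~R - p%:~R - 1)) (gm_Y W v p w).
Proof. by move=> vd wh; rewrite !addrA; exact: weight_Y. Qed.

Lemma ext_Y (W : gmod) d v p (f : C -> W) n : homog (va_wt V) d v ->
  in_completion f ->
  ext (gm_Y W v p) f n = gm_Y W v p (f (n - d%:~R + p%:~R + 1)).
Proof.
move=> vd cf; rewrite (ext_shift (sh := d%:~R - p%:~R - 1))//.
  by congr (gm_Y W v p (f _)); ring.
by move=> h w; exact: weight_Y'.
Qed.

Lemma ext_Y_fsup (W : gmod) v p (f : C -> W) n : in_completion f ->
  fsup (fun k => gm_wt W n (gm_Y W v p (f k))).
Proof.
move=> cf; move: v; apply: (grading_ind (g := va_wt V)).
- by exists [::] => k _; rewrite (lin0 (gm_Y_linear _ _)) linear0.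
- move=> u v su sv; have := fsupD su sv; congr fsup; apply/funext => k.
  by rewrite (linD (gm_Y_linear _ _)) linearD.
- move=> d v vd; exists [:: n - (d%:~R - p%:~R - 1)] => k; rewrite inE => kn.
  apply: (proj_homog0 (weight_Y' p vd (cf k))).
  by apply: contra kn => /eqP ->; rewrite addrK.
Qed.

Lemma ext_YDv (W : gmod) u v p (f : C -> W) n : in_completion f ->
  ext (gm_Y W (u + v) p) f n = ext (gm_Y W u p) f n + ext (gm_Y W v p) f n.
Proof.
move=> cf; rewrite /ext -fsumD; try exact: ext_Y_fsup.
by apply: fsum_ext => k; rewrite (linD (gm_Y_linear _ _)) linearD.
Qed.

Lemma ext_Y0v (W : gmod) p (f : C -> W) n : ext (gm_Y W 0 p) f n = 0.
Proof.
by rewrite /ext fsbig1// => k _; rewrite (lin0 (gm_Y_linear _ _)) linear0.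
Qed.

Lemma ext_YDf (W : gmod) v p (f g : C -> W) n : in_completion f -> in_completion g ->
  ext (gm_Y W v p) (fun k => f k + g k) n = ext (gm_Y W v p) f n + ext (gm_Y W v p) g n.
Proof.
move=> cf cg; rewrite /ext -fsumD; try exact: ext_Y_fsup.
by apply: fsum_ext => k; rewrite !linearD.
Qed.

Lemma ext_Y0f (W : gmod) v p n : ext (gm_Y W v p) (fun=> 0) n = 0.
Proof. by rewrite /ext fsbig1// => k _; rewrite !linear0. Qed.

End Extensions.

(** * A uniform bound on the powers of log x *)

Section LogBound.
Context {R : realType} {A At : zmodType} {emb : {additive A -> At}}.
Context {V : vertex_algebra R A}.
Local Notation C := R[i].
Local Notation gmod := (gmodule emb V).

Definition nil_bound (W : gmod) (K : nat) : Prop :=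
  forall h w, homog (gm_wt W) h w -> iter K (Nshift h) w = 0.

Lemma homog_iter_Nshift (W : gmod) h k (w : W) :
  homog (gm_wt W) h w -> homog (gm_wt W) h (iter k (Nshift h) w).
Proof.
move=> wh; elim: k => //= k IH; rewrite /Nshift.
apply: homogD; last by apply: homogN; exact: homogZ.
by have := weight_L is_j0 IH; rewrite subr0.
Qed.

(** On W_[h] the semisimple part of L(0) is the scalar h, and the iterates stay in W_[h]. *)
Lemma nil_bound_st (W : gmod) :
  (exists K : nat, (0 < K)%N /\ forall w : W,
    iter K (fun u => Lop (gm_L W) 0 u
                     - \sum_(n \in [set: C]) n *: gm_wt W n u) w = 0) ->
  exists K, nil_bound W K.
Proof.
move=> [K [_ KE]]; exists K => h w wh; rewrite -[RHS](KE w).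
elim: K {KE} => //= K <-; set u := iter K _ w.
have uh : homog (gm_wt W) h u by exact: homog_iter_Nshift.
rewrite /Nshift (fsum1 (i0 := h)) => [|n nh].
  by rewrite (proj_homog uh).
by rewrite (proj_homog0 uh nh) scaler0.
Qed.

Lemma nil_boundW (W : gmod) K k h w : nil_bound W K -> (K <= k)%N ->
  homog (gm_wt W) h w -> iter k (Nshift h) w = 0.
Proof.
move=> WK Kk wh; rewrite -(subnKC Kk) iterD; apply: WK.
exact: homog_iter_Nshift.
Qed.

Lemma iter_linear (W : gmod) h k : linear (iter k (@Nshift _ _ _ _ _ W h)).
Proof.
move=> a u v; elim: k => //= k ->; exact: Nshift_linear.
Qed.

Context {W1 W2 W3 : gmod} {Y : W1 -> C -> nat -> W2 -> W3}.
Hypothesis Yint : log_intertwining Y.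
Context {K1 K2 K3 : nat} (nil1 : nil_bound W1 K1) (nil2 : nil_bound W2 K2)
  (nil3 : nil_bound W3 K3).

(* L(0) - L(0)_s acts on W1, W2 and W3 nilpotently, and raises the power of
   log x by one, up to these three actions. *)
Lemma log_nilpotent h1 h2 w1 w2 n k a b c : homog (gm_wt W1) h1 w1 ->
  homog (gm_wt W2) h2 w2 -> (K1 + K2 + K3 <= a + b + c + k)%N ->
  iter a (Nshift (h1 + h2 - n - 1))
    (Y (iter b (Nshift h1) w1) n k (iter c (Nshift h2) w2)) = 0.
Proof.
move=> w1h w2h; elim: k a b c => [|k IH] a b c Kabc.
  have [Ka|aK] := leqP K3 a.
    exact: (nil_boundW nil3 Ka (weight_li Yint _ _
      (homog_iter_Nshift b w1h) (homog_iter_Nshift c w2h))).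
  have [Kb|bK] := leqP K1 b.
    rewrite (nil_boundW nil1 Kb w1h) (lin0 (li_linear1 Yint _ _ _)).
    exact: (lin0 (iter_linear _ _)).
  have Kc : (K2 <= c)%N by rewrite leqNgt; apply/negP => cK; lia.
  rewrite (nil_boundW nil2 Kc w2h) (lin0 (li_linear2 Yint _ _ _)).
  exact: (lin0 (iter_linear _ _)).
have IH1 := IH a.+1 b c; have IH2 := IH a b.+1 c; have IH3 := IH a b c.+1.
rewrite iterSr (li_Nshift Yint h1 h2) in IH1.
rewrite !(linD (iter_linear _ _)) (linZ (iter_linear _ _)) in IH1.
move: IH1; rewrite -!iterS IH2; last by lia.
rewrite IH3; last by lia.
rewrite !add0r => IH1; apply/eqP.
have /IH1/eqP : (K1 + K2 + K3 <= a.+1 + b + c + k)%N by lia.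
by rewrite scaler_eq0 pnatr_eq0.
Qed.

Lemma log_bound w1 w2 n k : (K1 + K2 + K3 <= k)%N -> Y w1 n k w2 = 0.
Proof.
move=> Kk; move: w1; apply: (grading_ind (g := gm_wt W1)).
- exact: (lin0 (li_linear1 Yint _ _ _)).
- by move=> u v u0 v0; rewrite (linD (li_linear1 Yint _ _ _)) u0 v0 addr0.
move=> h1 w1 w1h; move: w2; apply: (grading_ind (g := gm_wt W2)).
- exact: (lin0 (li_linear2 Yint _ _ _)).
- by move=> u v u0 v0; rewrite (linD (li_linear2 Yint _ _ _)) u0 v0 addr0.
by move=> h2 w2 w2h; apply: (@log_nilpotent h1 h2 w1 w2 n k 0 0 0).
Qed.

End LogBound.

(** * From logarithmic intertwining operators to intertwining maps *)

Section LogToMap.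
Context {R : realType} {A At : zmodType} {emb : {additive A -> At}}.
Context {V : vertex_algebra R A}.
Local Notation C := R[i].
Local Notation gmod := (gmodule emb V).
Context {W1 W2 W3 : gmod} {Y : W1 -> C -> nat -> W2 -> W3}.
Hypothesis Yint : log_intertwining Y.
Context {K : nat} (Ybound : forall w1 w2 n k, (K <= k)%N -> Y w1 n k w2 = 0).
Context (s : C).
Let z := cexp s.

Definition log_map (w1 : W1) (w2 : W2) (n : C) : W3 :=
  \sum_(t \in [set: C * nat]) mono t s *: gm_wt W3 n (Y w1 t.1 t.2 w2).

(** For homogeneous vectors, weight n forces the single exponent index h1 + h2 - n - 1, and [Ybound]
    leaves at most K powers of log x. *)
Lemma log_map_fsup w1 w2 n :
  fsup (fun t : C * nat => mono t s *: gm_wt W3 n (Y w1 t.1 t.2 w2)).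
Proof.
move: w1; apply: (grading_ind (g := gm_wt W1)).
- by exists [::] => t _; rewrite (lin0 (li_linear1 Yint _ _ _)) linear0 scaler0.
- move=> u v su sv; have := fsupD su sv; congr fsup; apply/funext => t.
  by rewrite (linD (li_linear1 Yint _ _ _)) linearD scalerDr.
move=> h1 w1 w1h; move: w2; apply: (grading_ind (g := gm_wt W2)).
- by exists [::] => t _; rewrite (lin0 (li_linear2 Yint _ _ _)) linear0 scaler0.
- move=> u v su sv; have := fsupD su sv; congr fsup; apply/funext => t.
  by rewrite (linD (li_linear2 Yint _ _ _)) linearD scalerDr.
move=> h2 w2 w2h; exists [seq (h1 + h2 - n - 1, k) | k <- seq.iota 0 K] => -[N k] tn.
have [Kk|kK] := leqP K k; first by rewrite Ybound// linear0 scaler0.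
rewrite (proj_homog0 (weight_li Yint N k w1h w2h)) ?scaler0//=.
apply: contra tn => /eqP nE; apply/mapP; exists k; first by rewrite mem_iota.
by rewrite nE; congr (_, _); ring.
Qed.

Lemma log_map_linear1 w2 n : linear (fun w1 => log_map w1 w2 n).
Proof.
move=> a u v; rewrite /log_map.
have su := log_map_fsup u w2 n; have sv := log_map_fsup v w2 n.
rewrite -fsumZ// -fsumD//; last exact: fsupZ.
apply: fsum_ext => t; rewrite (li_linear1 Yint) linearP scalerDr !scalerA.
by rewrite mulrC.
Qed.

Lemma log_map_linear2 w1 n : linear (fun w2 => log_map w1 w2 n).
Proof.
move=> a u v; rewrite /log_map.
have su := log_map_fsup w1 u n; have sv := log_map_fsup w1 v n.
rewrite -fsumZ// -fsumD//; last exact: fsupZ.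
apply: fsum_ext => t; rewrite (li_linear2 Yint) linearP scalerDr !scalerA.
by rewrite mulrC.
Qed.

Lemma log_map_homog h1 h2 w1 w2 n N : homog (gm_wt W1) h1 w1 ->
  homog (gm_wt W2) h2 w2 -> N = h1 + h2 - n - 1 ->
  log_map w1 w2 n = \sum_(k < K) mono (N, (k : nat)) s *: Y w1 N k w2.
Proof.
move=> w1h w2h NE; rewrite /log_map.
rewrite (@fsum_seq _ _ [seq (N, k) | k <- seq.iota 0 K]); last first.
- move=> [M k] tn; have [Kk|kK] := leqP K k; first by rewrite Ybound// linear0 scaler0.
  rewrite (proj_homog0 (weight_li Yint M k w1h w2h)) ?scaler0//=.
  apply: contra tn => /eqP nE; apply/mapP; exists k; first by rewrite mem_iota.
  by rewrite NE nE; congr (_, _); ring.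
- by rewrite map_inj_uniq ?iota_uniq// => i j [].
rewrite big_map -[seq.iota 0 K](_ : index_iota 0 K = _); last by rewrite /index_iota subn0.
rewrite big_mkord; apply: eq_bigr => k _ /=; congr (_ *: _).
apply: proj_homog; rewrite (_ : n = h1 + h2 - N - 1); last by rewrite NE; ring.
exact: weight_li.
Qed.

Lemma log_map_completion w1 w2 : in_completion (log_map w1 w2).
Proof.
by move=> n; apply: homog_sum => t; apply: homogZ; exact: homog_proj.
Qed.

Lemma cexp_int (i : int) (t : C) : cexp t ^ i = cexp (i%:~R * t).
Proof.
have nat_case (n : nat) : cexp t ^+ n = cexp (n%:R * t).
  elim: n => [|n IH]; first by rewrite expr0 mul0r cexp0.
  by rewrite exprS IH -cexpD -natr1; congr cexp; ring.
case: i => n; first exact: nat_case.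
by rewrite -[LHS]/(cexp t ^- n.+1) NegzE rmorphN/= mulNr cexpN -nat_case.
Qed.

Lemma mono_shift (i : int) (N : C) k :
  z ^ i * mono (N + i%:~R, k) s = mono (N, k) s.
Proof.
rewrite /mono/= mulrA /z cexp_int -cexpD; congr (cexp _ * _); ring.
Qed.

Lemma mono_shift_eq (i : int) (N N' : C) k : N' = N + i%:~R ->
  z ^ i * mono (N', k) s = mono (N, k) s.
Proof. by move=> ->; exact: mono_shift. Qed.

Lemma log_map_trunc w1 w2 n : exists N : nat, forall m : nat, (N <= m)%N ->
  log_map w1 w2 (n - m%:R) = 0.
Proof.
move: w1; apply: (grading_ind (g := gm_wt W1)).
- by exists 0%N => m _; rewrite (lin0 (log_map_linear1 _ _)).
- move=> u v [N1 u0] [N2 v0]; exists (maxn N1 N2) => m; rewrite geq_max => /andP[m1 m2].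
  by rewrite (linD (log_map_linear1 _ _)) u0// v0// addr0.
move=> h1 w1 w1h; move: w2; apply: (grading_ind (g := gm_wt W2)).
- by exists 0%N => m _; rewrite (lin0 (log_map_linear2 _ _)).
- move=> u v [N1 u0] [N2 v0]; exists (maxn N1 N2) => m; rewrite geq_max => /andP[m1 m2].
  by rewrite (linD (log_map_linear2 _ _)) u0// v0// addr0.
move=> h2 w2 w2h; have [N NE] := li_trunc Yint w1 w2 (h1 + h2 - n - 1).
exists N => m Nm; rewrite (log_map_homog (N := h1 + h2 - n - 1 + m%:R) w1h w2h); last by ring.
by rewrite big1// => k _; rewrite NE// scaler0.
Qed.

Lemma log_map_ch b c w1 w2 n : homog (gm_ch W1) b w1 -> homog (gm_ch W2) c w2 ->
  homog (gm_ch W3) (b + c) (log_map w1 w2 n).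
Proof.
move=> w1b w2c; apply: homog_sum => t; apply: homogZ.
by rewrite /homog/= gm_compatible (li_ch Yint t.1 t.2 w1b w2c).
Qed.

(** After reduction to homogeneous vectors both sides are sums over k with the common factor
    [mono (N, k)]: the power z^i absorbs the shift of the exponent by i, and what remains is
    [li_Lbracket] for each k. *)
Lemma log_map_Lbracket j w1 w2 n : is_j j ->
  ext (Lop (gm_L W3) j) (log_map w1 w2) n
  = log_map w1 (Lop (gm_L W2) j w2) n
    + \sum_(i < (absz (j + 1)).+1)
        ('C(absz (j + 1), i)%:R * z ^+ i) *:
          log_map (Lop (gm_L W1) (j - i%:Z) w1) w2 n.
Proof.
move=> ij; rewrite (ext_L _ ij (log_map_completion w1 w2)).
have l1 := log_map_linear1; have l2 := log_map_linear2; have lL := Lop_linear.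
move: w1; apply: (grading_ind (g := gm_wt W1)).
- rewrite !(lin0 (l1 _ _)) !(lin0 (lL _ _ _ _)) add0r big1// => i _.
  by rewrite (lin0 (lL _ _ _ _)) (lin0 (l1 _ _)) scaler0.
- move=> u v uE vE; rewrite !(linD (l1 _ _)) (linD (lL _ _ _ _)) uE vE addrACA.
  congr (_ + _); rewrite -big_split; apply: eq_bigr => i _ /=.
  by rewrite (linD (lL _ _ _ _)) (linD (l1 _ _)) scalerDr.
move=> h1 w1 w1h; move: w2; apply: (grading_ind (g := gm_wt W2)).
- rewrite !(lin0 (l2 _ _)) !(lin0 (lL _ _ _ _)) !(lin0 (l2 _ _)) add0r big1// => i _.
  by rewrite (lin0 (l2 _ _)) scaler0.
- move=> u v uE vE; rewrite !(linD (l2 _ _)) !(linD (lL _ _ _ _)) !(linD (l2 _ _)) uE vE addrACA.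
  congr (_ + _); rewrite -big_split; apply: eq_bigr => i _ /=.
  by rewrite (linD (l2 _ _)) scalerDr.
move=> h2 w2 w2h; set N := h1 + h2 - (n + j%:~R) - 1.
rewrite (log_map_homog (N := N) w1h w2h)//.
rewrite (log_map_homog (N := N) w1h (weight_L ij w2h)); last by rewrite /N; ring.
pose b := absz (j + 1); rewrite -/b.
have e (i : nat) : (i < b.+1)%N ->
    ('C(b, i)%:R * z ^+ i) *: log_map (Lop (gm_L W1) (j - i%:Z) w1) w2 n
    = \sum_(k < K) mono (N, (k : nat)) s *: (('C(b, i)%:R : C) *:
        Y (Lop (gm_L W1) (j - i%:Z) w1) (N + i%:R) k w2).
  move=> ilt; have ij' : is_j (j - i%:Z).
    case: ij ilt => jE; rewrite /b jE; case: i => [|[|[|i]]] //= _;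
      by [constructor 1|constructor 2|constructor 3].
  rewrite (log_map_homog (N := N + i%:R) (weight_L ij' w1h) w2h); last first.
    by rewrite /N rmorphB/=; ring.
  rewrite scaler_sumr; apply: eq_bigr => k _; rewrite !scalerA; congr (_ *: _).
  rewrite -mulrA [_ * mono _ _](@mono_shift_eq i%:Z N)//.
  by rewrite mulrC.
rewrite (eq_bigr _ (fun (i : 'I_b.+1) _ => e i (ltn_ord i))) exchange_big/= -big_split/=.
rewrite (lin_sum (lL _ _ _ _)); apply: eq_bigr => k _.
rewrite (linZ (lL _ _ _ _)) -scaler_sumr -scalerDr; congr (_ *: _).
have := li_Lbracket Yint k w1 w2 N ij => <-.
by rewrite addrC subrK.
Qed.

Section Jacobi.
Context (l m : int) (n : C).

Let cA i : C := xmy l i * z ^+ i.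
Let cB i : C := xmy (i%:Z - m - 1) i * z ^ (m - i%:Z).
Let cC i : C := (-1) ^ l * (xmy l i * z ^ (l - i%:Z)).
Let fA v w1 w2 i := ext (gm_Y W3 v (m + l - i%:Z)) (log_map w1 w2) n.
Let fB v w1 w2 (i : nat) := log_map (gm_Y W1 v (l + i%:Z) w1) w2 n.
Let fC v w1 w2 (i : nat) := log_map w1 (gm_Y W2 v (m + i%:Z) w2) n.

(* The sums over i in the Jacobi identity are finite, with a common bound that
   depends on the three vectors; this form of the identity is additive. *)
Let jac v w1 w2 := exists M : nat, forall M' : nat, (M <= M')%N ->
  [/\ fA v w1 w2 M' = 0, fB v w1 w2 M' = 0, fC v w1 w2 M' = 0 &
   \sum_(i < M') (cA i *: fA v w1 w2 i - cB i *: fB v w1 w2 i - cC i *: fC v w1 w2 i) = 0].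

Let jacD v w1 w2 v' w1' w2' v'' w1'' w2'' :
  (forall i, fA v w1 w2 i = fA v' w1' w2' i + fA v'' w1'' w2'' i) ->
  (forall i, fB v w1 w2 i = fB v' w1' w2' i + fB v'' w1'' w2'' i) ->
  (forall i, fC v w1 w2 i = fC v' w1' w2' i + fC v'' w1'' w2'' i) ->
  jac v' w1' w2' -> jac v'' w1'' w2'' -> jac v w1 w2.
Proof.
move=> eA eB eC [M h] [M' h']; exists (maxn M M') => k; rewrite geq_max => /andP[/h].
move=> [a b c e] /h'[a' b' c' e']; split; rewrite ?eA ?eB ?eC ?a ?b ?c ?a' ?b' ?c' ?addr0//.
transitivity (0 + 0 : W3); last by rewrite addr0.
rewrite -[X in _ = X + _]e -[X in _ = _ + X]e' -big_split; apply: eq_bigr => i _.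
by rewrite eA eB eC /=; lmod (R[i]) W3.
Qed.

Let jac_zero v w1 w2 : (forall i, fA v w1 w2 i = 0) -> (forall i, fB v w1 w2 i = 0) ->
  (forall i, fC v w1 w2 i = 0) -> jac v w1 w2.
Proof.
move=> eA eB eC; exists 0%N => k _; split=> //; rewrite big1// => i _.
by rewrite eA eB eC !scaler0 !subr0.
Qed.

(** For homogeneous vectors the powers of z in the three sums bring all monomials to [mono (N, k)].
    The coefficient of each is the formal Jacobi identity at the power k of log x. *)
Let jac_homog d h1 h2 v w1 w2 : homog (va_wt V) d v -> homog (gm_wt W1) h1 w1 ->
  homog (gm_wt W2) h2 w2 -> jac v w1 w2.
Proof.
(* [N] is fixed by the weights: v_(m+l) applied to the coefficient of index N must have weight n. *)
move=> vd w1h w2h; pose N := h1 + h2 + d%:~R - n - m%:~R - l%:~R - 2.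
have AE i : fA v w1 w2 i = \sum_(k < K) mono (N + i%:R, (k : nat)) s *:
    gm_Y W3 v (m + l - i%:Z) (Y w1 (N + i%:R) k w2).
  rewrite /fA (ext_Y _ _ vd (log_map_completion w1 w2)).
  rewrite (log_map_homog (N := N + i%:R) w1h w2h); last first.
    by rewrite /N rmorphB rmorphD/=; ring.
  rewrite (lin_sum (gmY_linear _ _)); apply: eq_bigr => k _.
  by rewrite (linZ (gmY_linear _ _)).
have BE i : fB v w1 w2 i = \sum_(k < K) mono (N + m%:~R - i%:R, (k : nat)) s *:
    Y (gm_Y W1 v (l + i%:Z) w1) (N + m%:~R - i%:R) k w2.
  rewrite /fB (log_map_homog (N := N + m%:~R - i%:R) (weight_Y (l + i%:Z) vd w1h) w2h)//.
  by rewrite /N rmorphD/=; ring.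
have CE i : fC v w1 w2 i = \sum_(k < K) mono (N + l%:~R - i%:R, (k : nat)) s *:
    Y w1 (N + l%:~R - i%:R) k (gm_Y W2 v (m + i%:Z) w2).
  rewrite /fC (log_map_homog (N := N + l%:~R - i%:R) w1h (weight_Y (m + i%:Z) vd w2h))//.
  by rewrite /N rmorphD/=; ring.
have [MA hA] := li_trunc Yint w1 w2 N.
have [MB hB] := gm_trunc (g := W1) v w1.
have [MC hC] := gm_trunc (g := W2) v w2.
exists (maxn MA (maxn (absz (MB - l)) (absz (MC - m)))) => M.
rewrite !geq_max => /and3P[MAM MBM MCM].
have vA i k : (M <= i)%N -> Y w1 (N + i%:R) k w2 = 0.
  by move=> Mi; apply: hA; exact: leq_trans Mi.
have vB i : (M <= i)%N -> gm_Y W1 v (l + i%:Z) w1 = 0.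
  by move=> Mi; apply: hB; lia.
have vC i : (M <= i)%N -> gm_Y W2 v (m + i%:Z) w2 = 0.
  by move=> Mi; apply: hC; lia.
split.
- by rewrite AE big1// => k _; rewrite vA// linear0 scaler0.
- by rewrite /fB vB// (lin0 (log_map_linear1 _ _)).
- by rewrite /fC vC// (lin0 (log_map_linear2 _ _)).
have zi (i : nat) : z ^+ i = z ^ i%:Z by [].
pose J k i := xmy l i *: gm_Y W3 v (m + l - i%:Z) (Y w1 (N + i%:R) k w2)
  - xmy (i%:Z - m - 1) i *: Y (gm_Y W1 v (l + i%:Z) w1) (N + m%:~R - i%:R) k w2
  - (-1) ^ l *: (xmy l i *: Y w1 (N + l%:~R - i%:R) k (gm_Y W2 v (m + i%:Z) w2)).
transitivity (\sum_(i < M) \sum_(k < K) mono (N, (k : nat)) s *: J k i).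
  apply: eq_bigr => i _; rewrite AE BE CE !scaler_sumr -!sumrB.
  apply: eq_bigr => k _; rewrite !scalerA.
  have -> : cA i * mono (N + i%:R, (k : nat)) s = xmy l i * mono (N, (k : nat)) s.
    by rewrite /cA zi -mulrA (@mono_shift_eq i%:Z N).
  have -> : cB i * mono (N + m%:~R - i%:R, (k : nat)) s
      = xmy (i%:Z - m - 1) i * mono (N, (k : nat)) s.
    by rewrite /cB -mulrA (@mono_shift_eq (m - i%:Z) N)// rmorphB/=; ring.
  have -> : cC i * mono (N + l%:~R - i%:R, (k : nat)) s
      = (-1) ^ l * xmy l i * mono (N, (k : nat)) s.
    have assoc (a b c e : C) : a * (b * c) * e = a * b * (c * e) by ring.
    rewrite /cC assoc (@mono_shift_eq (l - i%:Z) N)//.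
    by rewrite rmorphB/=; ring.
  rewrite /J; move: (xmy l i) (xmy (i%:Z - m - 1) i) (mono (N, (k : nat)) s) => x y c.
  by move: ((-1) ^ l : C) => b; lmod (R[i]) W3.
rewrite exchange_big big1// => k _; rewrite -scaler_sumr.
have -> : \sum_(i < M) J k i = 0; last by rewrite scaler0.
rewrite /J !sumrB -scaler_sumr.
have := li_jacobi Yint k v w1 w2 l m N.
rewrite !(fsum_nat (n := M)); last 3 first.
- by move=> i Mi; rewrite vB// (lin0 (li_linear1 Yint _ _ _)) scaler0.
- by move=> i Mi; rewrite vC// (lin0 (li_linear2 Yint _ _ _)) scaler0.
- by move=> i Mi; rewrite vA// linear0 scaler0.
by move=> /eqP; rewrite -subr_eq0 => /eqP e; rewrite addrAC.
Qed.

Lemma log_map_jac v w1 w2 : exists M : nat, forall M' : nat, (M <= M')%N ->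
  [/\ fA v w1 w2 M' = 0, fB v w1 w2 M' = 0, fC v w1 w2 M' = 0 &
   \sum_(i < M') (cA i *: fA v w1 w2 i - cB i *: fB v w1 w2 i - cC i *: fC v w1 w2 i) = 0].
Proof.
have l1 := log_map_linear1; have l2 := log_map_linear2.
have cm u w := log_map_completion u w.
have eD1 u u' w : log_map (u + u') w = fun k => log_map u w k + log_map u' w k.
  by apply/funext => k; rewrite (linD (l1 _ _)).
have eD2 u w w' : log_map u (w + w') = fun k => log_map u w k + log_map u w' k.
  by apply/funext => k; rewrite (linD (l2 _ _)).
have e01 w : log_map 0 w = fun=> 0 by apply/funext => k; rewrite (lin0 (l1 _ _)).
have e02 u : log_map u 0 = fun=> 0 by apply/funext => k; rewrite (lin0 (l2 _ _)).
move: v; apply: (grading_ind (g := va_wt V)).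
- apply: jac_zero => i; rewrite /fA /fB /fC.
  + exact: ext_Y0v.
  + by rewrite (lin0 (gm_Y_linear _ _)) (lin0 (l1 _ _)).
  + by rewrite (lin0 (gm_Y_linear _ _)) (lin0 (l2 _ _)).
- move=> u v ju jv; apply: jacD ju jv => i; rewrite /fA /fB /fC.
  + exact: ext_YDv.
  + by rewrite (linD (gm_Y_linear _ _)) (linD (l1 _ _)).
  + by rewrite (linD (gm_Y_linear _ _)) (linD (l2 _ _)).
move=> d v vd; move: w1; apply: (grading_ind (g := gm_wt W1)).
- apply: jac_zero => i; rewrite /fA /fB /fC.
  + by rewrite e01 ext_Y0f.
  + by rewrite linear0 (lin0 (l1 _ _)).
  + by rewrite (lin0 (l1 _ _)).
- move=> u w ju jw; apply: jacD ju jw => i; rewrite /fA /fB /fC.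
  + by rewrite eD1 ext_YDf.
  + by rewrite (linD (gmY_linear _ _)) (linD (l1 _ _)).
  + by rewrite (linD (l1 _ _)).
move=> h1 w1 w1h; move: w2; apply: (grading_ind (g := gm_wt W2)).
- apply: jac_zero => i; rewrite /fA /fB /fC.
  + by rewrite e02 ext_Y0f.
  + by rewrite (lin0 (l2 _ _)).
  + by rewrite linear0 (lin0 (l2 _ _)).
- move=> u w ju jw; apply: jacD ju jw => i; rewrite /fA /fB /fC.
  + by rewrite eD2 ext_YDf.
  + by rewrite (linD (l2 _ _)).
  + by rewrite (linD (gmY_linear _ _)) (linD (l2 _ _)).
by move=> h2 w2 w2h; exact: jac_homog vd w1h w2h.
Qed.

End Jacobi.

Lemma log_map_intertwining : intertwining_map z log_map.
Proof.
split.
- exact: log_map_completion.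
- exact: log_map_linear1.
- exact: log_map_linear2.
- by move=> b c w1 w2 n; exact: log_map_ch.
- exact: log_map_trunc.
- move=> v w1 w2 l m n; have [M h] := log_map_jac l m n v w1 w2.
  have [_ _ _] := h M (leqnn _); rewrite !sumrB => /eqP; rewrite subr_eq0 subr_eq => /eqP e.
  rewrite (fsum_nat (n := M)) => [|i /h[-> _ _ _]]; last by rewrite scaler0.
  rewrite (fsum_nat (n := M)) => [|i /h[_ -> _ _]]; last by rewrite scaler0.
  rewrite (fsum_nat (n := M)) => [|i /h[_ _ -> _]]; last by rewrite scaler0.
  rewrite e addrC scaler_sumr; congr (_ + _); apply: eq_bigr => i _.
  by rewrite scalerA.
- by move=> j w1 w2 n; exact: log_map_Lbracket.
Qed.

End LogToMap.

(** * Skew symmetry *)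

Section Binomials.
Context {R : realType}.
Local Notation C := R[i].

Definition ffz (n : int) (i : nat) : C := \prod_(j < i) (n - j%:Z)%:~R.

Lemma fact_neq0 (i : nat) : (i`!)%:R != 0 :> C.
Proof. by rewrite pnatr_eq0 -lt0n fact_gt0. Qed.

Lemma ffz0 n : ffz n 0 = 1. Proof. by rewrite /ffz big_ord0. Qed.

Lemma ffzSr n i : ffz n i.+1 = ffz n i * (n - i%:Z)%:~R.
Proof. by rewrite /ffz big_ord_recr. Qed.

Lemma ffzSl n i : ffz n i.+1 = n%:~R * ffz (n - 1) i.
Proof.
rewrite /ffz big_ord_recl subr0; congr (_ * _); apply: eq_bigr => j _.
by rewrite lift0; congr (_%:~R); lia.
Qed.

Lemma binomz0 n : binomz n 0 = 1 :> C.
Proof. by rewrite /binomz big_ord0 fact0 divr1. Qed.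

Lemma binomzS n i : binomz (n + 1) i.+1 = binomz n i.+1 + binomz n i :> C.
Proof.
rewrite /binomz -!/(ffz _ _) ffzSl ffzSr addrK factS natrM.
have := fact_neq0 i; have : i.+1%:R != 0 :> C by rewrite pnatr_eq0.
by rewrite rmorphD rmorphB/= -[i.+1]addn1 natrD => h1 h2; field; rewrite h1 h2.
Qed.

(** Negation of the upper index; reversing the order of the factors matches them one by one. *)
Lemma xmy_opp (m : int) i : xmy (i%:Z - m - 1) i = binomz m i :> C.
Proof.
rewrite /xmy /binomz mulrA; congr (_ / _).
rewrite -[X in _ ^+ X]card_ord -prodr_const -big_split (reindex_inj rev_ord_inj)/=.
apply: eq_bigr => j _; rewrite mulN1r -rmorphN/=; congr (_%:~R).
by have := ltn_ord j; lia.
Qed.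

Lemma xmy0 (l : int) : xmy l 0 = 1 :> C.
Proof. by rewrite /xmy expr0 mul1r binomz0. Qed.

Lemma xmyS (l : int) i : xmy (l + 1) i.+1 = xmy l i.+1 - xmy l i :> C.
Proof. by rewrite /xmy binomzS exprS; ring. Qed.

Let vsum (l q : int) s : C := \sum_(i < s.+1) xmy l i * binomz (q - i%:Z) (s - i).

(** Coefficient form of (1 - y)^(l + 1) = (1 - y)^l - y (1 - y)^l, the extra y lowering both q and s
    by one. *)
Let vsumS l q s : vsum (l + 1) q s.+1 = vsum l q s.+1 - vsum l (q - 1) s.
Proof.
rewrite /vsum big_ord_recl [in RHS]big_ord_recl !xmy0 -addrA; congr (_ + _).
rewrite -sumrB; apply: eq_bigr => i _; rewrite /= /bump/= add1n subSS xmyS.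
have -> : q - i.+1%:Z = q - 1 - i%:Z by lia.
by rewrite mulrBl.
Qed.

(* Compare coefficients in (1 + x)^q (1 - x / (1 + x))^l = (1 + x)^(q - l). *)
Lemma binomz_vandermonde (l q : int) s :
  \sum_(i < s.+1) xmy l i * binomz (q - i%:Z) (s - i) = binomz (q - l) s :> C.
Proof.
rewrite -/(vsum l q s); move: l q s.
have v0 l q : vsum l q 0 = binomz (q - l) 0.
  by rewrite /vsum big_ord_recl big_ord0 addr0 xmy0 !binomz0 mulr1.
apply: int_rect => [q s|n IH q s|n IH q s].
- rewrite /vsum big_ord_recl xmy0 mul1r subn0 big1 ?addr0// => i _.
  by rewrite /xmy /binomz big_ord_recl/= subrr !mul0r mulr0 mul0r.
- case: s => [|s]; first exact: v0.
  rewrite -addn1 PoszD vsumS !IH.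
  have -> : q - n%:Z = q - (n%:Z + 1) + 1 by lia.
  by rewrite binomzS (_ : q - 1 - n%:Z = q - (n%:Z + 1)) ?addrK//; lia.
- elim: s q => [|s IHs] q; first exact: v0.
  have e : - n%:Z = - (n.+1)%:Z + 1 by lia.
  have := IH q s.+1; rewrite {1}e vsumS IHs => /eqP; rewrite subr_eq => /eqP ->.
  have -> : q - - n.+1%:Z = q - - n%:Z + 1 by lia.
  by rewrite binomzS; congr (_ + binomz _ _); lia.
Qed.

Lemma sum_triangle (W : zmodType) (N : nat) (H : nat -> nat -> W) :
  (forall i r, (N <= i + r)%N -> H i r = 0) ->
  \sum_(i < N) \sum_(r < N) H i r = \sum_(s < N) \sum_(i < s.+1) H i (s - i)%N.
Proof.
move=> H0.
transitivity (\sum_(0 <= s < N) \sum_(0 <= i < N | (i <= s)%N) H i (s - i)%N); last first.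
  rewrite big_mkord; apply: eq_bigr => s _.
  rewrite (big_ord_widen_cond N (fun=> true) (fun i => H i (s - i)%N) (ltn_ord s)).
  by rewrite big_mkord; apply: eq_bigl => i; rewrite ltnS.
rewrite (exchange_big_dep_nat (fun=> true))//= big_mkord; apply: eq_bigr => i _.
rewrite -(big_mkord xpredT (H i)) (big_cat_nat (n := N - i)) ?leq_subr//=.
rewrite [X in _ + X]big_nat_cond [X in _ + X]big1 ?addr0 => [|r]; last first.
  by rewrite andbT => /andP[ir _]; apply: H0; rewrite -leq_subLR.
rewrite [RHS](big_cat_nat (n := i)) ?(ltnW (ltn_ord i))//=.
rewrite [X in _ = X + _]big_nat_cond [X in _ = X + _]big1 ?add0r => [|r]; last first.
  by move=> /andP[/andP[_ ri] ir]; have := leq_trans ri ir; rewrite ltnn.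
have -> : \sum_(i <= s < N | (i <= s)%N) H i (s - i)%N
    = \sum_(0 + i <= s < N | (i <= s)%N) H i (s - i)%N by rewrite add0n.
rewrite big_addn; apply: congr_big_nat => // r; first by rewrite leq_addl.
by rewrite addnK.
Qed.

End Binomials.

Lemma bigrading_ind (R : realType) (A At : zmodType) (emb : {additive A -> At})
    (V : vertex_algebra R A) (W : gmodule emb V) (P : W -> Prop) : P 0 ->
  (forall u v, P u -> P v -> P (u + v)) ->
  (forall b n w, homog (gm_ch W) b w -> homog (gm_wt W) n w -> P w) -> forall w, P w.
Proof.
move=> P0 PD Ph; apply: (grading_ind (g := gm_wt W)) => // n w wn.
have [s _ ->] := grading_dec (gm_ch W) w.
elim/big_ind: _ => // b _; apply: (Ph b n); first exact: homog_proj.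
by rewrite /homog/= -gm_compatible wn.
Qed.

Section ScalarMaps.
Context {K : comPzRingType} {W : lmodType K} (f : W -> K).
Hypothesis lf : forall a u v, f (a *: u + v) = a * f u + f v.

Lemma scD u v : f (u + v) = f u + f v.
Proof. by rewrite -[u]scale1r lf scale1r mul1r. Qed.

Lemma sc0 : f 0 = 0.
Proof. by apply: (addIr (f 0)); rewrite -scD !add0r. Qed.

Lemma scZ a u : f (a *: u) = a * f u.
Proof. by rewrite -[a *: u]addr0 lf sc0 addr0. Qed.

Lemma sc_sum (I : Type) (r : seq I) (P : pred I) (F : I -> W) :
  f (\sum_(i <- r | P i) F i) = \sum_(i <- r | P i) f (F i).
Proof. by elim/big_rec2: _ => [|i y1 y2 _ <-]; rewrite ?sc0 ?scD. Qed.

End ScalarMaps.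

Section GradedDual.
Context {R : realType} {A At : zmodType} {emb : {additive A -> At}}.
Context {V : vertex_algebra R A} {W : gmodule emb V}.
Local Notation C := R[i].

Lemma scP (f : {scalar W}) a (u v : W) : f (a *: u + v) = a * f u + f v.
Proof. exact: linearP. Qed.

Lemma graded_dual_sum (f : {scalar W}) : graded_dual f ->
  exists2 s : seq (At * C), uniq s &
    forall w, f w = \sum_(bn <- s) f (gm_ch W bn.1 (gm_wt W bn.2 w)).
Proof.
move=> /finite_seqP[s0 sE]; exists (undup s0) => [|w]; first exact: undup_uniq.
move: w; apply: bigrading_ind.
- by rewrite (sc0 (scP f)) big1// => bn _; rewrite !linear0.
- move=> u v uE vE; rewrite (scD (scP f)) uE vE -big_split; apply: eq_bigr => bn _ /=.
  by rewrite !linearD.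
move=> b n w wb wn.
have o bn : bn != (b, n) -> f (gm_ch W bn.1 (gm_wt W bn.2 w)) = 0.
  case: bn => b' n' /= bn; have [n'n|n'n] := eqVneq n' n; last first.
    by rewrite (proj_homog0 wn n'n) linear0 (sc0 (scP f)).
  rewrite n'n (proj_homog wn) (proj_homog0 wb) ?(sc0 (scP f))//.
  by apply: contra bn => /eqP ->; rewrite n'n.
have e : f (gm_ch W b (gm_wt W n w)) = f w by rewrite (proj_homog wn) (proj_homog wb).
have [bns|bns] := boolP ((b, n) \in undup s0).
  rewrite (bigD1_seq (b, n)) ?undup_uniq//= e big1 ?addr0// => bn; exact: o.
rewrite big_seq_cond big1 => [|bn]; last first.
  by rewrite andbT => bn_s; apply: o; apply: contraNneq bns => <-.
apply/eqP; apply: contraT => fw.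
have /= : [set` s0] (b, n) by rewrite -sE/=; exists w; rewrite e.
by rewrite -mem_undup (negbTE bns).
Qed.

Lemma graded_dualP (f : {scalar W}) (s : seq (At * C)) :
  (forall b n w, homog (gm_ch W) b w -> homog (gm_wt W) n w -> (b, n) \notin s -> f w = 0) ->
  graded_dual f.
Proof.
move=> fs; apply: (sub_finite_set (B := [set` s])); last exact: finite_seq.
move=> [b n] /= [w]; apply: contraNT => bn; apply/eqP; apply: fs bn.
  exact: homog_proj.
by rewrite /homog/= -gm_compatible; congr (gm_ch W b _); exact: homog_proj.
Qed.

Lemma graded_dual_completion (f : {scalar W}) : graded_dual f ->
  exists s : seq C, forall n w, homog (gm_wt W) n w -> n \notin s -> f w = 0.
Proof.
move=> /graded_dual_sum[s _ fE]; exists (map snd s) => n w wn ns.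
rewrite fE big_seq_cond big1// => -[b n']; rewrite andbT => bn /=.
rewrite (proj_homog0 wn) ?linear0 ?(sc0 (scP f))//.
by apply: contra ns => /eqP <-; apply/mapP; exists (b, n').
Qed.

End GradedDual.

(** * The operator e^(c L(-1)) on lower truncated families *)

Section ExpL.
Context {R : realType} {A At : zmodType} {emb : {additive A -> At}}.
Context {V : vertex_algebra R A} {W : gmodule emb V}.
Local Notation C := R[i].
Local Notation L := (Lneg1 (gm_L W)).

(** L(-1) raises weights by one, so this is the condition that makes [expL] a finite sum in each
    weight. *)
Definition lower_trunc (f : C -> W) : Prop :=
  forall n, exists N : nat, forall m : nat, (N <= m)%N -> f (n - m%:R) = 0.

(* The weight n component of e^(c L(-1)) f. *)
Definition expL (c : C) (f : C -> W) (n : C) : W :=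
  \sum_(j \in [set: nat]) (c ^+ j / j`!%:R) *: iter j L (f (n - j%:R)).

Lemma iterL_linear j : linear (iter j L).
Proof. by move=> a u v; elim: j => //= j ->; rewrite linearP. Qed.

Lemma expL_nat c f n N : (forall m, (N <= m)%N -> f (n - m%:R) = 0) ->
  expL c f n = \sum_(j < N) (c ^+ j / j`!%:R) *: iter j L (f (n - j%:R)).
Proof.
move=> f0; rewrite /expL (fsum_nat (n := N))// => j /f0 ->.
by rewrite (lin0 (iterL_linear _)) scaler0.
Qed.

Lemma expLP c a f g n : lower_trunc f -> lower_trunc g ->
  expL c (fun k => a *: f k + g k) n = a *: expL c f n + expL c g n.
Proof.
move=> /(_ n)[N f0] /(_ n)[M g0].
have f0' m : (maxn N M <= m)%N -> f (n - m%:R) = 0 by rewrite geq_max => /andP[/f0].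
have g0' m : (maxn N M <= m)%N -> g (n - m%:R) = 0 by rewrite geq_max => /andP[_ /g0].
rewrite !(expL_nat _ (N := maxn N M))//; last first.
  by move=> m Nm; rewrite f0'// g0'// scaler0 addr0.
rewrite scaler_sumr -big_split; apply: eq_bigr => j _ /=.
by rewrite (iterL_linear _ a) scalerDr !scalerA [a * _]mulrC.
Qed.

Lemma lower_trunc0 : lower_trunc (fun=> 0).
Proof. by move=> n; exists 0%N. Qed.

Lemma lower_truncP a f g : lower_trunc f -> lower_trunc g ->
  lower_trunc (fun k => a *: f k + g k).
Proof.
move=> tf tg n; have [N f0] := tf n; have [M g0] := tg n; exists (maxn N M) => m.
by rewrite geq_max => /andP[/f0 -> /g0 ->]; rewrite scaler0 addr0.
Qed.

Lemma expL0 c n : expL c (fun=> 0) n = 0.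
Proof. by rewrite (expL_nat c (N := 0)) ?big_ord0. Qed.

Lemma expLD c f g n : lower_trunc f -> lower_trunc g ->
  expL c (fun k => f k + g k) n = expL c f n + expL c g n.
Proof.
move=> tf tg; rewrite -[expL c f n]scale1r -expLP//; congr (expL c _ n).
by apply/funext => k; rewrite scale1r.
Qed.

Lemma expLZ c a f n : lower_trunc f -> expL c (fun k => a *: f k) n = a *: expL c f n.
Proof.
move=> tf; rewrite -[RHS]addr0 -(expL0 c n) -expLP//; last exact: lower_trunc0.
by congr (expL c _ n); apply/funext => k; rewrite addr0.
Qed.

Lemma lower_trunc_sum M (a : nat -> C) (f : nat -> C -> W) :
  (forall i, lower_trunc (f i)) -> lower_trunc (fun k => \sum_(i < M) a i *: f i k).
Proof.
move=> tf; elim: M => [|M IH].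
  by move=> n; exists 0%N => m _; rewrite big_ord0.
have := lower_truncP (a M) (tf M) IH; congr lower_trunc; apply/funext => k.
by rewrite big_ord_recr/= addrC.
Qed.

Lemma expL_sum c M (a : nat -> C) (f : nat -> C -> W) n :
  (forall i, lower_trunc (f i)) ->
  expL c (fun k => \sum_(i < M) a i *: f i k) n = \sum_(i < M) a i *: expL c (f i) n.
Proof.
move=> tf; elim: M => [|M IH].
  transitivity (expL c (fun=> 0) n); last by rewrite expL0 big_ord0.
  by congr (expL c _ n); apply/funext => k; rewrite big_ord0.
rewrite big_ord_recr/= -IH addrC -expLP//; last exact: lower_trunc_sum.
by congr (expL c _ n); apply/funext => k; rewrite big_ord_recr/= addrC.
Qed.

Lemma weight_iterL j h w : homog (gm_wt W) h w -> homog (gm_wt W) (h + j%:R) (iter j L w).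
Proof.
elim: j => [|j IH] wh; first by rewrite addr0.
by rewrite /= -natr1 addrA; have := weight_L is_jN1 (IH wh); rewrite opprK.
Qed.

Lemma ch_iterL j b w : homog (gm_ch W) b w -> homog (gm_ch W) b (iter j L w).
Proof. by move=> wb; elim: j => //= j; exact: (gm_L_ch (j := -1) is_jN1). Qed.

Lemma expL_completion c f : in_completion f -> in_completion (expL c f).
Proof.
move=> cf n; apply: homog_sum => j; apply: homogZ.
by have := weight_iterL j (cf (n - j%:R)); rewrite subrK.
Qed.

Lemma expL_trunc c f : lower_trunc f -> lower_trunc (expL c f).
Proof.
move=> tf n; have [N f0] := tf n; exists N => m Nm.
rewrite (expL_nat c (N := 0)) ?big_ord0// => k _.
by rewrite -addrA -opprD -natrD f0// (leq_trans Nm) ?leq_addr.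
Qed.

Lemma fact_div (j : nat) : j.+1%:R / j.+1`!%:R = j`!%:R^-1 :> C.
Proof.
rewrite factS natrM invfM mulrA divff ?mul1r// pnatr_eq0//.
Qed.

(** This is c d/dc applied to e^(c L(-1)): the factor j cancels in j! and the index moves by one. It
    produces the terms in L(-1) when L(0) and L(1) are moved past the exponential. *)
Lemma expL_shift c f n N : (forall m, (N <= m)%N -> f (n - m%:R) = 0) ->
  \sum_(j < N) (c ^+ j / j`!%:R) *: (j%:R *: iter j L (f (n - j%:R)))
  = c *: expL c (fun k => L (f (k - 1))) n.
Proof.
move=> f0.
rewrite (expL_nat c (N := N)) => [|m Nm]; last first.
  by rewrite -addrA -opprD natr1 f0 ?linear0// ltnW.
have : (c ^+ N / N`!%:R) *: (N%:R *: iter N L (f (n - N%:R))) = 0.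
  by rewrite f0// (lin0 (iterL_linear _)) !scaler0.
move=> e; transitivity
  (\sum_(j < N.+1) (c ^+ j / j`!%:R) *: ((j : nat)%:R *: iter j L (f (n - (j : nat)%:R)))).
  by rewrite big_ord_recr/= e addr0.
rewrite big_ord_recl scale0r scaler0 add0r scaler_sumr; apply: eq_bigr => j _.
rewrite lift0 !scalerA -mulrA [_^-1 * _]mulrC fact_div exprS iterSr.
have -> : n - j%:R - 1 = n - j.+1%:R by rewrite -natr1 opprD addrA.
by rewrite mulrA.
Qed.

Lemma L0_iterL j w : Lzero (gm_L W) (iter j L w)
  = iter j L (Lzero (gm_L W) w) + j%:R *: iter j L w.
Proof.
elim: j w => [|j IH] w; first by rewrite scale0r addr0.
have e u : Lzero (gm_L W) (L u) = L (Lzero (gm_L W) u) + L u.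
  have := gm_sl2 (g := W) u is_j0 is_jN1; rewrite -[(0 - -1)%:~R]/(1 : C).
  rewrite -[0 + -1]/(-1 : int) !Lop0 !LopN1 scale1r.
  by move=> /eqP; rewrite subr_eq addrC => /eqP.
rewrite !iterS e IH linearD linearZ/=.
by rewrite -natr1; lmod (R[i]) W.
Qed.

(** Each passage of L(1) over an L(-1) leaves 2 L(0), and moving these to the right past the
    remaining L(-1) adds up to (j + 1) j. *)
Lemma L1_iterL j w : Lone (gm_L W) (iter j.+1 L w)
  = iter j.+1 L (Lone (gm_L W) w) + (2 * j.+1%:R) *: iter j L (Lzero (gm_L W) w)
    + (j.+1%:R * j%:R) *: iter j L w.
Proof.
have e u : Lone (gm_L W) (L u) = L (Lone (gm_L W) u) + 2 *: Lzero (gm_L W) u.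
  have := gm_sl2 (g := W) u is_j1 is_jN1; rewrite !Lop1 !LopN1 opprK.
  have -> : (1 - 1 : int) = 0 by []. rewrite Lop0 => /eqP; rewrite subr_eq addrC => /eqP ->.
  by [].
elim: j w => [|j IH] w.
  by rewrite /= e mulr0 scale0r addr0 mulr1.
rewrite iterS e IH L0_iterL !linearD !linearZ/= -!iterS.
rewrite -![j.+2%:R]natr1 -![j.+1%:R]natr1 !iterS.
lmod (R[i]) W.
Qed.

Section Brackets.
Context (c : C) (f : C -> W) (tf : lower_trunc f).

Lemma Lneg1_expL n : L (expL c f (n - 1)) = expL c (fun k => L (f (k - 1))) n.
Proof.
have [N f0] := tf (n - 1).
rewrite !(expL_nat c (N := N))//; last by move=> m /f0; rewrite addrAC => ->; rewrite linear0.
rewrite linear_sum; apply: eq_bigr => j _; rewrite linearZ/= -iterS iterSr.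
by rewrite addrAC.
Qed.

Lemma Lzero_expL n : Lzero (gm_L W) (expL c f n)
  = expL c (fun k => Lzero (gm_L W) (f k)) n + c *: expL c (fun k => L (f (k - 1))) n.
Proof.
have [N f0] := tf n; rewrite -(expL_shift c f0).
rewrite !(expL_nat c (N := N))//; last by move=> m /f0 ->; rewrite linear0.
rewrite linear_sum -big_split; apply: eq_bigr => j _ /=.
by rewrite linearZ/= L0_iterL scalerDr.
Qed.

(** The three terms of [L1_iterL] resum to L(1) + 2 c L(0) + c^2 L(-1), the conjugate of L(1) by
    e^(c L(-1)). *)
Lemma Lone_expL n : Lone (gm_L W) (expL c f (n + 1))
  = expL c (fun k => Lone (gm_L W) (f (k + 1))) n
    + (2 * c) *: expL c (fun k => Lzero (gm_L W) (f k)) n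
    + (c ^+ 2) *: expL c (fun k => L (f (k - 1))) n.
Proof.
have [N f0] := tf (n + 1).
have f1 m : (N <= m)%N -> f (n - m%:R) = 0.
  move=> Nm; have := f0 m.+1 (leqW Nm); rewrite -natr1.
  by rewrite (_ : n + 1 - (m%:R + 1) = n - m%:R)//; ring.
have fS m : (N <= m)%N -> f (n + 1 - m.+1%:R) = 0 by move=> Nm; rewrite f0// leqW.
have -> : (c ^+ 2) *: expL c (fun k => L (f (k - 1))) n =
  c *: \sum_(j < N) (c ^+ j / j`!%:R) *: (j%:R *: iter j L (f (n - j%:R))).
  by rewrite (expL_shift c f1) scalerA expr2.
(* The first two sums get one term more: their terms j = 0 agree, and their terms j + 1 are compared
   with the terms j of the other two. *)
rewrite (expL_nat c (N := N.+1)); last by move=> m Nm; rewrite f0// ltnW.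
rewrite (expL_nat c (N := N.+1) (n := n)); last first.
  by move=> m Nm; rewrite addrAC f0 ?linear0// ltnW.
rewrite (expL_nat c (N := N) (n := n)); last by move=> m /f1 ->; rewrite linear0.
rewrite linear_sum !big_ord_recl/= linearZ/= -!addrA; congr (_ + _).
  by congr (_ *: _); congr (Lone _ (f _)); ring.
rewrite !scaler_sumr -!big_split; apply: eq_bigr => j _ /=.
rewrite /bump/= add1n linearZ/= -iterS L1_iterL.
have -> : n + 1 - j.+1%:R = n - j%:R by rewrite -natr1; ring.
have -> : n - j.+1%:R + 1 = n - j%:R by rewrite -natr1; ring.
rewrite !scalerDr -addrA; congr (_ + _); rewrite !scalerA.
have e : c ^+ j.+1 / j.+1`!%:R * j.+1%:R = c * (c ^+ j / j`!%:R).
  by rewrite -mulrA [_^-1 * _]mulrC fact_div exprS mulrA.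
rewrite [2 * j.+1%:R]mulrC !mulrA e.
congr (_ *: _ + _ *: _); ring.
Qed.

End Brackets.

(** The terms with i + r = s add up to a multiple of (1 - 1)^s, so only s = 0 survives. *)
Lemma expL_inv c f n : lower_trunc f -> expL c (expL (- c) f) n = f n.
Proof.
move=> tf; have [N f0] := tf n.
have [N' NE] : exists N', (N <= N'.+1)%N by exists N; exact: leqnSn.
have {}f0 m : (N'.+1 <= m)%N -> f (n - m%:R) = 0 by move=> Nm; exact/f0/(leq_trans NE).
have f0' i m : (N'.+1 <= i + m)%N -> f (n - i%:R - m%:R) = 0.
  by move=> Nm; rewrite -addrA -opprD -natrD f0.
rewrite (expL_nat c (N := N'.+1)); last first.
  move=> m Nm; rewrite (expL_nat _ (N := 0)) ?big_ord0// => k _; rewrite f0'//.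
  exact: leq_trans (leq_addr _ _).
pose H i r := (c ^+ i / i`!%:R * ((- c) ^+ r / r`!%:R)) *: iter (i + r) L (f (n - (i + r)%:R)).
transitivity (\sum_(i < N'.+1) \sum_(r < N'.+1) H i r).
  apply: eq_bigr => i _; rewrite (expL_nat _ (N := N'.+1)); last first.
    by move=> m Nm; rewrite f0'//; exact: leq_trans (leq_addl _ _).
  rewrite (lin_sum (iterL_linear _)) scaler_sumr; apply: eq_bigr => r _.
  by rewrite (linZ (iterL_linear _)) scalerA -iterD /H natrD opprD addrA.
rewrite sum_triangle => [|i r Nir]; last first.
  by rewrite /H f0// (lin0 (iterL_linear _)) scaler0.
have HE (s i : nat) : (i < s.+1)%N ->
    H i (s - i)%N = (c ^+ s / s`!%:R * ((-1) ^+ (s - i) *+ 'C(s, i))) *: iter s L (f (n - s%:R)).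
  rewrite ltnS => is_; rewrite /H subnKC//; congr (_ *: _).
  have -> : c ^+ s = c ^+ i * c ^+ (s - i) by rewrite -exprD subnKC.
  rewrite -(bin_fact is_) !natrM [(- c) ^+ _]exprNn -mulr_natr.
  have := fact_neq0 (R := R) i; have := fact_neq0 (R := R) (s - i).
  have : 'C(s, i)%:R != 0 :> C by rewrite pnatr_eq0 -lt0n bin_gt0.
  by move=> h1 h2 h3; field; rewrite h1 h2 h3.
rewrite big_ord_recl [X in _ + X]big1 ?addr0 => [|s _].
  rewrite big_ord_recl big_ord0 addr0 (HE 0%N 0%N)//=.
  by rewrite expr0 fact0 divr1 bin0 mulr1n mul1r scale1r subr0.
rewrite (eq_bigr _ (fun i _ => HE _ _ (ltn_ord i))) -scaler_suml -mulr_sumr.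
have := exprDn (-1 : C) 1 (lift ord0 s); rewrite addNr lift0 expr0n/=.
rewrite (eq_bigr (fun i : 'I_(s.+2) => (-1) ^+ (s.+1 - i) *+ 'C(s.+1, i))).
  by move=> <-; rewrite mulr0 scale0r.
by move=> i _; rewrite expr1n mulr1.
Qed.

(** Leibniz rule: passing one L(-1) turns v_q into q v_(q-1), by the L(-1)-derivative property. *)
Lemma Y_iterL v q k w : gm_Y W v q (iter k L w) =
  \sum_(i < k.+1) ('C(k, i)%:R * ffz q i) *: iter (k - i) L (gm_Y W v (q - i%:Z) w).
Proof.
have e u p : gm_Y W v p (L u) = L (gm_Y W v p u) + p%:~R *: gm_Y W v (p - 1) u.
  rewrite (Lbracket_N1 (gm_Lbracket (g := W))) -[Lneg1 (va_L V) _]/(Lop (va_L V) (-1) v).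
  by rewrite gm_Lneg1 scaleNr subrK.
elim: k q => [|k IH] q.
  by rewrite big_ord_recl big_ord0 addr0 bin0 ffz0 mulr1 scale1r subr0.
rewrite iterS e !IH linear_sum scaler_sumr.
rewrite [RHS]big_ord_recl subn0 bin0 ffz0.
under [X in _ = _ + X]eq_bigr => i _ do rewrite lift0 subSS binS natrD mulrDl scalerDl.
rewrite big_split addrA; congr (_ + _); last first.
  apply: eq_bigr => i _; rewrite scalerA ffzSl mulrCA.
  by have -> : q - 1 - i%:Z = q - i.+1%:Z by lia.
rewrite [in RHS]big_ord_recr/= bin_small// mul0r scale0r addr0.
rewrite big_ord_recl/= linearZ/= bin0 ffz0 subn0 subr0; congr (_ + _).
rewrite ?addr0; apply: eq_bigr => i _; rewrite linearZ/= /bump/= add1n -iterS subnSK//.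
Qed.

End ExpL.

(** * Skew symmetry of intertwining maps *)

Section SkewSymmetry.
Context {R : realType} {A At : zmodType} {emb : {additive A -> At}}.
Context {V : vertex_algebra R A}.
Local Notation C := R[i].
Local Notation gmod := (gmodule emb V).

Lemma sum_antidiagonal (M : zmodType) (N : nat) (H : nat -> nat -> M) :
  (forall r t, (N <= r + t)%N -> H r t = 0) ->
  \sum_(k < N) \sum_(r < k.+1) H r (k - r)%N = \sum_(r < N) \sum_(t < N) H r t.
Proof. by move=> H0; rewrite sum_triangle. Qed.

(** Formally Y(v, x1) e^(c L(-1)) = e^(c L(-1)) Y(v, x1 - c). Both sides are residues against x1^m
    (x1 - c)^l; in the variable x = x1 - c this factor is (x + c)^m x^l, whence the coefficients
    binom(m, s) c^s on the right. *)
Lemma expL_Y (W : gmod) (c : C) (f : C -> W) v (l m : int) (a : C) (N : nat) :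
  (forall t, (N <= t)%N -> f (a - t%:R) = 0) ->
  \sum_(i < N) (xmy l i * c ^+ i) *: gm_Y W v (m + l - i%:Z) (expL c f (a - i%:R))
  = \sum_(t < N) (c ^+ t / t`!%:R) *: iter t (Lneg1 (gm_L W))
      (\sum_(s < N) (binomz m s * c ^+ s) *: gm_Y W v (m + l - s%:Z) (f (a - t%:R - s%:R))).
Proof.
move=> f0; set L := Lneg1 (gm_L W).
have f0' i t : (N <= i + t)%N -> f (a - i%:R - t%:R) = 0.
  by move=> Nit; rewrite -addrA -opprD -natrD f0.
pose G s t := (c ^+ (s + t) / t`!%:R) *: iter t L (gm_Y W v (m + l - s%:Z) (f (a - (s + t)%:R))).
have G0 s t : (N <= s + t)%N -> G s t = 0.
  by move=> Nst; rewrite /G f0// linear0 (lin0 (iterL_linear _)) scaler0.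
(* i comes from (x1 - c)^l, r from the Leibniz rule, and t counts the L(-1) left on the outside.
   Collecting i + r = s gives the sum of [binomz_vandermonde] with q = m + l. *)
transitivity (\sum_(i < N) \sum_(r < N) \sum_(t < N)
    (xmy l i * binomz (m + l - i%:Z) r) *: G (i + r)%N t).
  apply: eq_bigr => i _.
  rewrite -(sum_antidiagonal (H := fun r t => (xmy l i * binomz (m + l - i%:Z) r) *: G (i + r)%N t)).
    rewrite (expL_nat _ (N := N)) => [|t Nt]; last by rewrite f0'// (leq_trans Nt)// leq_addl.
    rewrite linear_sum scaler_sumr; apply: eq_bigr => k _.
    rewrite linearZ/= Y_iterL !scaler_sumr; apply: eq_bigr => r _.
    have rk : (r <= k)%N by rewrite -ltnS ltn_ord.
    rewrite /G !scalerA -!addnA subnKC//.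
    have -> : m + l - i%:Z - r%:Z = m + l - (i + r)%:Z by lia.
    have -> : a - (i + k)%:R = a - i%:R - k%:R by rewrite natrD opprD addrA.
    congr (_ *: _); rewrite /binomz -/(ffz _ _) -(bin_fact rk) !natrM exprD.
    have := fact_neq0 (R := R) r; have := fact_neq0 (R := R) (k - r).
    have : 'C(k, r)%:R != 0 :> C by rewrite pnatr_eq0 -lt0n bin_gt0.
    by move=> h1 h2 h3; field; rewrite h1 h2 h3.
  move=> r t Nrt; by rewrite G0 ?scaler0// -addnA (leq_trans Nrt)// leq_addl.
under eq_bigr do rewrite exchange_big/=.
rewrite exchange_big; apply: eq_bigr => t _ /=.
rewrite (sum_triangle (H := fun i r => (xmy l i * binomz (m + l - i%:Z) r) *: G (i + r)%N t)); last first.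
  by move=> i r Nir; rewrite G0 ?scaler0// (leq_trans Nir)// leq_addr.
rewrite (lin_sum (iterL_linear _)) scaler_sumr; apply: eq_bigr => s _.
rewrite (linZ (iterL_linear _)) scalerA.
transitivity ((\sum_(i < s.+1) xmy l i * binomz (m + l - i%:Z) (s - i)) *: G s t).
  rewrite scaler_suml; apply: eq_bigr => i _; rewrite subnKC// -ltnS; exact: ltn_ord.
rewrite binomz_vandermonde addrK /G scalerA.
have -> : a - (s + t)%:R = a - t%:R - s%:R by rewrite natrD; ring.
by congr (_ *: _); rewrite exprD; ring.
Qed.

Context {W1 W2 W3 : gmod} {z : C} {I : W1 -> W2 -> C -> W3}.
Hypothesis Iint : intertwining_map z I.
Hypothesis z0 : z != 0.

(** I places w1 at z and w2 at 0; translation by - z places w2 at - z and w1 at 0. *)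
Definition skew_map (w2 : W2) (w1 : W1) : C -> W3 := expL (- z) (I w1 w2).

Let Itr w1 w2 : lower_trunc (I w1 w2). Proof. exact: (pz_trunc Iint). Qed.
Let Ic w1 w2 : in_completion (I w1 w2). Proof. exact: (pz_completion Iint). Qed.
Let l1 := pz_linear1 Iint.
Let l2 := pz_linear2 Iint.

Lemma skew_completion w2 w1 : in_completion (skew_map w2 w1).
Proof. exact/expL_completion/Ic. Qed.

Lemma skew_linear1 w1 n : linear (fun w2 => skew_map w2 w1 n).
Proof.
move=> a u v; rewrite /skew_map -expLP//; congr (expL _ _ n).
by apply/funext => k; rewrite (l2 _ _ a).
Qed.

Lemma skew_linear2 w2 n : linear (fun w1 => skew_map w2 w1 n).
Proof.
move=> a u v; rewrite /skew_map -expLP//; congr (expL _ _ n).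
by apply/funext => k; rewrite (l1 _ _ a).
Qed.

Lemma skew_ch b c w2 w1 n : homog (gm_ch W2) b w2 -> homog (gm_ch W1) c w1 ->
  homog (gm_ch W3) (b + c) (skew_map w2 w1 n).
Proof.
move=> w2b w1c; apply: homog_sum => j; apply: homogZ; apply: ch_iterL.
by rewrite addrC; exact: (pz_ch Iint).
Qed.

Lemma skew_trunc w2 w1 n : exists N : nat, forall m : nat, (N <= m)%N ->
  skew_map w2 w1 (n - m%:R) = 0.
Proof. exact/expL_trunc/Itr. Qed.

(** Conjugating L(j) by e^(- z L(-1)) adds multiples of lower L(i). Through the brackets of I these
    cancel the terms in z at [w1] and create the terms in - z at [w2]. *)
Lemma skew_Lbracket j w2 w1 n : is_j j ->
  ext (Lop (gm_L W3) j) (skew_map w2 w1) n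
  = skew_map w2 (Lop (gm_L W1) j w1) n
    + \sum_(i < (absz (j + 1)).+1)
        ('C(absz (j + 1), i)%:R * (- z) ^+ i) *:
          skew_map (Lop (gm_L W2) (j - i%:Z) w2) w1 n.
Proof.
move=> ij; rewrite ext_L//; last exact: skew_completion.
have hN n' : Lneg1 (gm_L W3) (I w1 w2 (n' - 1)) =
    I w1 (Lneg1 (gm_L W2) w2) n' + I (Lneg1 (gm_L W1) w1) w2 n'.
  have := pz_Lbracket Iint w1 w2 n' is_jN1; rewrite ext_L ?is_jN1//; last exact: is_jN1.
  by rewrite !LopN1 big_ord_recl big_ord0 addr0 expr0 mulr1 scale1r.
have h0 n' : Lzero (gm_L W3) (I w1 w2 n') =
    I w1 (Lzero (gm_L W2) w2) n' + (I (Lzero (gm_L W1) w1) w2 n'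
      + z *: I (Lneg1 (gm_L W1) w1) w2 n').
  have := pz_Lbracket Iint w1 w2 n' is_j0; rewrite ext_L//; last exact: is_j0.
  rewrite !big_ord_recl big_ord0 !addr0 expr0 !mul1r scale1r => e; exact: e.
have h1 n' : Lone (gm_L W3) (I w1 w2 (n' + 1)) =
    I w1 (Lone (gm_L W2) w2) n' + (I (Lone (gm_L W1) w1) w2 n'
      + ((2 * z) *: I (Lzero (gm_L W1) w1) w2 n' + z ^+ 2 *: I (Lneg1 (gm_L W1) w1) w2 n')).
  have := pz_Lbracket Iint w1 w2 n' is_j1; rewrite ext_L//; last exact: is_j1.
  rewrite !big_ord_recl big_ord0 !addr0 expr0 !mul1r scale1r => e.
  exact: e.
have tZ a w w' : lower_trunc (fun k => a *: I w w' k).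
  by have := lower_truncP a (Itr w w') lower_trunc0; congr lower_trunc; apply/funext => k; rewrite addr0.
have tD f g : lower_trunc f -> lower_trunc g -> lower_trunc (fun k : C => f k + g k : W3).
  move=> tf tg; have := lower_truncP 1 tf tg; congr lower_trunc.
  by apply/funext => k; rewrite scale1r.
have EN : expL (- z) (fun k => Lneg1 (gm_L W3) (I w1 w2 (k - 1))) n
    = skew_map (Lneg1 (gm_L W2) w2) w1 n + skew_map w2 (Lneg1 (gm_L W1) w1) n.
  by rewrite -expLD//; congr (expL _ _ n); apply/funext => k; exact: hN.
have E0 : expL (- z) (fun k => Lzero (gm_L W3) (I w1 w2 k)) n
    = skew_map (Lzero (gm_L W2) w2) w1 n + (skew_map w2 (Lzero (gm_L W1) w1) n
      + z *: skew_map w2 (Lneg1 (gm_L W1) w1) n).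
  rewrite -expLZ// -!expLD//; last by apply: tD.
  by congr (expL _ _ n); apply/funext => k; exact: h0.
have E1 : expL (- z) (fun k => Lone (gm_L W3) (I w1 w2 (k + 1))) n
    = skew_map (Lone (gm_L W2) w2) w1 n + (skew_map w2 (Lone (gm_L W1) w1) n
      + ((2 * z) *: skew_map w2 (Lzero (gm_L W1) w1) n
         + z ^+ 2 *: skew_map w2 (Lneg1 (gm_L W1) w1) n)).
  rewrite /skew_map -!expLZ// -expLD; [|exact: tZ|exact: tZ].
  rewrite -expLD; [|exact: Itr|exact: tD (tZ _ _ _) (tZ _ _ _)].
  rewrite -expLD; [|exact: Itr|exact: tD (Itr _ _) (tD _ _ (tZ _ _ _) (tZ _ _ _))].
  by congr (expL _ _ n); apply/funext => k; exact: h1.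
case: ij => ->.
- by rewrite !LopN1 Lneg1_expL// EN big_ord_recl big_ord0 addr0 expr0 mulr1 scale1r addrC.
- rewrite addr0 !Lop0 Lzero_expL// EN E0 !big_ord_recl big_ord0 addr0 !expr0 !mulr1 !scale1r.
  rewrite -[Lop _ (0 - _) w2]/(Lneg1 (gm_L W2) w2) -[Lop _ _ w2]/(Lzero (gm_L W2) w2).
  rewrite expr1 mul1r; lmod (R[i]) W3.
- rewrite !Lop1 Lone_expL// EN E0 E1 !big_ord_recl big_ord0 addr0 !expr0 !mulr1 !scale1r.
  rewrite -[Lop _ (1 - (lift _ (lift _ _))%:Z) w2]/(Lneg1 (gm_L W2) w2).
  rewrite -[Lop _ (1 - (lift _ _)%:Z) w2]/(Lzero (gm_L W2) w2) -[Lop _ _ w2]/(Lone (gm_L W2) w2).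
  rewrite -['C(_, lift _ (lift _ _))%:R * _]/(1 * (- z) ^+ 2).
  rewrite -['C(_, lift _ _)%:R * _]/(2 * (- z)); lmod (R[i]) W3.
Qed.

Section Jacobi.
Context (l m : int) (n : C) (w1 : W1) (w2 : W2).

Let fA v i : W3 := (xmy l i * (- z) ^+ i) *: ext (gm_Y W3 v (m + l - i%:Z)) (skew_map w2 w1) n.
Let fB v i : W3 := (xmy (i%:Z - m - 1) i * (- z) ^ (m - i%:Z)) *:
         skew_map (gm_Y W2 v (l + i%:Z) w2) w1 n.
Let fC v i : W3 := (xmy l i * (- z) ^ (l - i%:Z)) *: skew_map w2 (gm_Y W1 v (m + i%:Z) w1) n.

(** The finite supports belong to the statement because with them it is additive in [v], which
    reduces it to homogeneous [v]. *)
Let jac v := [/\ fsup (fA v), fsup (fB v), fsup (fC v) &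
  \sum_(i \in [set: nat]) fA v i = \sum_(i \in [set: nat]) fB v i
    + (-1) ^ l *: \sum_(i \in [set: nat]) fC v i].

Let fsup_bound (F : nat -> W3) M : (forall i, (M <= i)%N -> F i = 0) -> fsup F.
Proof.
move=> F0; exists (seq.iota 0 M) => i; rewrite mem_iota add0n /= -leqNgt; exact: F0.
Qed.

(** [expL_Y] with c = - z carries the left-hand side to e^(- z L(-1)) applied to that of the Jacobi
    identity of I with l and m exchanged. The exchange swaps the two terms on the right, just as the
    two vectors are swapped. *)
Let jac_homog d v : homog (va_wt V) d v -> jac v.
Proof.
move=> vd; pose a := n - d%:~R + (m + l)%:~R + 1.
have [MB hB] := gm_trunc (g := W2) v w2.
have [MC hC] := gm_trunc (g := W1) v w1.
have [N Nf] := Itr w1 w2 a.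
have ZB i : (absz (MB - l) <= i)%N -> gm_Y W2 v (l + i%:Z) w2 = 0 by move=> ?; apply: hB; lia.
have ZC i : (absz (MC - m) <= i)%N -> gm_Y W1 v (m + i%:Z) w1 = 0 by move=> ?; apply: hC; lia.
have ZA i : (N <= i)%N -> skew_map w2 w1 (a - i%:R) = 0.
  move=> Ni; rewrite /skew_map (expL_nat _ (N := 0)) ?big_ord0// => k _.
  by rewrite -addrA -opprD -natrD Nf// (leq_trans Ni)// leq_addr.
have AE i : fA v i = (xmy l i * (- z) ^+ i) *: gm_Y W3 v (m + l - i%:Z) (skew_map w2 w1 (a - i%:R)).
  rewrite /fA (ext_Y _ _ vd (skew_completion _ _)); congr (_ *: gm_Y W3 v _ (skew_map _ _ _)).
  by rewrite /a rmorphB/=; ring.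
have A0 i : (N <= i)%N -> fA v i = 0 by move=> /ZA e; rewrite AE e linear0 scaler0.
have B0 i : (absz (MB - l) <= i)%N -> fB v i = 0.
  by move=> /ZB e; rewrite /fB e (lin0 (skew_linear1 _ _)) scaler0.
have C0 i : (absz (MC - m) <= i)%N -> fC v i = 0.
  by move=> /ZC e; rewrite /fC e (lin0 (skew_linear2 _ _)) scaler0.
split; [exact: fsup_bound A0|exact: fsup_bound B0|exact: fsup_bound C0|].
rewrite (fsum_nat A0) (fsum_nat B0) (fsum_nat C0).
rewrite (eq_bigr _ (fun (i : 'I_N) _ => AE i)) /skew_map expL_Y//.
pose kB := absz (MB - l); pose kC := absz (MC - m).
pose cB (i : nat) := (-1) ^ m * (xmy m i * z ^ (m - i%:Z)).
pose cC (i : nat) := xmy (i%:Z - l - 1) i * z ^ (l - i%:Z).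
pose g k := \sum_(i < kC) cC i *: I (gm_Y W1 v (m + i%:Z) w1) w2 k
  + \sum_(i < kB) cB i *: I w1 (gm_Y W2 v (l + i%:Z) w2) k.
have gE t : \sum_(s < N) (binomz m s * (- z) ^+ s) *:
    gm_Y W3 v (m + l - s%:Z) (I w1 w2 (a - t%:R - s%:R)) = g (n - t%:R).
  have := pz_jacobi Iint v w1 w2 m l (n - t%:R).
  rewrite (fsum_nat (n := N)); last first.
    move=> i Ni; rewrite (ext_Y _ _ vd (Ic _ _)) (_ : _ + 1 = a - (t + i)%:R).
      by rewrite Nf ?linear0 ?scaler0// (leq_trans Ni)// leq_addl.
    by rewrite /a natrD !rmorphB !rmorphD/=; ring.
  rewrite (fsum_nat (n := kC)); last by move=> i /ZC ->; rewrite (lin0 (l1 _ _)) scaler0.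
  rewrite (fsum_nat (n := kB)); last by move=> i /ZB ->; rewrite (lin0 (l2 _ _)) scaler0.
  move=> e; rewrite /g; transitivity (\sum_(i < N) (xmy m i * z ^+ i) *:
      ext (gm_Y W3 v (l + m - i%:Z)) (I w1 w2) (n - t%:R)).
    apply: eq_bigr => i _; rewrite (ext_Y _ _ vd (Ic _ _)) (addrC l m).
    congr (_ *: gm_Y W3 v _ (I _ _ _)); last by rewrite /a !rmorphB !rmorphD/=; ring.
    by rewrite exprNn /xmy; ring.
  rewrite e scaler_sumr; congr (_ + _); apply: eq_bigr => i _.
  by rewrite scalerA.
under eq_bigr do rewrite gE.
rewrite -(expL_nat (- z) (f := g)); last first.
  move=> t Nt; rewrite -gE big1// => i _.
  have -> : a - t%:R - i%:R = a - (t + i)%:R by rewrite natrD opprD addrA.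
  by rewrite Nf ?linear0 ?scaler0// (leq_trans Nt)// leq_addr.
have tC : lower_trunc (fun k => \sum_(i < kC) cC i *: I (gm_Y W1 v (m + i%:Z) w1) w2 k).
  by apply: (@lower_trunc_sum _ _ _ _ _ _ _ _ (fun i k => I (gm_Y W1 v (m + i%:Z) w1) w2 k)) => i; exact: Itr.
have tB : lower_trunc (fun k => \sum_(i < kB) cB i *: I w1 (gm_Y W2 v (l + i%:Z) w2) k).
  by apply: (@lower_trunc_sum _ _ _ _ _ _ _ _ (fun i k => I w1 (gm_Y W2 v (l + i%:Z) w2) k)) => i; exact: Itr.
rewrite /g expLD//.
rewrite (@expL_sum _ _ _ _ _ _ _ _ _ (fun i k => I (gm_Y W1 v (m + i%:Z) w1) w2 k)); last by move=> i; exact: Itr.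
rewrite (@expL_sum _ _ _ _ _ _ _ _ _ (fun i k => I w1 (gm_Y W2 v (l + i%:Z) w2) k)); last by move=> i; exact: Itr.
have Nz (p : int) : (- z) ^ p = (-1) ^ p * z ^ p by rewrite -[- z]mulN1r expfzMl.
have s1 (p : int) (i : nat) : (-1) ^ (p - i%:Z) = (-1) ^ p * (-1) ^+ i :> C.
  rewrite expfzDr ?oppr_eq0 ?oner_eq0// -exprz_inv invrN1.
  by [].
have s2 (p : int) : (-1) ^ p * (-1) ^ p = 1 :> C.
  by rewrite -expfzMl mulrNN mulr1 exp1rz.
rewrite [LHS]addrC; congr (_ + _).
  apply: eq_bigr => i _; rewrite /fB; congr (_ *: _).
  by rewrite /cB xmy_opp Nz s1 /xmy; ring.
rewrite scaler_sumr; apply: eq_bigr => i _; rewrite /fC scalerA; congr (_ *: _).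
rewrite /cC xmy_opp Nz s1.
transitivity ((-1) ^ l * (-1) ^ l * ((-1) ^+ i * (-1) ^+ i) * (binomz l i * z ^ (l - i%:Z))).
  by rewrite s2 -expr2 sqrr_sign !mul1r.
by rewrite /xmy; ring.
Qed.

Lemma skew_jac v : jac v.
Proof.
move: v; apply: (grading_ind (g := va_wt V)); last exact: jac_homog.
- apply: (jac_homog (d := 0)); exact: homog0.
move=> u v [uA uB uC uE] [vA vB vC vE].
have eA i : fA (u + v) i = fA u i + fA v i.
  by rewrite /fA ext_YDv ?scalerDr//; exact: skew_completion.
have eB i : fB (u + v) i = fB u i + fB v i.
  by rewrite /fB (linD (gm_Y_linear _ _)) (linD (skew_linear1 _ _)) scalerDr.
have eC i : fC (u + v) i = fC u i + fC v i.
  by rewrite /fC (linD (gm_Y_linear _ _)) (linD (skew_linear2 _ _)) scalerDr.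
rewrite /jac (funext eA) (funext eB) (funext eC).
split; try exact: fsupD.
have key (x y b c b' c' : W3) (e : C) : x = b + e *: c -> y = b' + e *: c' ->
    x + y = (b + b') + e *: (c + c') by move=> -> ->; rewrite scalerDr addrACA.
rewrite (fsumD uA vA) (fsumD uB vB) (fsumD uC vC); exact: key uE vE.
Qed.

End Jacobi.

Lemma skew_intertwining : intertwining_map (- z) skew_map.
Proof.
split.
- exact: skew_completion.
- exact: skew_linear1.
- exact: skew_linear2.
- exact: skew_ch.
- exact: skew_trunc.
- by move=> v w2 w1 l m n; have [_ _ _] := skew_jac l m n w1 w2 v.
- by move=> j w2 w1 n; exact: skew_Lbracket.
Qed.

Lemma skew_inv w1 w2 n : I w1 w2 n = expL z (skew_map w2 w1) n.
Proof. by rewrite /skew_map expL_inv. Qed.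

End SkewSymmetry.

(** * The two series *)

(** [psi] has to invert [phi] only on the support of [G]. In the derivative of a power of log x,
    lowering k fails at k = 0, where the coefficient k vanishes. *)
Lemma fsum_reindex (I J : choiceType) (M : zmodType) (phi : I -> J) (psi : J -> I)
    (G : J -> M) : cancel phi psi -> (forall j, G j != 0 -> phi (psi j) = j) -> fsup G ->
  \sum_(i \in [set: I]) G (phi i) = \sum_(j \in [set: J]) G j.
Proof.
move=> pK Gr /fsup_uniq[s us G0].
have pi : injective phi := can_inj pK.
pose t := [seq psi j | j <- s & G j != 0].
have tE : [seq phi i | i <- t] = [seq j <- s | G j != 0].
  rewrite -map_comp -[RHS]map_id; apply/eq_in_map => j.
  by rewrite mem_filter => /andP[/Gr].
rewrite (fsum_seq (s := t)); last first.
- move=> i it; apply/eqP; apply: contraNT it => Gi; apply/mapP; exists (phi i); last by rewrite pK.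
  by rewrite mem_filter Gi; apply: contraNT Gi => /G0 ->.
- by rewrite -(map_inj_uniq pi) tE filter_uniq.
rewrite (fsum_seq us)// -(big_map phi xpredT G) tE big_filter big_mkcond.
by apply: eq_bigr => j _; case: eqVneq.
Qed.

Lemma fsum_sum (I : choiceType) (M : zmodType) (K : Type) (r : seq K) (F : K -> I -> M) :
  (forall k, fsup (F k)) ->
  fsup (fun i => \sum_(k <- r) F k i) /\
  \sum_(i \in [set: I]) \sum_(k <- r) F k i = \sum_(k <- r) \sum_(i \in [set: I]) F k i.
Proof.
move=> sF; elim: r => [|k r [IH1 IH2]].
  split; first by exists [::] => i _; rewrite big_nil.
  rewrite big_nil -[RHS](@fsum0 I M); apply: fsum_ext => i; exact: big_nil.
split.
  by have := fsupD (sF k) IH1; congr fsup; apply/funext => i; rewrite big_cons.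
rewrite big_cons -IH2 -fsumD//; apply: fsum_ext => i; exact: big_cons.
Qed.

(** * Transposing e^(c L(-1)) to the graded dual *)

Section DualExp.
Context {R : realType} {A At : zmodType} {emb : {additive A -> At}}.
Context {V : vertex_algebra R A} {W : gmodule emb V}.
Local Notation C := R[i].
Local Notation L := (Lneg1 (gm_L W)).

(** The transpose of e^(c L(-1)), cut off at N; on a graded dual vector nothing is lost for large N,
    by [dual_iterL_nil]. *)
Definition expL_dual (f : {scalar W}) (c : C) (N : nat) (w : W) : C :=
  \sum_(j < N) c ^+ j / j`!%:R * f (iter j L w).

Lemma expL_dual_scalar f c N : scalar (expL_dual f c N).
Proof.
move=> a u v; rewrite /expL_dual mulr_sumr -big_split; apply: eq_bigr => j _ /=.
by rewrite (iterL_linear _ a) (scP f); ring.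
Qed.

HB.instance Definition _ f c N :=
  GRing.isLinear.Build C W C *%R (expL_dual f c N) (expL_dual_scalar f c N).

Lemma expL_dual_graded f c N : graded_dual f -> graded_dual (expL_dual f c N : {scalar W}).
Proof.
move=> /graded_dual_sum[s us fE].
apply: (graded_dualP (s := [seq (bn.1, bn.2 - (j : nat)%:R) | bn <- s, j <- seq.iota 0 N])).
move=> b n w wb wn bns; rewrite -[LHS]/(expL_dual f c N w) /expL_dual big1// => j _.
rewrite fE big_seq big1 ?mulr0// => -[b' n'] bn' /=.
have [n'E|n'E] := eqVneq n' (n + (j : nat)%:R); last first.
  by rewrite (proj_homog0 (weight_iterL j wn) n'E) linear0 (sc0 (scP f)).
have [b'E|b'E] := eqVneq b' b; last first.
  by rewrite n'E (proj_homog (weight_iterL j wn)) (proj_homog0 (ch_iterL j wb) b'E) (sc0 (scP f)).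
case/negP: bns; apply/allpairsP; exists ((b', n'), (j : nat)); split => //=.
  by rewrite mem_iota/= add0n.
by rewrite b'E n'E addrK.
Qed.

Lemma bounded_seq (s : seq (At * C)) : exists N : nat, forall b n, (b, n) \in s ->
  forall j : nat, (N <= j)%N -> forall w, homog (gm_ch W) b w ->
    homog (gm_wt W) (n - j%:R) w -> w = 0.
Proof.
elim: s => [|[b0 n0] s [N NE]]; first by exists 0%N.
have [M ME] := @gm_bounded _ _ _ _ _ W b0 n0.
exists (maxn N (absz M).+1) => b n; rewrite inE => /orP[/eqP[-> ->]|bns] j; last first.
  by rewrite geq_max => /andP[Nj _]; exact: NE bns j Nj.
rewrite geq_max => /andP[_ Mj] w wb wn.
have Mlt : - j%:Z < M by lia.
by apply: (ME (- j%:Z) Mlt w); split => //; rewrite rmorphN.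
Qed.

(** The functional sees finitely many bidegrees (b, n). Through L(-1)^j it reaches them only from
    vectors of bidegree (b, n - j), and these are 0 for large j. *)
Lemma dual_iterL_nil (f : {scalar W}) : graded_dual f ->
  exists N : nat, forall j : nat, (N <= j)%N -> forall w, f (iter j L w) = 0.
Proof.
move=> /graded_dual_sum[s us fE]; have [N NE] := bounded_seq s.
exists N => j Nj; apply: bigrading_ind.
- by rewrite (lin0 (iterL_linear _)) (sc0 (scP f)).
- by move=> u v u0 v0; rewrite (linD (iterL_linear _)) (scD (scP f)) u0 v0 addr0.
move=> b n w wb wn; rewrite fE big_seq big1// => -[b' n'] bns /=.
have [n'E|n'E] := eqVneq n' (n + j%:R); last first.
  by rewrite (proj_homog0 (weight_iterL j wn) n'E) linear0 (sc0 (scP f)).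
have [b'E|b'E] := eqVneq b' b; last first.
  by rewrite n'E (proj_homog (weight_iterL j wn)) (proj_homog0 (ch_iterL j wb) b'E) (sc0 (scP f)).
have -> : w = 0 by apply: (NE b' n' bns j Nj); rewrite ?b'E// n'E addrK.
by rewrite (lin0 (iterL_linear _)) !linear0.
Qed.

(** [g] has to be found before [h]: it is the one functional to which the convergence condition is
    applied, while [h] varies with the summation index. *)
Lemma pairing_expL (f : {scalar W}) c : graded_dual f -> exists2 g : {scalar W},
  graded_dual g & forall h : C -> W, in_completion h -> lower_trunc h ->
    pairing f (expL c h) = pairing g h.
Proof.
move=> df; have [N NE] := dual_iterL_nil df; exists (expL_dual f c N).
  exact: expL_dual_graded.
have [s sE] := graded_dual_completion df.
move=> h ch th; pose F j n := c ^+ j / j`!%:R * f (iter j L (h n)).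
have F0 j n : n + j%:R \notin s -> F j n = 0.
  by move=> ns; rewrite /F (sE _ _ (weight_iterL j (ch n)) ns) mulr0.
have sF (j : nat) : fsup (F j).
  exists [seq x - j%:R | x <- s] => n ns; apply: F0; apply: contra ns => ns.
  by apply/mapP; exists (n + j%:R) => //; rewrite addrK.
have sF' (j : nat) : fsup (fun n => F j (n - j%:R)).
  by exists s => n ns; apply: F0; rewrite subrK.
transitivity (\sum_(n \in [set: C]) \sum_(j <- index_enum 'I_N) F j (n - (j : nat)%:R)).
  apply: fsum_ext => n; have [M M0] := th n.
  rewrite (expL_nat c (N := maxn N M)); last by move=> m; rewrite geq_max => /andP[_ /M0].
  rewrite (sc_sum (scP f)) -(big_mkord xpredT (fun j => f ((c ^+ j / j`!%:R) *: iter j L (h (n - j%:R))))).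
  rewrite (big_cat_nat (n := N)) ?leq_maxl//= big_mkord.
  rewrite [X in _ + X]big_nat_cond [X in _ + X]big1 ?addr0 => [|j]; last first.
    by rewrite andbT => /andP[Nj _]; rewrite (scZ (scP f)) NE// mulr0.
  by apply: eq_bigr => j _; rewrite (scZ (scP f)).
rewrite (fsum_sum _ (fun j : 'I_N => sF' j)).2.
transitivity (\sum_(n \in [set: C]) \sum_(j <- index_enum 'I_N) F j n); last by [].
rewrite (fsum_sum _ (fun j : 'I_N => sF j)).2; apply: eq_bigr => j _.
apply: (fsum_reindex (phi := fun n => n - (j : nat)%:R) (psi := fun n => n + (j : nat)%:R)).
- by move=> n; rewrite subrK.
- by move=> n _; rewrite addrK.
- exact: sF.
Qed.

End DualExp.

(* Skew symmetry turns an iterate into a product, with W3 and M2 exchanged and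
   e^(z2 L(-1)) moved to the graded dual of W4. *)
Lemma convergence_iterate (R : realType) (A At : zmodType) (emb : {additive A -> At})
    (V : vertex_algebra R A) (cat : gmodule emb V -> Prop) :
  convergence_condition cat ->
  forall W1 W2 W3 W4 M2 : gmodule emb V,
    cat W1 -> cat W2 -> cat W3 -> cat W4 -> cat M2 ->
  forall z0 z2 : R[i], `|z2| > `|z0| -> `|z0| > 0 ->
  forall (I1 : M2 -> W3 -> R[i] -> W4) (I2 : W1 -> W2 -> R[i] -> M2),
    intertwining_map z2 I1 -> intertwining_map z0 I2 ->
  forall (w1 : W1) (w2 : W2) (w3 : W3) (w4' : {scalar W4}), graded_dual w4' ->
    abs_cvg (fun n : R[i] => pairing w4' (I1 (I2 w1 w2 n) w3)).
Proof.
move=> cc W1 W2 W3 W4 M2 c1 c2 c3 c4 cM z0 z2 z02 z00 I1 I2 I1i I2i w1 w2 w3 w4' d4.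
have z20 : z2 != 0 by rewrite -normr_gt0; exact: lt_trans z02.
have Ji := skew_intertwining I1i z20.
have [g dg gE] := pairing_expL z2 d4.
have Nz : `|z0| < `|- z2| by rewrite normrN.
have := cc W3 W1 W2 W4 M2 c3 c1 c2 c4 cM _ _ Nz z00 _ _ Ji I2i w3 w1 w2 g dg.
congr abs_cvg; apply/funext => n.
rewrite -gE; [|exact: skew_completion|exact: skew_trunc].
by congr pairing; apply/funext => k; rewrite -(skew_inv I1i).
Qed.

(** * Finite sums of monomials and their derivatives *)

Section Monomials.
Context {R : realType}.
Local Notation C := R[i].
Local Notation T := ((C * nat) * (C * nat))%type.

Lemma mono_derive (N : C) k s :
  is_derive (s : R[i]^o) 1 ((fun s => mono (N, k) s) : R[i]^o -> R[i]^o)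
    ((- N - 1) * mono (N, k) s + k%:R * mono (N, k.-1) s).
Proof.
have dX : is_derive (s : R[i]^o) 1 ((fun s => s ^+ k) : R[i]^o -> R[i]^o) (k%:R * s ^+ k.-1).
  elim: k => [|k IH].
    by rewrite mul0r; exact: is_derive_cst.
  have := is_deriveM (is_derive_id (s : R[i]^o) 1) IH; congr is_derive.
    by apply/funext => x; exact: (esym (exprS x k)).
  transitivity (s * (k%:R * s ^+ k.-1) + s ^+ k * 1) => //.
  by case: k {IH} => [|k]; rewrite ?mul0r ?mulr0 ?add0r ?mulr1 ?mul1r//= mulrCA -exprS -[X in _ + X]mul1r -mulrDl natr1.
have dE : is_derive (s : R[i]^o) 1 ((fun s => cexp ((- N - 1) * s)) : R[i]^o -> R[i]^o)
    (cexp ((- N - 1) * s) * (- N - 1)).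
  have := @is_derive_chain R[i] (@cexp R) (fun z => 0 + (- N - 1) * z) s _ _
    (cexp_derive (0 + (- N - 1) * s)) (is_derive_affine 0 (- N - 1) s).
  have z0 (u : C) : 0 + u = u by exact: add0r.
  congr is_derive; last by rewrite z0.
  by apply/funext => x; rewrite /comp z0.
have := is_deriveM dE dX; congr is_derive.
transitivity (cexp ((- N - 1) * s) * (k%:R * s ^+ k.-1) + s ^+ k * (cexp ((- N - 1) * s) * (- N - 1))) => //.
by rewrite /mono/=; ring.
Qed.

Lemma cexp_mono (N : C) k s : cexp s * mono (N, k) s = mono (N - 1, k) s.
Proof. by rewrite /mono/= mulrA -cexpD; congr (cexp _ * _); ring. Qed.

(** The coefficients form a function on all exponents and powers, so that the L(-1)-derivative
    property becomes an equality of coefficients. *)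
Definition monosum (c : T -> C) (s1 s2 : C) : C :=
  \sum_(t \in [set: T]) c t * mono t.1 s1 * mono t.2 s2.

(* The coefficients of the derivatives with respect to e^(s_1) and e^(s_2). *)
Definition dcoef1 (c : T -> C) (t : T) : C :=
  - t.1.1 * c ((t.1.1 - 1, t.1.2), t.2) + t.1.2.+1%:R * c ((t.1.1 - 1, t.1.2.+1), t.2).

Definition dcoef2 (c : T -> C) (t : T) : C :=
  - t.2.1 * c (t.1, (t.2.1 - 1, t.2.2)) + t.2.2.+1%:R * c (t.1, (t.2.1 - 1, t.2.2.+1)).

Lemma fsupMl (I : choiceType) (c d : I -> C) : fsup c -> fsup (fun t => c t * d t).
Proof. by move=> [s c0]; exists s => t /c0 ->; rewrite mul0r. Qed.

Lemma der1_fsum (f : T -> C -> C -> C) (d : T -> C) (r : seq T) a b :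
  (forall t, der1 (f t) a b (d t)) ->
  der1 (fun x y => \sum_(t <- r) f t x y) a b (\sum_(t <- r) d t).
Proof.
move=> df; elim: r => [|t r IH].
  rewrite big_nil; have -> : (fun x y => \sum_(t <- [::]) f t x y) = fun _ _ => 0.
    by apply/funext => x; apply/funext => y; rewrite big_nil.
  exact: is_derive_cst.
rewrite big_cons.
have -> : (fun x y => \sum_(t <- t :: r) f t x y) =
    fun x y => f t x y + \sum_(t <- r) f t x y.
  by apply/funext => x; apply/funext => y; rewrite big_cons.
exact: der1D.
Qed.

(** Since x = e^s, the derivative in s is e^s times that in x, and [cexp_mono] absorbs e^s into a
    shift of the exponent by one. *)
Lemma monosum_der1 c a b : fsup c ->
  der1 (monosum c) a b (cexp a * monosum (dcoef1 c) a b).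
Proof.
move=> sc; have [s us c0] := fsup_uniq sc.
pose m' (t : T) := (- t.1.1 - 1) * mono t.1 a + t.1.2%:R * mono (t.1.1, t.1.2.-1) a.
have dm t : der1 (fun x y => c t * mono t.1 x * mono t.2 y) a b (c t * m' t * mono t.2 b).
  have := mono_derive t.1.1 t.1.2 a.
  move=> /(is_deriveM (is_derive_cst (c t * mono t.2 b : R[i]^o) _ _)).
  congr is_derive.
    apply/funext => x; transitivity (c t * mono t.2 b * mono (t.1.1, t.1.2) x) => //.
    by rewrite -surjective_pairing mulrAC.
  transitivity (c t * mono t.2 b * ((- t.1.1 - 1) * mono (t.1.1, t.1.2) a
       + t.1.2%:R * mono (t.1.1, t.1.2.-1) a) + mono (t.1.1, t.1.2) a * 0) => //.
  by rewrite -surjective_pairing mulr0 addr0 /m'; ring.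
have := der1_fsum s dm; rewrite /monosum.
have -> : (fun x y => \sum_(t <- s) c t * mono t.1 x * mono t.2 y) =
   fun x y => \sum_(t \in [set: T]) c t * mono t.1 x * mono t.2 y.
  apply/funext => x; apply/funext => y; rewrite (fsum_seq us)// => t /c0 ->.
  by rewrite !mul0r.
congr der1; rewrite -(fsum_seq us); last by move=> t /c0 ->; rewrite !mul0r.
(* [GA] comes from differentiating the power of x and [GB] from differentiating that of log x; each
   is then reindexed to the monomial to which it contributes. *)
pose GA (t : T) := c t * ((- t.1.1 - 1) * mono t.1 a) * mono t.2 b.
pose GB (t : T) := c t * (t.1.2%:R * mono (t.1.1, t.1.2.-1) a) * mono t.2 b.
have sA : fsup GA by exists s => t /c0; rewrite /GA => ->; rewrite !mul0r.
have sB : fsup GB by exists s => t /c0; rewrite /GB => ->; rewrite !mul0r.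
pose pA (t : T) : T := ((t.1.1 - 1, t.1.2), t.2).
pose pB (t : T) : T := ((t.1.1 - 1, t.1.2.+1), t.2).
pose qA (t : T) : T := ((t.1.1 + 1, t.1.2), t.2).
pose qB (t : T) : T := ((t.1.1 + 1, t.1.2.-1), t.2).
have pAK : cancel pA qA by move=> [[N k] t]; rewrite /pA /qA /= subrK.
have qAK : cancel qA pA by move=> [[N k] t]; rewrite /pA /qA /= addrK.
have pBK : cancel pB qB by move=> [[N k] t]; rewrite /pB /qB /= subrK.
have qBK t : GB t != 0 -> pB (qB t) = t.
  case: t => [[N [|k]] t]; rewrite /GB /pB /qB /= ?addrK//.
  by rewrite mul0r mulr0 mul0r eqxx.
transitivity (\sum_(t \in [set: T]) GA t + \sum_(t \in [set: T]) GB t).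
  rewrite -fsumD//; apply: fsum_ext => t; rewrite /m' /GA /GB; ring.
rewrite -(fsum_reindex pAK (fun t _ => qAK t) sA) -(fsum_reindex pBK qBK sB).
rewrite -fsumD; last 2 first.
- case: sA => s' h; exists (map qA s') => t ts; apply: h; apply: contra ts => ts.
  by apply/mapP; exists (pA t) => //; rewrite pAK.
- case: sB => s' h; exists (map qB s') => t ts; apply: h; apply: contra ts => ts.
  by apply/mapP; exists (pB t) => //; rewrite pBK.
have sD : fsup (fun t => dcoef1 c t * mono t.1 a * mono t.2 b).
  exists (map qA s ++ map qB s) => t; rewrite mem_cat negb_or => /andP[tA tB].
  rewrite /dcoef1 -/(pA t) -/(pB t) !c0 ?mulr0 ?addr0 ?mul0r//.
    by apply: contra tB => tB; apply/mapP; exists (pB t) => //; rewrite pBK.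
  by apply: contra tA => tA; apply/mapP; exists (pA t) => //; rewrite pAK.
transitivity (\sum_(t \in [set: T]) cexp a *: (dcoef1 c t * mono t.1 a * mono t.2 b : R[i]^o)).
  apply: fsum_ext => -[[N k] t].
  rewrite -[RHS]/(cexp a * _) /dcoef1 /GA /GB /pA /pB /= -(cexp_mono N).
  by ring.
exact: (fsumZ (W := R[i]^o)).
Qed.

Lemma monosum_swap c s1 s2 : fsup c ->
  monosum c s1 s2 = monosum (fun t => c (t.2, t.1)) s2 s1.
Proof.
move=> sc; rewrite /monosum.
rewrite -(fsum_reindex (phi := fun t : T => (t.2, t.1)) (psi := fun t : T => (t.2, t.1)))/=.
- by apply: fsum_ext => t; rewrite mulrAC.
- by case.
- by case.
- by case: sc => s c0; exists s => t /c0 ->; rewrite !mul0r.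
Qed.

Lemma fsup_swap (c : T -> C) : fsup c -> fsup (fun t : T => c (t.2, t.1)).
Proof.
move=> [s c0]; exists [seq (t.2, t.1) | t <- s] => t ts; apply: c0; apply: contra ts => ts.
by apply/mapP; exists (t.2, t.1) => //; case: (t).
Qed.

Lemma fsup_dcoef2 (c : T -> C) : fsup c -> fsup (dcoef2 c).
Proof.
move=> [s c0]; exists ([seq (t.1, (t.2.1 + 1, t.2.2)) | t <- s]
    ++ [seq (t.1, (t.2.1 + 1, t.2.2.-1)) | t <- s]) => t.
rewrite mem_cat negb_or => /andP[tA tB].
rewrite /dcoef2 !c0 ?mulr0 ?addr0//.
  apply: contra tB => tB; apply/mapP; exists (t.1, (t.2.1 - 1, t.2.2.+1)) => //=.
  by rewrite subrK; case: (t) => ? [].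
apply: contra tA => tA; apply/mapP; exists (t.1, (t.2.1 - 1, t.2.2)) => //=.
by rewrite subrK; case: (t) => ? [].
Qed.

Lemma monosum_der2 c a b : fsup c ->
  der2 (monosum c) a b (cexp b * monosum (dcoef2 c) a b).
Proof.
move=> sc; have := monosum_der1 b a (fsup_swap sc).
rewrite (monosum_swap _ _ (fsup_dcoef2 sc)).
by congr is_derive; apply/funext => z; rewrite [RHS](monosum_swap _ _ sc).
Qed.

Lemma monosumD c d s1 s2 : fsup c -> fsup d ->
  monosum (fun t => c t + d t) s1 s2 = monosum c s1 s2 + monosum d s1 s2.
Proof.
move=> sc sd; rewrite /monosum -fsumD; last 2 first.
- by apply: fsupMl; exact: fsupMl.
- by apply: fsupMl; exact: fsupMl.
by apply: fsum_ext => t; rewrite !mulrDl.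
Qed.

End Monomials.

(** * Families of coefficients *)

Section CoefficientFamilies.
Context {R : realType}.
Local Notation C := R[i].
Local Notation T := ((C * nat) * (C * nat))%type.

(** For homogeneous vectors the weights determine both exponents, and only the powers of the
    logarithms remain free below K. *)
Definition conc (K : nat) (N1 N2 : C) (c : T -> C) : Prop := forall t, c t != 0 ->
  [/\ (t.1.2 < K)%N, (t.2.2 < K)%N, t.1.1 = N1 & t.2.1 = N2].

Let conc_seq K N1 N2 : seq T :=
  [seq ((N1, i), (N2, j)) | i <- seq.iota 0 K, j <- seq.iota 0 K].

Let conc_seq0 K N1 N2 c t : conc K N1 N2 c -> t \notin conc_seq K N1 N2 -> c t = 0.
Proof.
move=> c0 ts; apply/eqP; apply: contraNT ts; case: t => [[M1 k1] [M2 k2]].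
move=> /c0[/= k1K k2K -> ->].
by apply/allpairsP; exists (k1, k2); rewrite !mem_iota.
Qed.

Lemma conc_fsup K N1 N2 c : conc K N1 N2 c -> fsup c.
Proof. by move=> c0; exists (conc_seq K N1 N2) => t; exact: conc_seq0. Qed.

Lemma monosum_conc K N1 N2 c s1 s2 : conc K N1 N2 c -> monosum c s1 s2 =
  \sum_(i < K) \sum_(j < K)
    c ((N1, i : nat), (N2, j : nat)) * mono (N1, i : nat) s1 * mono (N2, j : nat) s2.
Proof.
move=> c0; rewrite /monosum (fsum_seq (s := conc_seq K N1 N2)); last first.
- by move=> t ts; rewrite (conc_seq0 c0 ts) !mul0r.
- apply: allpairs_uniq; rewrite ?iota_uniq// => -[i j] [i' j'] _ _ /=.
  by move=> [-> ->].
rewrite big_allpairs_dep.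
have iE : seq.iota 0 K = index_iota 0 K by rewrite /index_iota subn0.
by rewrite iE big_mkord; apply: eq_bigr => i _; rewrite big_mkord.
Qed.

(** With these indices the exponents of x_1 and x_2 are al - n and be + n, so the n-th term is a
    polynomial in s1 and s2 times e^(al s1 + be s2) e^(n (s2 - s1)), as [good_polylog] requires. *)
Lemma good_monosum (c : R -> T -> C) (K : nat) (al be : C) :
  (forall n, conc K (n%:C - al - 1) (- n%:C - be - 1) (c n)) ->
  (forall s1 s2, ReGt s1 s2 -> abs_cvg (fun n => monosum (c n) s1 s2)) ->
  good ReGt (fun n s1 s2 => monosum (c n) s1 s2).
Proof.
move=> c0; pose a i j n := c n ((n%:C - al - 1, i), (- n%:C - be - 1, j)).
have mE n s1 s2 : (\sum_(i < K) \sum_(j < K) a i j n * s1 ^+ i * s2 ^+ j)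
       * (cexp (al * s1 + be * s2) * cexp (n%:C * (s2 - s1))) = monosum (c n) s1 s2.
  rewrite (monosum_conc _ _ (c0 n)) mulr_suml; apply: eq_bigr => i _.
  rewrite mulr_suml; apply: eq_bigr => j _.
  rewrite /mono/= /a; set x := c n _.
  have -> : cexp (al * s1 + be * s2) * cexp (n%:C * (s2 - s1)) =
      cexp ((- (n%:C - al - 1) - 1) * s1) * cexp ((- (- n%:C - be - 1) - 1) * s2).
    by rewrite -!cexpD; congr cexp; ring.
  by ring.
move=> sc; apply: (good_eq mE); apply: good_polylog => s1 s2 /sc.
by congr abs_cvg; apply/funext => n; rewrite mE.
Qed.

Context (Om : C -> C -> Prop) (Om_open : open2 Om).

Definition good_coef (c : R -> T -> C) : Prop :=
  (forall n, fsup (c n)) /\ good Om (fun n s1 s2 => monosum (c n) s1 s2).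

Lemma good_coef0 : good_coef (fun _ _ => 0).
Proof.
split=> [n|]; first exact: fsup0.
apply: (good_eq _ (good_sum Om_open (nil : seq void) (T := fun _ _ _ _ => 0) _)).
  by move=> n x y; rewrite big_nil /monosum fsbig1// => t _; rewrite !mul0r.
by case.
Qed.

Lemma good_coefD c d : good_coef c -> good_coef d ->
  good_coef (fun n t => c n t + d n t).
Proof.
move=> [sc gc] [sd gd]; split=> [n|]; first exact: fsupD.
by apply: (good_eq _ (goodD Om_open gc gd)) => n x y; rewrite monosumD.
Qed.

Lemma good_coef_eq c d : (forall n t, c n t = d n t) -> good_coef c -> good_coef d.
Proof. by move=> e; congr good_coef; apply/funext => n; apply/funext => t; exact: e. Qed.

Lemma good_coef_sum (K : Type) (r : seq K) (c : K -> R -> T -> C) :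
  (forall k, good_coef (c k)) -> good_coef (fun n t => \sum_(k <- r) c k n t).
Proof.
move=> gc; elim: r => [|k r IH].
  by apply: good_coef_eq good_coef0 => n t; rewrite big_nil.
by apply: good_coef_eq (good_coefD (gc k) IH) => n t; rewrite big_cons.
Qed.

Context {X : Type} (c : X -> R -> T -> C) (gc : forall x, good_coef (c x)).
Context (d1 : X -> X) (d2 : X -> seq X) (sh : R).
Hypothesis c1 : forall x n t, dcoef1 (c x n) t = c (d1 x) n t.
Hypothesis c2 : forall x n t, dcoef2 (c x n) t = \sum_(y <- d2 x) c y (n + sh) t.

Definition coef_sum (x : X) : C -> C -> C := sumF (fun n s1 s2 => monosum (c x n) s1 s2).

Lemma coef_sum_cvg x a b : Om a b -> abs_cvg (fun n => monosum (c x n) a b).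
Proof. by move=> /(gc x).2[D1 [D2 g]]; exact: good_cvg g. Qed.

Lemma coef_sum_analytic x a b : Om a b -> analytic2_at (coef_sum x) a b.
Proof. by move=> /(gc x).2[D1 [D2 g]]; exact: good_an g. Qed.

Lemma coef_sum_der1 x a b : Om a b ->
  der1 (coef_sum x) a b (cexp a * coef_sum (d1 x) a b).
Proof.
move=> om; have [D1 [D2 g]] := (gc x).2 a b om.
have <- : sumC D1 = cexp a * coef_sum (d1 x) a b; last exact: good_sum1 g.
rewrite /coef_sum /sumF -sumCZ; last exact: coef_sum_cvg.
apply: eq_sumC => n; have := monosum_der1 a b ((gc x).1 n).
rewrite (_ : dcoef1 (c x n) = c (d1 x) n); last by apply/funext => t; exact: c1.
exact: der1_uniq (good_der1 g n).
Qed.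

(** Derivatives are unique, so the recorded [D2] is the family given by [dcoef2]. The shift by [sh]
    is a bijection of the real indices and does not change the sum; it is 0 for products and 1 for
    iterates. *)
Lemma coef_sum_der2 x a b : Om a b ->
  der2 (coef_sum x) a b (cexp b * \sum_(y <- d2 x) coef_sum y a b).
Proof.
move=> om; have [D1 [D2 g]] := (gc x).2 a b om.
have <- : sumC D2 = cexp b * \sum_(y <- d2 x) coef_sum y a b; last exact: good_sum2 g.
have shi : injective (fun n : R => n + sh) := addIr sh.
have scy y : abs_cvg (fun n => monosum (c y (n + sh)) a b).
  exact: (abs_cvg_sub shi (coef_sum_cvg y om)).
have -> : \sum_(y <- d2 x) coef_sum y a b
    = sumC (fun n => \sum_(y <- d2 x) monosum (c y (n + sh)) a b).
  rewrite sumC_sum//; apply: eq_bigr => y _; rewrite /coef_sum /sumF.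
  rewrite (sumC_inj (f := fun n => monosum (c y n) a b) shi)// => n e; have := e (n - sh).
  by rewrite subrK eqxx.
rewrite -sumCZ; last exact: abs_cvg_sum.
apply: eq_sumC => n; have := monosum_der2 a b ((gc x).1 n).
rewrite (_ : dcoef2 (c x n) = fun t => \sum_(y <- d2 x) c y (n + sh) t); last first.
  by apply/funext => t; exact: c2.
rewrite (_ : monosum _ a b = \sum_(y <- d2 x) monosum (c y (n + sh)) a b).
  exact: der2_uniq (good_der2 g n).
rewrite /monosum -(fsum_sum _ _).2.
  by apply: fsum_ext => t; rewrite !mulr_suml.
by move=> y; apply: fsupMl; apply: fsupMl; exact: (gc y).1.
Qed.

End CoefficientFamilies.

Section Concentrated.
Context {R : realType} {A At : zmodType} {emb : {additive A -> At}}.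
Context {V : vertex_algebra R A} {W : gmodule emb V}.
Local Notation C := R[i].

Definition concentrated (h : C) (f : {scalar W}) : Prop :=
  forall m w, homog (gm_wt W) m w -> m != h -> f w = 0.

Lemma graded_dual_dec (f : {scalar W}) : graded_dual f ->
  exists (s : seq C) (g : C -> {scalar W}),
    [/\ forall h, graded_dual (g h), forall h, concentrated h (g h)
      & forall w, f w = \sum_(h <- s) g h w].
Proof.
move=> df; have [s0 s0E] := graded_dual_completion df.
pose s := undup s0.
have sE n w : homog (gm_wt W) n w -> n \notin s -> f w = 0.
  by move=> wn ns; apply: s0E wn _; rewrite -mem_undup.
exists s, (fun h => (f \o gm_wt W h : {scalar W})); split.
- move=> h; have [r _ rE] := graded_dual_sum df.
  apply: (graded_dualP (s := r)) => b n w wb wn bnr.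
  rewrite -[LHS]/(f (gm_wt W h w)); have [->|nh] := eqVneq h n; last first.
    by rewrite (proj_homog0 wn nh) (sc0 (scP f)).
  rewrite (proj_homog wn) rE big_seq big1// => -[b' n'] bn' /=.
  have [n'E|n'E] := eqVneq n' n; last by rewrite (proj_homog0 wn n'E) linear0 (sc0 (scP f)).
  rewrite n'E (proj_homog wn); have [b'E|b'E] := eqVneq b' b; last first.
    by rewrite (proj_homog0 wb b'E) (sc0 (scP f)).
  by move: bn'; rewrite n'E b'E (negbTE bnr).
- move=> h m w wm mh; rewrite -[LHS]/(f (gm_wt W h w)) (proj_homog0 wm).
    exact: (sc0 (scP f)).
  by rewrite eq_sym.
apply: (grading_ind (g := gm_wt W)).
- by rewrite (sc0 (scP f)) big1// => h _; rewrite /= !linear0.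
- move=> u v uE vE; rewrite (scD (scP f)) uE vE -big_split; apply: eq_bigr => h _ /=.
  by rewrite !linearD.
move=> n w wn; have [ns|ns] := boolP (n \in s).
  rewrite (bigD1_seq n) ?undup_uniq//= (proj_homog wn) big1 ?addr0// => h hn.
  by rewrite (proj_homog0 wn hn) (sc0 (scP f)).
rewrite (sE _ _ wn ns) big_seq big1// => h hs /=.
by rewrite (proj_homog0 wn) ?(sc0 (scP f))//; apply: contraNneq ns => <-.
Qed.

End Concentrated.

Lemma ReGt_cexp (R : realType) (s1 s2 : R[i]) : ReGt s1 s2 ->
  `|cexp s1| > `|cexp s2| /\ `|cexp s2| > 0.
Proof.
move=> h; rewrite normr_gt0 cexp_neq0; split => //.
by rewrite !normE ltcR !nm_cexp ltr_expR.
Qed.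

(** * Products *)

Section ProductTerms.
Context {R : realType} {A At : zmodType} {emb : {additive A -> At}}.
Context {V : vertex_algebra R A} (cat : gmodule emb V -> Prop).
Hypothesis cat_conv : convergence_condition cat.
Context {W1 W2 W3 W4 M1 : gmodule emb V}.
Hypotheses (catW1 : cat W1) (catW2 : cat W2) (catW3 : cat W3) (catW4 : cat W4)
  (catM1 : cat M1).
Local Notation C := R[i].
Local Notation T := ((C * nat) * (C * nat))%type.
Context (Y1 : W1 -> C -> nat -> M1 -> W4) (Y2 : W2 -> C -> nat -> W3 -> M1).
Hypotheses (Y1_int : log_intertwining Y1) (Y2_int : log_intertwining Y2).
Context (K : nat) (Y1K : forall w1 w2 n k, (K <= k)%N -> Y1 w1 n k w2 = 0)
  (Y2K : forall w1 w2 n k, (K <= k)%N -> Y2 w1 n k w2 = 0).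

Definition product_coef (w3 : W3) (w4' : {scalar W4}) (w : W1 * W2) (n : R) (t : T) : C :=
  w4' (Y1 w.1 t.1.1 t.1.2 (gm_wt M1 n%:C (Y2 w.2 t.2.1 t.2.2 w3))).

(** The intermediate weight gives n = h2 + h3 - N2 - 1, and the functional, concentrated in weight
    h4, gives h4 = h1 + n - N1 - 1. *)
Lemma product_coef_homog h1 h2 h3 h4 w1 w2 w3 w4' : homog (gm_wt W1) h1 w1 ->
  homog (gm_wt W2) h2 w2 -> homog (gm_wt W3) h3 w3 -> concentrated h4 w4' ->
  forall n, conc K (n%:C - (h4 - h1) - 1) (- n%:C - (- h2 - h3) - 1)
    (product_coef w3 w4' (w1, w2) n).
Proof.
move=> w1h w2h w3h w4h n [[N1 k1] [N2 k2]]; rewrite /product_coef/=.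
have [k1K|k1K] := ltnP k1 K; last by rewrite Y1K// (sc0 (scP w4')) eqxx.
have [k2K|k2K] := ltnP k2 K; last first.
  by rewrite Y2K// linear0 (lin0 (li_linear2 Y1_int _ _ _)) (sc0 (scP w4')) eqxx.
have [e2|ne2] := eqVneq n%:C (h2 + h3 - N2 - 1); last first.
  rewrite (proj_homog0 (weight_li Y2_int N2 k2 w2h w3h) ne2).
  by rewrite (lin0 (li_linear2 Y1_int _ _ _)) (sc0 (scP w4')) eqxx.
have yh := weight_li Y1_int N1 k1 w1h (homog_proj (gm_wt M1) n%:C (Y2 w2 N2 k2 w3)).
have [e1|ne1] := eqVneq (h1 + n%:C - N1 - 1) h4; last by rewrite (w4h _ _ yh ne1) eqxx.
by split => //; rewrite -?e1 ?e2; ring.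
Qed.

Lemma product_coef_good_homog h1 h2 h3 h4 w1 w2 w3 w4' : homog (gm_wt W1) h1 w1 ->
  homog (gm_wt W2) h2 w2 -> homog (gm_wt W3) h3 w3 -> concentrated h4 w4' ->
  graded_dual w4' -> good_coef ReGt (product_coef w3 w4' (w1, w2)).
Proof.
move=> w1h w2h w3h w4h dw; have c0 := product_coef_homog w1h w2h w3h w4h.
split=> [n|]; first exact: conc_fsup (c0 n).
apply: (good_monosum c0) => s1 s2 s12; have [z12 z20] := ReGt_cexp s12.
have := cat_conv catW1 catW2 catW3 catW4 catM1 z12 z20
  (log_map_intertwining Y1_int Y1K s1) (log_map_intertwining Y2_int Y2K s2) w1 w2 w3 dw.
(* The convergence condition sums over all complex weights, the series over the real ones. *)
have ri : injective (fun n : R => n%:C) by move=> x y [].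
move=> /(abs_cvg_sub ri); congr abs_cvg; apply/funext => n /=.
pose N1 : C := n%:C - (h4 - h1) - 1; pose N2 : C := - n%:C - (- h2 - h3) - 1.
rewrite /pairing (fsum1 (i0 := h4)) => [|m mh]; last first.
  by apply: w4h mh; exact: log_map_completion.
have cn : homog (gm_wt M1) n%:C (log_map (Y := Y2) s2 w2 w3 n%:C) by exact: log_map_completion.
rewrite (log_map_homog Y1_int Y1K _ w1h cn (N := N1)); last by rewrite /N1; ring.
rewrite (log_map_homog Y2_int Y2K _ w2h w3h (N := N2)); last by rewrite /N2; ring.
rewrite (sc_sum (scP w4')) (monosum_conc _ _ (c0 n)); apply: eq_bigr => i _.
rewrite (scZ (scP w4')) (lin_sum (li_linear2 Y1_int _ _ _)) (sc_sum (scP w4')) mulr_sumr.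
apply: eq_bigr => j _; rewrite (linZ (li_linear2 Y1_int _ _ _)) (scZ (scP w4')).
rewrite /product_coef /= -/N1 -/N2 (proj_homog (g := gm_wt M1)).
  by ring.
have := weight_li Y2_int N2 j w2h w3h.
by rewrite (_ : h2 + h3 - N2 - 1 = n%:C)//; rewrite /N2; ring.
Qed.

Lemma product_coef_good w3 w4' w1 w2 : graded_dual w4' ->
  good_coef ReGt (product_coef w3 w4' (w1, w2)).
Proof.
have o := @ReGt_open R.
move=> /graded_dual_dec[s [g [dg cg gE]]].
apply: (good_coef_eq (c := fun n t => \sum_(h <- s) product_coef w3 (g h) (w1, w2) n t)).
  by move=> n t; rewrite /product_coef gE.
apply: good_coef_sum => // h; move: (g h) (dg h) (cg h) => f df cf {g dg cg gE}.
have fP := scP f; have l1 := li_linear1 Y1_int; have l2 := li_linear2 Y1_int.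
have l1' := li_linear1 Y2_int; have l2' := li_linear2 Y2_int.
move: w1; apply: (grading_ind (g := gm_wt W1)).
- apply: good_coef_eq (good_coef0 o) => n t.
  by rewrite /product_coef/= (lin0 (l1 _ _ _)) (sc0 fP).
- move=> u v gu gv; apply: good_coef_eq (good_coefD o gu gv) => n t.
  by rewrite /product_coef/= (linD (l1 _ _ _)) (scD fP).
move=> h1 w1 w1h; move: w2; apply: (grading_ind (g := gm_wt W2)).
- apply: good_coef_eq (good_coef0 o) => n t.
  by rewrite /product_coef/= (lin0 (l1' _ _ _)) linear0 (lin0 (l2 _ _ _)) (sc0 fP).
- move=> u v gu gv; apply: good_coef_eq (good_coefD o gu gv) => n t.
  by rewrite /product_coef/= (linD (l1' _ _ _)) linearD (linD (l2 _ _ _)) (scD fP).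
move=> h2 w2 w2h; move: w3; apply: (grading_ind (g := gm_wt W3)).
- apply: good_coef_eq (good_coef0 o) => n t.
  by rewrite /product_coef/= (lin0 (l2' _ _ _)) linear0 (lin0 (l2 _ _ _)) (sc0 fP).
- move=> u v gu gv; apply: good_coef_eq (good_coefD o gu gv) => n t.
  by rewrite /product_coef/= (linD (l2' _ _ _)) linearD (linD (l2 _ _ _)) (scD fP).
by move=> h3 w3 w3h; exact: product_coef_good_homog w1h w2h w3h cf df.
Qed.

Definition product_d1 (w : W1 * W2) := (Lop (gm_L W1) (-1) w.1, w.2).
Definition product_d2 (w : W1 * W2) := [:: (w.1, Lop (gm_L W2) (-1) w.2)].

Lemma product_dcoef1 w3 w4' w n t : dcoef1 (product_coef w3 w4' w n) t
  = product_coef w3 w4' (product_d1 w) n t.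
Proof.
rewrite /product_coef /dcoef1 /= (li_Lneg1 Y1_int).
by rewrite (scD (scP w4')) !(scZ (scP w4')).
Qed.

Lemma product_dcoef2 w3 w4' w n t : dcoef2 (product_coef w3 w4' w n) t
  = \sum_(y <- product_d2 w) product_coef w3 w4' y (n + 0) t.
Proof.
rewrite big_seq1 addr0 /product_coef /dcoef2 /= (li_Lneg1 Y2_int) linearD !linearZ/=.
by rewrite (linD (li_linear2 Y1_int _ _ _)) !(linZ (li_linear2 Y1_int _ _ _))
  (scD (scP w4')) !(scZ (scP w4')).
Qed.

End ProductTerms.

(** * Iterates *)

Section IterateTerms.
Context {R : realType} {A At : zmodType} {emb : {additive A -> At}}.
Context {V : vertex_algebra R A} (cat : gmodule emb V -> Prop).
Hypothesis cat_conv : convergence_condition cat.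
Context {W1 W2 W3 W4 M2 : gmodule emb V}.
Hypotheses (catW1 : cat W1) (catW2 : cat W2) (catW3 : cat W3) (catW4 : cat W4)
  (catM2 : cat M2).
Local Notation C := R[i].
Local Notation T := ((C * nat) * (C * nat))%type.
Context (Y1 : M2 -> C -> nat -> W3 -> W4) (Y2 : W1 -> C -> nat -> W2 -> M2).
Hypotheses (Y1_int : log_intertwining Y1) (Y2_int : log_intertwining Y2).
Context (K : nat) (Y1K : forall w1 w2 n k, (K <= k)%N -> Y1 w1 n k w2 = 0)
  (Y2K : forall w1 w2 n k, (K <= k)%N -> Y2 w1 n k w2 = 0).

Definition iterate_coef (w3 : W3) (w4' : {scalar W4}) (w : W1 * W2) (n : R) (t : T) : C :=
  w4' (Y1 (gm_wt M2 n%:C (Y2 w.1 t.1.1 t.1.2 w.2)) t.2.1 t.2.2 w3).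

(** The two variables are exchanged: the outer operator has the larger variable, which
    [good_monosum] expects first. *)
Lemma iterate_coef_homog h1 h2 h3 h4 w1 w2 w3 w4' : homog (gm_wt W1) h1 w1 ->
  homog (gm_wt W2) h2 w2 -> homog (gm_wt W3) h3 w3 -> concentrated h4 w4' ->
  forall n, conc K (n%:C - (h4 - h3) - 1) (- n%:C - (- h1 - h2) - 1)
    (fun t => iterate_coef w3 w4' (w1, w2) n (t.2, t.1)).
Proof.
move=> w1h w2h w3h w4h n [[N1 k1] [N2 k2]]; rewrite /iterate_coef/=.
have [k1K|k1K] := ltnP k1 K; last by rewrite Y1K// (sc0 (scP w4')) eqxx.
have [k2K|k2K] := ltnP k2 K; last first.
  by rewrite Y2K// linear0 (lin0 (li_linear1 Y1_int _ _ _)) (sc0 (scP w4')) eqxx.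
have [e2|ne2] := eqVneq n%:C (h1 + h2 - N2 - 1); last first.
  rewrite (proj_homog0 (weight_li Y2_int N2 k2 w1h w2h) ne2).
  by rewrite (lin0 (li_linear1 Y1_int _ _ _)) (sc0 (scP w4')) eqxx.
have yh := weight_li Y1_int N1 k1 (homog_proj (gm_wt M2) n%:C (Y2 w1 N2 k2 w2)) w3h.
have [e1|ne1] := eqVneq (n%:C + h3 - N1 - 1) h4; last by rewrite (w4h _ _ yh ne1) eqxx.
by split => //; rewrite -?e1 ?e2; ring.
Qed.

Lemma iterate_coef_good_homog h1 h2 h3 h4 w1 w2 w3 w4' : homog (gm_wt W1) h1 w1 ->
  homog (gm_wt W2) h2 w2 -> homog (gm_wt W3) h3 w3 -> concentrated h4 w4' ->
  graded_dual w4' -> good_coef ReLt (iterate_coef w3 w4' (w1, w2)).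
Proof.
move=> w1h w2h w3h w4h dw; have c0 := iterate_coef_homog w1h w2h w3h w4h.
have sc n : fsup (iterate_coef w3 w4' (w1, w2) n).
  by have [s h] := fsup_swap (conc_fsup (c0 n)); exists s => -[t1 t2] /h.
split => //.
have : good ReGt (fun n s1 s2 =>
    monosum (fun t => iterate_coef w3 w4' (w1, w2) n (t.2, t.1)) s1 s2); last first.
  by move=> /good_swap; apply: good_eq => n x y; rewrite [RHS]monosum_swap.
apply: (good_monosum c0) => s1 s2 s12; have [z12 z20] := ReGt_cexp s12.
have := convergence_iterate cat_conv catW1 catW2 catW3 catW4 catM2 z12 z20
  (log_map_intertwining Y1_int Y1K s1) (log_map_intertwining Y2_int Y2K s2) w1 w2 w3 dw.
have ri : injective (fun n : R => n%:C) by move=> x y [].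
move=> /(abs_cvg_sub ri); congr abs_cvg; apply/funext => n /=.
pose N1 : C := n%:C - (h4 - h3) - 1; pose N2 : C := - n%:C - (- h1 - h2) - 1.
rewrite /pairing (fsum1 (i0 := h4)) => [|m mh]; last first.
  by apply: w4h mh; exact: log_map_completion.
have cn : homog (gm_wt M2) n%:C (log_map (Y := Y2) s2 w1 w2 n%:C) by exact: log_map_completion.
rewrite (log_map_homog Y1_int Y1K _ cn w3h (N := N1)); last by rewrite /N1; ring.
rewrite (log_map_homog Y2_int Y2K _ w1h w2h (N := N2)); last by rewrite /N2; ring.
rewrite (sc_sum (scP w4')) (monosum_conc _ _ (c0 n)); apply: eq_bigr => i _.
rewrite (scZ (scP w4')) (lin_sum (li_linear1 Y1_int _ _ _)) (sc_sum (scP w4')) mulr_sumr.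
apply: eq_bigr => j _; rewrite (linZ (li_linear1 Y1_int _ _ _)) (scZ (scP w4')).
rewrite /iterate_coef /= -/N1 -/N2 (proj_homog (g := gm_wt M2)).
  by ring.
have := weight_li Y2_int N2 j w1h w2h.
by rewrite (_ : h1 + h2 - N2 - 1 = n%:C)//; rewrite /N2; ring.
Qed.

Lemma iterate_coef_good w3 w4' w1 w2 : graded_dual w4' ->
  good_coef ReLt (iterate_coef w3 w4' (w1, w2)).
Proof.
have o := @ReLt_open R.
move=> /graded_dual_dec[s [g [dg cg gE]]].
apply: (good_coef_eq (c := fun n t => \sum_(h <- s) iterate_coef w3 (g h) (w1, w2) n t)).
  by move=> n t; rewrite /iterate_coef gE.
apply: good_coef_sum => // h; move: (g h) (dg h) (cg h) => f df cf {g dg cg gE}.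
have fP := scP f; have l1 := li_linear1 Y1_int; have l2 := li_linear2 Y1_int.
have l1' := li_linear1 Y2_int; have l2' := li_linear2 Y2_int.
move: w1; apply: (grading_ind (g := gm_wt W1)).
- apply: good_coef_eq (good_coef0 o) => n t.
  by rewrite /iterate_coef/= (lin0 (l1' _ _ _)) linear0 (lin0 (l1 _ _ _)) (sc0 fP).
- move=> u v gu gv; apply: good_coef_eq (good_coefD o gu gv) => n t.
  by rewrite /iterate_coef/= (linD (l1' _ _ _)) linearD (linD (l1 _ _ _)) (scD fP).
move=> h1 w1 w1h; move: w2; apply: (grading_ind (g := gm_wt W2)).
- apply: good_coef_eq (good_coef0 o) => n t.
  by rewrite /iterate_coef/= (lin0 (l2' _ _ _)) linear0 (lin0 (l1 _ _ _)) (sc0 fP).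
- move=> u v gu gv; apply: good_coef_eq (good_coefD o gu gv) => n t.
  by rewrite /iterate_coef/= (linD (l2' _ _ _)) linearD (linD (l1 _ _ _)) (scD fP).
move=> h2 w2 w2h; move: w3; apply: (grading_ind (g := gm_wt W3)).
- apply: good_coef_eq (good_coef0 o) => n t.
  by rewrite /iterate_coef/= (lin0 (l2 _ _ _)) (sc0 fP).
- move=> u v gu gv; apply: good_coef_eq (good_coefD o gu gv) => n t.
  by rewrite /iterate_coef/= (linD (l2 _ _ _)) (scD fP).
by move=> h3 w3 w3h; exact: iterate_coef_good_homog w1h w2h w3h cf df.
Qed.

Definition iterate_d1 (w : W1 * W2) := (Lop (gm_L W1) (-1) w.1, w.2).
Definition iterate_d2 (w : W1 * W2) :=
  [:: (Lop (gm_L W1) (-1) w.1, w.2); (w.1, Lop (gm_L W2) (-1) w.2)].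

Lemma iterate_dcoef1 w3 w4' w n t : dcoef1 (iterate_coef w3 w4' w n) t
  = iterate_coef w3 w4' (iterate_d1 w) n t.
Proof.
rewrite /iterate_coef /dcoef1 /= (li_Lneg1 Y2_int) linearD !linearZ/=.
by rewrite (linD (li_linear1 Y1_int _ _ _)) !(linZ (li_linear1 Y1_int _ _ _))
  (scD (scP w4')) !(scZ (scP w4')).
Qed.

Lemma Lneg1_proj (W : gmodule emb V) n w :
  Lneg1 (gm_L W) (gm_wt W n w) = gm_wt W (n + 1) (Lneg1 (gm_L W) w).
Proof.
move: w; apply: (grading_ind (g := gm_wt W)).
- by rewrite !linear0.
- by move=> u v uE vE; rewrite !linearD uE vE.
move=> h w wh; have := weight_L is_jN1 wh; rewrite opprK LopN1 => Lwh.
have [->|nh] := eqVneq n h; first by rewrite (proj_homog wh) (proj_homog Lwh).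
rewrite (proj_homog0 wh nh) linear0 (proj_homog0 Lwh)//.
by apply: contra nh => /eqP/addIr ->.
Qed.

(** L(-1) passes the projection by moving it from n to n + 1, and on Y2(w1, x_0) w2 it acts through
    both vectors by the L(-1)-bracket; hence two terms, both of index n + 1. *)
Lemma iterate_dcoef2 w3 w4' w n t : dcoef2 (iterate_coef w3 w4' w n) t
  = \sum_(y <- iterate_d2 w) iterate_coef w3 w4' y (n + 1) t.
Proof.
rewrite big_cons big_seq1 -(scD (scP w4')) -(linD (li_linear1 Y1_int _ _ _)) -linearD.
rewrite [X in gm_wt _ _ X]addrC /= !LopN1 -(Lbracket_N1 (li_Lbracket Y2_int _)).
rewrite rmorphD/= -Lneg1_proj -[Lneg1 _ _]/(Lop (gm_L M2) (-1) _) (li_Lneg1 Y1_int).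
by rewrite (scD (scP w4')) !(scZ (scP w4')).
Qed.

End IterateTerms.

Lemma pderiv_index_product (R : realType) (A At : zmodType) (emb : {additive A -> At})
    (V : vertex_algebra R A) (W1 W2 : gmodule emb V) k l (w1 : W1) (w2 : W2) :
  pderiv_index (@product_d1 R A At emb V W1 W2) (@product_d2 R A At emb V W1 W2) k l (w1, w2)
  = [:: (iter k (Lop (gm_L W1) (-1)) w1, iter l (Lop (gm_L W2) (-1)) w2)].
Proof.
rewrite /pderiv_index.
have -> : iter l (fun s => flatten [seq product_d2 y | y <- s]) [:: (w1, w2)]
    = [:: (w1, iter l (Lop (gm_L W2) (-1)) w2)].
  by elim: l => // l /= ->.
by rewrite /=; congr [:: _]; elim: k => // k /= ->.
Qed.

(** Pascal's rule. The summand is generalized so that one derivative can be absorbed into it at each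
    step, and the k derivatives in the first variable are absorbed beforehand. *)
Lemma pderiv_index_iterate (R : realType) (A At : zmodType) (emb : {additive A -> At})
    (V : vertex_algebra R A) (W1 W2 : gmodule emb V) (G : W1 * W2 -> R[i]) k l
    (w1 : W1) (w2 : W2) :
  \sum_(y <- pderiv_index (@iterate_d1 R A At emb V W1 W2) (@iterate_d2 R A At emb V W1 W2)
      k l (w1, w2)) G y
  = \sum_(j < l.+1) 'C(l, j)%:R * G (iter (k + j) (Lop (gm_L W1) (-1)) w1,
      iter (l - j) (Lop (gm_L W2) (-1)) w2).
Proof.
set L1 := Lop (gm_L W1) (-1); set L2 := Lop (gm_L W2) (-1).
rewrite /pderiv_index big_map.
pose H y := G (iter k (@iterate_d1 R A At emb V W1 W2) y).
have HE u v : H (u, v) = G (iter k L1 u, v) by rewrite /H; congr G; elim: k {H} => // k /= ->.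
rewrite -[LHS]/(\sum_(y <- _) H y).
under [RHS]eq_bigr => j _ do rewrite iterD -HE.
move: H {HE} => H; elim: l H => [|l IH] H.
  by rewrite big_seq1 big_ord_recl big_ord0 addr0 bin0 mul1r.
rewrite iterS big_flatten/= big_map.
under eq_bigr => y _ do rewrite big_cons big_seq1.
rewrite (IH (fun y => H (L1 y.1, y.2) + H (y.1, L2 y.2)))/=.
rewrite [RHS]big_ord_recl bin0 subn0.
under [X in _ = _ + X]eq_bigr => i _ do rewrite lift0 subSS binS natrD mulrDl.
rewrite big_split addrA.
under eq_bigr => i _ do rewrite mulrDr.
rewrite big_split/= addrC; congr (_ + _).
rewrite [in RHS]big_ord_recr/= bin_small// mul0r addr0 big_ord_recl/= bin0 subn0; congr (_ + _).
by apply: eq_bigr => i _; rewrite /bump/= add1n -[L2 (iter _ _ _)]iterS subnSK.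
Qed.

(** * The two regions and their coverings *)

Section Regions.
Context {R : realType}.
Local Notation C := R[i].

Lemma region_fst_gtP (z1 z2 : C) : region_fst_gt (z1, z2) <-> nm z2 < nm z1 /\ 0 < nm z2.
Proof. by rewrite /region_fst_gt/= normr_gt0 -nm_gt0 !normE ltcR. Qed.

Lemma region_fst_gt_open : open2 (fun z1 z2 : C => region_fst_gt (z1, z2)).
Proof.
move=> a b /region_fst_gtP[ba b0].
exists (Num.min ((nm a - nm b) / 2) (nm b)); first by rewrite lt_min b0 andbT; lra.
move=> h k; rewrite !lt_min => /andP[h1 _] /andP[k1 k2]; apply/region_fst_gtP.
have := nmD (a + h) (- h); have := nmD b k; have := nmD (b + k) (- k).
rewrite !addrK !nmN => *; split; lra.
Qed.

Lemma region_fst_gt_neq0 (z : C * C) : region_fst_gt z -> z.1 != 0 /\ z.2 != 0.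
Proof.
case: z => z1 z2 /region_fst_gtP[z21 z20]; rewrite -!nm_gt0; split => //.
exact: lt_trans z21.
Qed.

Lemma region_fst_gt_clog (z1 z2 : C) : z1 != 0 -> z2 != 0 ->
  region_fst_gt (z1, z2) <-> ReGt (clog z1) (clog z2).
Proof.
move=> z10 z20; rewrite region_fst_gtP nm_gt0 z20.
rewrite /ReGt -[complex.Re (clog z1)]/(ln (nm z1)) -[complex.Re (clog z2)]/(ln (nm z2)).
by rewrite ltr_ln ?posrE ?nm_gt0//; split => [[]|].
Qed.

Lemma region_snd_gt_open : open2 (fun z1 z2 : C => region_snd_gt (z1, z2)).
Proof. by move=> a b /region_fst_gt_open[r r0 h]; exists r => // x y xr yr; exact: h. Qed.

Lemma region_snd_gt_neq0 (z : C * C) : region_snd_gt z -> z.1 != 0 /\ z.2 != 0.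
Proof. by case: z => z1 z2 /(@region_fst_gt_neq0 (z2, z1))[]. Qed.

Lemma region_snd_gt_clog (z1 z2 : C) : z1 != 0 -> z2 != 0 ->
  region_snd_gt (z1, z2) <-> ReLt (clog z1) (clog z2).
Proof. by move=> z10 z20; exact: region_fst_gt_clog. Qed.

Lemma ReGt_Re (a b a' b' : C) : complex.Re a = complex.Re a' ->
  complex.Re b = complex.Re b' -> ReGt a b -> ReGt a' b'.
Proof. by rewrite /ReGt => -> ->. Qed.

Lemma ReLt_Re (a b a' b' : C) : complex.Re a = complex.Re a' ->
  complex.Re b = complex.Re b' -> ReLt a b -> ReLt a' b'.
Proof. by rewrite /ReLt /ReGt => -> ->. Qed.

End Regions.

Section Standing.
Context {R : realType} {A At : zmodType} {emb : {additive A -> At}}.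
Context {V : vertex_algebra R A} (cat : gmodule emb V -> Prop).
Hypothesis cat_standing : standing cat.

Lemma log_bounded (W1 W2 W3 : gmodule emb V) (Y : W1 -> R[i] -> nat -> W2 -> W3) :
  cat W1 -> cat W2 -> cat W3 -> log_intertwining Y ->
  exists K, forall w1 w2 n k, (K <= k)%N -> Y w1 n k w2 = 0.
Proof.
move=> /(st_nilpotent cat_standing)/nil_bound_st[K1 N1].
move=> /(st_nilpotent cat_standing)/nil_bound_st[K2 N2].
move=> /(st_nilpotent cat_standing)/nil_bound_st[K3 N3] Yint.
by exists (K1 + K2 + K3)%N => w1 w2 n k; exact: log_bound.
Qed.

End Standing.

Unset Implicit Arguments.

Theorem proposition7p14 (R : realType) (A At : zmodType)
    (iota : {additive A -> At}) (iota_inj : injective iota)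
    (V : vertex_algebra R A) (cat : gmodule iota V -> Prop)
    (cat_standing : standing cat) (cat_conv : convergence_condition cat)
    (W1 W2 W3 W4 M1 M2 : gmodule iota V)
    (catW1 : cat W1) (catW2 : cat W2) (catW3 : cat W3) (catW4 : cat W4)
    (catM1 : cat M1) (catM2 : cat M2) :
  (forall (Y1 : W1 -> R[i] -> nat -> M1 -> W4)
          (Y2 : W2 -> R[i] -> nat -> W3 -> M1)
          (Y1_int : log_intertwining Y1) (Y2_int : log_intertwining Y2)
          (w1 : W1) (w2 : W2) (w3 : W3) (w4' : {scalar W4})
          (w4'_dual : graded_dual w4'),
    let P := product_sum Y1 Y2 w3 w4' in
    [/\ forall (p q : int) (z1 z2 : R[i]), region_fst_gt (z1, z2) ->
          abs_cvg (product_term Y1 Y2 w3 w4' w1 w2 (lbranch p z1) (lbranch q z2)),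
        forall p q : int,
          analytic2_on (cut_region region_fst_gt) (P p q w1 w2),
        forall (p q : int) (k l : nat) (z1 z2 : R[i]),
          cut_region region_fst_gt (z1, z2) ->
          pderiv k l (P p q w1 w2) z1 z2
          = P p q (iter k (Lop (gm_L W1) (-1)) w1)
                  (iter l (Lop (gm_L W2) (-1)) w2) z1 z2,
        multivalued_branches region_fst_gt (fun p q => P p q w1 w2)
      & forall k l : nat,
          multivalued_branches region_fst_gt
            (fun p q => pderiv k l (P p q w1 w2))])
  /\
  (forall (Y1 : M2 -> R[i] -> nat -> W3 -> W4)
          (Y2 : W1 -> R[i] -> nat -> W2 -> M2)
          (Y1_int : log_intertwining Y1) (Y2_int : log_intertwining Y2)
          (w1 : W1) (w2 : W2) (w3 : W3) (w4' : {scalar W4})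
          (w4'_dual : graded_dual w4'),
    let Q := iterate_sum Y1 Y2 w3 w4' in
    [/\ forall (p q : int) (z0 z2 : R[i]), region_snd_gt (z0, z2) ->
          abs_cvg (iterate_term Y1 Y2 w3 w4' w1 w2 (lbranch p z0) (lbranch q z2)),
        forall p q : int,
          analytic2_on (cut_region region_snd_gt) (Q p q w1 w2),
        forall (p q : int) (k l : nat) (z0 z2 : R[i]),
          cut_region region_snd_gt (z0, z2) ->
          pderiv k l (Q p q w1 w2) z0 z2
          = \sum_(j < l.+1) 'C(l, j)%:R
              * Q p q (iter (k + j) (Lop (gm_L W1) (-1)) w1)
                      (iter (l - j) (Lop (gm_L W2) (-1)) w2) z0 z2,
        multivalued_branches region_snd_gt (fun p q => Q p q w1 w2)
      & forall k l : nat,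
          multivalued_branches region_snd_gt
            (fun p q => pderiv k l (Q p q w1 w2))]).
Proof.
split=> Y1 Y2 Y1_int Y2_int w1 w2 w3 w4' w4'_dual.
- have [Ka YKa] := log_bounded cat_standing catW1 catM1 catW4 Y1_int.
  have [Kb YKb] := log_bounded cat_standing catW2 catW3 catM1 Y2_int.
  (* One bound for the powers of both logarithms, as the interpolation uses a single K. *)
  have Y1K w w' n k : (maxn Ka Kb <= k)%N -> Y1 w n k w' = 0.
    by rewrite geq_max => /andP[/YKa].
  have Y2K w w' n k : (maxn Ka Kb <= k)%N -> Y2 w n k w' = 0.
    by rewrite geq_max => /andP[_ /YKb].
  (* [product_term] is convertible to [monosum] of these coefficients, and [product_sum] to the
     pullback of [coef_sum] by the branches. *)
  pose c := product_coef Y1 Y2 w3 w4'.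
  have gc x : good_coef ReGt (c x).
    case: x => u v.
    exact (product_coef_good cat_conv catW1 catW2 catW3 catW4 catM1 Y1_int Y2_int Y1K Y2K w3 u v w4'_dual).
  have D0 := @region_fst_gt_neq0 R; have DO := @region_fst_gt_clog R.
  have Dop := @region_fst_gt_open R; have ORe := @ReGt_Re R.
  have an := coef_sum_analytic gc.
  have d1 := coef_sum_der1 gc (product_dcoef1 Y2 Y1_int w3 w4').
  have d2 := coef_sum_der2 gc (product_dcoef2 Y1_int Y2_int w3 w4').
  have pE p q k l z1 z2 := pull_pderiv Dop D0 DO ORe d1 d2 p q k l (w1, w2) (z1 := z1) (z2 := z2).
  have mv := pull_multivalued DO ORe an.
  split.
  (* Convergence holds on the whole region, cut included, because the real parts of the logarithms
     alone decide membership in [ReGt]. *)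
  + move=> p q z1 z2 Dz; apply: (coef_sum_cvg gc (w1, w2)).
    have [z10 z20] := D0 _ Dz; have := (DO z1 z2 z10 z20).1 Dz.
    by apply: ORe; rewrite Re_lbranch.
  + move=> p q; exact: (pull_analytic D0 DO ORe an p q (w1, w2)).
  + move=> p q k l z1 z2 Dz.
    by have := pE p q k l z1 z2 Dz; rewrite pderiv_index_product big_seq1.
  + by apply: (mv [:: (w1, w2)]) => p q z1 z2 _; rewrite big_seq1.
  (* The list [pderiv_index] does not depend on p and q, so the derivatives are branches of one
     function too. *)
  + move=> k l; apply: mv => p q z1 z2; exact: pE.
- have [Ka YKa] := log_bounded cat_standing catM2 catW3 catW4 Y1_int.
  have [Kb YKb] := log_bounded cat_standing catW1 catW2 catM2 Y2_int.
  have Y1K w w' n k : (maxn Ka Kb <= k)%N -> Y1 w n k w' = 0.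
    by rewrite geq_max => /andP[/YKa].
  have Y2K w w' n k : (maxn Ka Kb <= k)%N -> Y2 w n k w' = 0.
    by rewrite geq_max => /andP[_ /YKb].
  pose c := iterate_coef Y1 Y2 w3 w4'.
  have gc x : good_coef ReLt (c x).
    case: x => u v.
    exact (iterate_coef_good cat_conv catW1 catW2 catW3 catW4 catM2 Y1_int Y2_int Y1K Y2K w3 u v w4'_dual).
  have D0 := @region_snd_gt_neq0 R; have DO := @region_snd_gt_clog R.
  have Dop := @region_snd_gt_open R; have ORe := @ReLt_Re R.
  have an := coef_sum_analytic gc.
  have d1 := coef_sum_der1 gc (iterate_dcoef1 Y1_int Y2_int w3 w4').
  have d2 := coef_sum_der2 gc (iterate_dcoef2 Y1_int Y2_int w3 w4').
  have pE p q k l z1 z2 := pull_pderiv Dop D0 DO ORe d1 d2 p q k l (w1, w2) (z1 := z1) (z2 := z2).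
  have mv := pull_multivalued DO ORe an.
  split.
  + move=> p q z1 z2 Dz; apply: (coef_sum_cvg gc (w1, w2)).
    have [z10 z20] := D0 _ Dz; have := (DO z1 z2 z10 z20).1 Dz.
    by apply: ORe; rewrite Re_lbranch.
  + move=> p q; exact: (pull_analytic D0 DO ORe an p q (w1, w2)).
  + move=> p q k l z1 z2 Dz.
    by have := pE p q k l z1 z2 Dz; rewrite pderiv_index_iterate.
  + by apply: (mv [:: (w1, w2)]) => p q z1 z2 _; rewrite big_seq1.
  + move=> k l; apply: mv => p q z1 z2; exact: pE.
Qed.
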